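(* Let $n,m\ge 1$ be integers, let $\Omega\subset \mathbb{C}^n\subset\mathbb{C}\mathbb{P}^n$ be a nonempty connected open set, and let $h\colon\Omega\to \mathbb{C}^m\subset \mathbb{C}\mathbb{P}^m$ be a minimally embedded holomorphic mapping such that $$n(k+1)+k<m<n(k+2)-\frac{k(k+1)}{2}$$ for some integer $k$. Then $h^*\omega_m$ is not the $1$-modification $\omega_{n,f}=\omega_n+f^*\omega_d$ for any positive integer $d$ and any holomorphic mapping $f\colon\Omega\to \mathbb{C}^d\subset \mathbb{C}\mathbb{P}^d$; that is, there are no such $d$ and $f$ with $h^*\omega_m=\omega_n+f^*\omega_d$ on $\Omega$.
   Context: $\omega_N$ denotes the $(1,1)$-form associated with the Fubini-Study metric on $\mathbb{C}\mathbb{P}^N$; in affine coordinates $w=(w_1,\ldots,w_N)\in\mathbb{C}^N\subset\mathbb{C}\mathbb{P}^N$ (the affine chart $w\mapsto[1:w]$), $$\omega_N=\frac{\sqrt{-1}}{2\pi}\,\partial\bar\partial\log\Big(1+\sum_{i=1}^N|w_i|^2\Big).$$ For a holomorphic mapping $\phi=(\phi_1,\ldots,\phi_N)\colon\Omega\to\mathbb{C}^N\subset\mathbb{C}\mathbb{P}^N$ on an open set $\Omega\subset\mathbb{C}^n$, $\phi^*\omega_N=\frac{\sqrt{-1}}{2\pi}\partial\bar\partial\log(1+\sum_{i=1}^N|\phi_i(z)|^2)$. The mapping $\phi$ is called minimally embedded if its image $\phi(\Omega)$ is not contained in a proper projective linear subspace of $\mathbb{C}\mathbb{P}^N$; equivalently,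 $1,\phi_1,\ldots,\phi_N$ are linearly independent over $\mathbb{C}$. *)

(* Defs.v *)
From HB Require Import structures.
From mathcomp Require Import all_boot all_order all_algebra.
From mathcomp Require Import complex.
From mathcomp Require Import boolp classical_sets reals topology normedtype.
From mathcomp Require Import derive exp trigo.

Set Implicit Arguments.
Unset Strict Implicit.
Unset Printing Implicit Defensive.

Import Order.TTheory GRing.Theory Num.Theory.
Import numFieldNormedType.Exports.

Local Open Scope classical_set_scope.
Local Open Scope ring_scope.
Local Open Scope complex_scope.

(* MathComp-Analysis gives the norm topology to abstract numFieldTypes only;
   this transfers it to the concrete field R[i]. *)
HB.instance Definition _ (R : realType) := NormedModule.copy R[i] R[i]^o.

Section Forms.
Variable R : realType.
Local Notation C := R[i].

(* A map defined on all of C^n, of which only the values on the open set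
   Omega matter; differentiability is C-linear (Frechet) differentiability. *)
Definition holomorphic_on (n N : nat) (Omega : set 'rV[C]_n)
    (phi : 'rV[C]_n -> 'rV[C]_N) : Prop :=
  forall z, Omega z -> differentiable phi z.

(* [row_mx 1 w] is the vector of homogeneous coordinates of [1 : w] in CP^N;
   projective linear subspaces of CP^N are the linear subspaces of C^(1 + N). *)
Definition minimally_embedded (n N : nat) (Omega : set 'rV[C]_n)
    (phi : 'rV[C]_n -> 'rV[C]_N) : Prop :=
  forall W : {vspace 'rV[C]_(1 + N)},
    (forall z, Omega z -> row_mx (1 : 'rV[C]_1) (phi z) \in W) -> W = fullv.

(* Derivative of [t |-> F (z + t v)] at the real time [t = 0]. *)
Definition real_derive (n : nat) (v : 'rV[C]_n) (F : 'rV[C]_n -> C)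
    (z : 'rV[C]_n) : C :=
  derive1 (fun t : R => complex.Re (F (z + t%:C *: v))) 0
  +i* derive1 (fun t : R => complex.Im (F (z + t%:C *: v))) 0.

(* Wirtinger derivatives, with z_j = x_j + i y_j:
   d/dz_j = (d/dx_j - i d/dy_j) / 2,  d/dzbar_j = (d/dx_j + i d/dy_j) / 2. *)
Definition wirtinger (n : nat) (j : 'I_n) (F : 'rV[C]_n -> C)
    (z : 'rV[C]_n) : C :=
  (real_derive (delta_mx 0 j) F z
   - 'i * real_derive ('i *: delta_mx 0 j) F z) / 2.

Definition wirtinger_bar (n : nat) (j : 'I_n) (F : 'rV[C]_n -> C)
    (z : 'rV[C]_n) : C :=
  (real_derive (delta_mx 0 j) F z
   + 'i * real_derive ('i *: delta_mx 0 j) F z) / 2.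

(* The matrix-valued function [a] stands for the (1,1)-form
   \sum_(j, k) a_(j, k) dz_j /\ dzbar_k; the dz_j /\ dzbar_k being linearly
   independent, equality of forms is equality of coefficient matrices. *)
Definition form11 (n : nat) : Type := 'rV[C]_n -> 'M[C]_n.

Definition ddbar (n : nat) (u : 'rV[C]_n -> C) : form11 n :=
  fun z => \matrix_(j, k) wirtinger j (wirtinger_bar k u) z.

Definition FS_potential (N : nat) (w : 'rV[C]_N) : R :=
  ln (1 + \sum_(i < N) Normc.normc (w 0 i) ^+ 2).

Definition FS (N : nat) : form11 N :=
  fun w => ('i / (2 * pi)%:C) *: ddbar (fun w => (FS_potential w)%:C) w.

(* For holomorphic phi, phi^* dw_a = \sum_j (d phi_a / dz_j) dz_j, and the entry
   (j, a) of ['J phi z] is d phi_a / dz_j (row vectors act on the left). *)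
Definition pullback (n N : nat) (phi : 'rV[C]_n -> 'rV[C]_N)
    (omega : form11 N) : form11 n :=
  fun z => 'J phi z *m omega (phi z) *m (map_mx conjc ('J phi z))^T.

Definition one_modification (n d : nat) (f : 'rV[C]_n -> 'rV[C]_d) : form11 n :=
  fun z => FS z + pullback f (@FS d) z.

End Forms.

Arguments FS {R} N.

(* Main.v *)
(* Write K_phi(z, w) = 1 + sum_j phi_j(z) conj(phi_j(w)), so that phi^* omega_N is
   d dbar log K_phi(z, z) up to a constant, and let q = K_h / (K_id K_f).  The
   equation of forms says that log q(z, z) is pluriharmonic.  Restricted to a
   complex line it becomes, after clearing denominators, the vanishing on the
   diagonal of a finite sum of products A_i(z) conj(B_i(w)) with A_i, B_i
   holomorphic; such a sum then vanishes off the diagonal as well, and integrating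
   in z and w gives q(z, z) q(w, w) = |q(z, w)|^2 for all z, w near a point p (two
   points lie on a line).  Hence q(z, w) q(p, p) / (q(z, p) q(p, w)) has modulus 1
   and is constant on lines through p, i.e. q(z, w) q(p, p) = q(z, p) q(p, w).

   So the kernels K_h and K_id K_f have the same rank near p.  As h is minimally
   embedded (and, by unique continuation, stays so near p) the rank of K_h is
   m + 1, while that of K_id K_f is the dimension s of the span of the functions
   z_a f_b, with z_0 = f_0 = 1.  If 1, f_1, ..., f_d span a space of dimension e then
   s <= (n + 1) e, and s >= (n + 1) r - r (r - 1) / 2 for every r <= e.  The bounds
   for e <= k + 1 and for r = k + 2 leave no room for m.

   Only the Cauchy theory of one variable is needed: complex differentiable
   functions are smooth, and they vanish near a point where all their derivatives
   do. *)
Require Import Defs.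
From HB Require Import structures.
From mathcomp Require Import all_boot all_order all_algebra.
From mathcomp Require Import complex ring lra zify.
From mathcomp Require Import boolp classical_sets reals topology normedtype.
From mathcomp Require Import derive realfun exp trigo.

Set Implicit Arguments.
Unset Strict Implicit.
Unset Printing Implicit Defensive.

Import Order.TTheory GRing.Theory Num.Theory.
Import numFieldNormedType.Exports.

Local Open Scope classical_set_scope.
Local Open Scope ring_scope.

(** * Cauchy theory in one variable *)

(** Polarization is proved for finite sums of products A_i(z) conj(B_i(w)), which is why
    denominators are cleared first. On the diagonal the Wirtinger derivative d / dz acts on the A_i
    alone, so every z-derivative of the sum vanishes there, and for fixed w the sum is a holomorphic
    function of z that is flat at z = w. Each appeal to flatness divides a radius by 8; the
    numerical radii 9, 19, 20 and 40 below leave room for this. The term r (r - 1) / 2 bounds the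
    dimension of the space of linear relations between the products z_a g_b, for r independent
    functions g_b: discarding one function at a time costs at most r - 1, r - 2, ..., 0 relations.
    With e <= k + 1 the upper bound becomes m <= n (k + 1) + k, and with r = k + 2 the lower one
    becomes m >= n (k + 2) - k (k + 1) / 2: exactly the negations of the two assumed
    inequalities. *)

Section ComplexLimits.
Variable R : realType.
Local Notation C := (R[i]%C).
Local Notation nc := (@Normc.normc R).
Implicit Types (f g : C -> C) (a b c z w l : C) (K : C -> Prop) (e M : R).

Lemma nc_ge0 z : 0 <= nc z.
Proof. by case: z => x y; rewrite sqrtr_ge0. Qed.

Lemma ncB z w : nc (z - w) = nc (w - z).
Proof. by rewrite -normcN opprB. Qed.

Lemma ler_ncD z w : nc (z + w) <= nc z + nc w.
Proof. exact: le_normcD. Qed.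

Lemma ler_ncB z w : nc (z - w) <= nc z + nc w.
Proof. by rewrite -[X in _ <= _ + X]normcN le_normcD. Qed.

Lemma ler_nc_dist z w : nc z - nc w <= nc (z - w).
Proof. by have := ler_ncD (z - w) w; rewrite subrK; lra. Qed.

Lemma nc_real (x : R) : nc (x%:C)%C = `|x|.
Proof. by rewrite /= expr0n addr0 sqrtr_sqr. Qed.

Lemma nc_gt0 z : z != 0 -> 0 < nc z.
Proof.
move=> z0; rewrite lt0r nc_ge0 andbT; apply: contra z0 => /eqP/Normc.eq0_normc.
by move=> ->.
Qed.

Lemma nc_ReIm z : nc z <= `|complex.Re z| + `|complex.Im z|.
Proof.
rewrite {1}(complexE z) (le_trans (ler_ncD _ _))// Normc.normcM !nc_real.
by rewrite /= expr0n expr1n add0r sqrtr1 mul1r.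
Qed.

Lemma ReB z w : complex.Re (z - w) = complex.Re z - complex.Re w.
Proof. by case: z; case: w. Qed.

Lemma ImB z w : complex.Im (z - w) = complex.Im z - complex.Im w.
Proof. by case: z; case: w. Qed.

Lemma Re_le_nc z : `|complex.Re z| <= nc z.
Proof. by have := normc_ge_Re z; rewrite lecR. Qed.

Lemma Im_le_nc z : `|complex.Im z| <= nc z.
Proof.
have := Re_le_nc (z * 'i%C); rewrite ReiNIm normrN Normc.normcM.
by rewrite /= expr0n expr1n add0r sqrtr1 mulr1.
Qed.

Definition tends (u : nat -> C) l :=
  forall e, 0 < e -> exists N, forall n, (N <= n)%N -> nc (u n - l) <= e.

Lemma nc_le0 z : (forall e, 0 < e -> nc z <= e) -> z = 0.
Proof.
move=> h; apply/eqP/negPn/negP => /nc_gt0 z0.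
by have := h (nc z / 2); rewrite divr_gt0// => /(_ isT); lra.
Qed.

Lemma tends_unique u l l' : tends u l -> tends u l' -> l = l'.
Proof.
move=> hl hl'; apply/eqP; rewrite -subr_eq0; apply/eqP/nc_le0 => e e0.
have [N hN] := hl _ (divr_gt0 e0 (ltr0Sn _ 1)).
have [N' hN'] := hl' _ (divr_gt0 e0 (ltr0Sn _ 1)).
have := hN (N + N')%N (leq_addr _ _); have := hN' (N + N')%N (leq_addl _ _).
set v := u _; rewrite ncB => h1 h2.
have -> : l - l' = (l - v) - (l' - v) by ring.
by have := ler_ncB (l - v) (l' - v); rewrite (ncB l) (ncB l'); move: h1 h2; rewrite (ncB l'); lra.
Qed.

Lemma tends_cst l : tends (fun=> l) l.
Proof. by move=> e e0; exists 0%N => n _; rewrite subrr Normc.normc0 ltW. Qed.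

Lemma eq_tends u v l : u =1 v -> tends u l -> tends v l.
Proof. by move=> uv h e /h[N hN]; exists N => n /hN; rewrite uv. Qed.

Lemma tendsD u v l l' : tends u l -> tends v l' ->
  tends (fun n => u n + v n) (l + l').
Proof.
move=> hl hl' e e0.
have [N hN] := hl _ (divr_gt0 e0 (ltr0Sn _ 1)).
have [N' hN'] := hl' _ (divr_gt0 e0 (ltr0Sn _ 1)).
exists (N + N')%N => n hn.
have h1 := hN n (leq_trans (leq_addr _ _) hn).
have h2 := hN' n (leq_trans (leq_addl _ _) hn).
have -> : u n + v n - (l + l') = (u n - l) + (v n - l') by ring.
by have := ler_ncD (u n - l) (v n - l'); lra.
Qed.

Lemma tendsZ c u l : tends u l -> tends (fun n => c * u n) (c * l).
Proof.
move=> hl e e0; have c0 : 0 < nc c + 1 by have := nc_ge0 c; lra.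
have [N hN] := hl _ (divr_gt0 e0 c0); exists N => n /hN.
rewrite -mulrBr Normc.normcM ler_pdivlMr// => h.
have := nc_ge0 (u n - l); have := nc_ge0 c; nra.
Qed.

Lemma tendsN u l : tends u l -> tends (fun n => - u n) (- l).
Proof.
move=> /(tendsZ (-1)); rewrite mulN1r; apply: eq_tends => n.
by rewrite mulN1r.
Qed.

Lemma tends_le u l M : tends u l -> (forall n, nc (u n) <= M) -> nc l <= M.
Proof.
move=> h hM; apply/ler_addgt0Pr => e /h[N /(_ N (leqnn _)) hN].
have := hM N; have := ler_nc_dist l (u N); rewrite ncB; lra.
Qed.

(** The intervals of centre [u n] and radius [2 * M * 2^-1 ^+ n] are nested, and [s] is the supremum
    of their left ends. *)
Lemma real_nest (u : nat -> R) M :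
  (forall n, `|u n.+1 - u n| <= M * 2^-1 ^+ n) ->
  exists s : R, forall n, `|u n - s| <= 2 * M * 2^-1 ^+ n.
Proof.
move=> hu; set h := fun n : nat => 2 * M * 2^-1 ^+ n : R.
have hS n : h n.+1 = 2^-1 * h n by rewrite /h exprS; ring.
have M0 : 0 <= M by have := hu 0%N; rewrite mulr1; apply: le_trans.
have h0 n : 0 <= h n by rewrite /h !mulr_ge0// exprn_ge0// invr_ge0.
have step n : u n - h n <= u n.+1 - h n.+1 /\ u n.+1 + h n.+1 <= u n + h n.
  have := hu n; rewrite hS ler_norml => /andP[].
  have -> : M * 2^-1 ^+ n = 2^-1 * h n by rewrite /h; field.
  lra.
have up n k : u n - h n <= u (n + k)%N - h (n + k)%N.
  elim: k => [|k]; first by rewrite addn0.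
  by move=> /le_trans; apply; rewrite addnS; have [] := step (n + k)%N.
have dn n k : u (n + k)%N + h (n + k)%N <= u n + h n.
  elim: k => [|k]; first by rewrite addn0.
  by apply: le_trans; rewrite addnS; have [] := step (n + k)%N.
have cross n k : u k - h k <= u n + h n.
  have := up k n; have := dn n k; rewrite (addnC k n).
  by have := h0 (n + k)%N; lra.
pose E := [set x | exists n, x = u n - h n].
have ubE n : ubound E (u n + h n) by move=> _ [k ->].
have E0 : E !=set0 by exists (u 0%N - h 0%N), 0%N.
exists (sup E) => n; rewrite ler_norml; apply/andP; split.
  rewrite -/(h n); have := ge_sup E0 (ubE n); lra.
rewrite -/(h n); have : u n - h n <= sup E; last lra.
apply: ub_le_sup; last by exists n.
by exists (u 0%N + h 0%N); exact: ubE.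
Qed.

(** Common frame of the bisection arguments: [x] is a stage, [pt] its marked point, [dia] its size.
    The real and imaginary parts of the marked points each converge with error [2 * dia], whence the
    factor 4. *)
Lemma nest (T : Type) (P : T -> Prop) (pt : T -> C) (dia : T -> R) (x0 : T) :
  (forall x, P x -> exists y,
     [/\ P y, dia y = dia x / 2 & nc (pt y - pt x) <= dia x]) ->
  P x0 ->
  exists (x : nat -> T) l, forall n, [/\ P (x n),
    dia (x n) = dia x0 * 2^-1 ^+ n & nc (pt (x n) - l) <= 4 * dia (x n)].
Proof.
move=> step Px0.
have /choice[nxt hf] : forall x, exists y, P x ->
    [/\ P y, dia y = dia x / 2 & nc (pt y - pt x) <= dia x].
  move=> x.
  by have [/step[y hy]|nP] := pselect (P x); [exists y | exists x].
pose x n := iter n nxt x0.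
have Px n : P (x n) by elim: n => // n /hf[].
have dx n : dia (x n) = dia x0 * 2^-1 ^+ n.
  elim: n => [|n IH]; first by rewrite mulr1.
  by rewrite /x iterS; have [_ -> _] := hf _ (Px n); rewrite IH exprSr mulrA.
have hx n : nc (pt (x n.+1) - pt (x n)) <= dia x0 * 2^-1 ^+ n.
  by rewrite -dx; have [] := hf _ (Px n).
have [n|lr hlr] := @real_nest (fun n => complex.Re (pt (x n))) (dia x0).
  by rewrite -ReB; exact: le_trans (Re_le_nc _) (hx n).
have [n|li hli] := @real_nest (fun n => complex.Im (pt (x n))) (dia x0).
  by rewrite -ImB; exact: le_trans (Im_le_nc _) (hx n).
exists x, (lr +i* li)%C => n; split=> //; rewrite dx.
apply: le_trans (nc_ReIm _) _; have := hlr n; have := hli n.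
case: (pt (x n)) => u v /=; lra.
Qed.

Lemma exp2_lt M e : 0 < e -> exists n, M * 2^-1 ^+ n < e.
Proof.
move=> e0; set k := Num.bound (`|M| / e); exists k.
have hk : `|M| / e < k%:R by apply: archi_boundP; rewrite divr_ge0// ltW.
have h2 : k%:R <= 2 ^+ k :> R by rewrite -natrX ler_nat ltnW// ltn_expl.
rewrite exprVn ltr_pdivrMr ?exprn_gt0//.
apply: le_lt_trans (ler_norm M) _; rewrite mulrC -ltr_pdivrMr//.
exact: lt_le_trans hk h2.
Qed.

End ComplexLimits.

(** * Integrals along segments by repeated bisection *)

Section ContourIntegrals.
Variable R : realType.
Local Notation C := (R[i]%C).
Local Notation nc := (@Normc.normc R).

(* Iterated bisection with the midpoint rule on every piece: exact on affine
   functions, and compatible with halving a segment or splitting a triangle. *)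
Fixpoint midsum (f : C -> C) (n : nat) (a b : C) : C :=
  if n is n'.+1 then midsum f n' a ((a + b) / 2) + midsum f n' ((a + b) / 2) b
  else (b - a) * f ((a + b) / 2).

(** Stability under midpoints is the form of convexity that [midsum] sees, since it evaluates [f] at
    iterated midpoints of the ends. *)
Definition midconvex (K : C -> Prop) :=
  forall a b, K a -> K b -> K ((a + b) / 2).

Definition limclosed (K : C -> Prop) :=
  forall l, (forall e : R, 0 < e -> exists2 z, K z & nc (z - l) < e) -> K l.

Definition cont_on (K : C -> Prop) (f : C -> C) :=
  forall x, K x -> forall e : R, 0 < e -> exists2 d : R, 0 < d &
    forall y, K y -> nc (y - x) < d -> nc (f y - f x) <= e.

Lemma nc_half (z : C) : nc (z / 2) = nc z / 2.
Proof.
rewrite Normc.normcM Normc.normcV; congr (_ / _).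
by rewrite -(rmorph_nat (real_complex R)) nc_real ger0_norm.
Qed.

Lemma midsumN f n a b : midsum f n b a = - midsum f n a b.
Proof.
elim: n a b => [|n IH] a b /=; first by rewrite (addrC b); ring.
by rewrite (addrC b a) (IH ((a + b) / 2) b) (IH a ((a + b) / 2)); ring.
Qed.

Lemma midsumD f g n a b :
  midsum (fun z => f z + g z) n a b = midsum f n a b + midsum g n a b.
Proof.
by elim: n a b => [|n IH] a b /=; rewrite ?IH; ring.
Qed.

Lemma midsumZ k f n a b : midsum (fun z => k * f z) n a b = k * midsum f n a b.
Proof. by elim: n a b => [|n IH] a b /=; rewrite ?IH; ring. Qed.

Lemma midsum_affine n k l a b :
  midsum (fun z => k + l * z) n a b = (b - a) * (k + l * ((a + b) / 2)).
Proof. by elim: n a b => [|n IH] a b //=; rewrite !IH; field. Qed.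

Lemma midsum_cst n k a b : midsum (fun=> k) n a b = (b - a) * k.
Proof. by elim: n a b => [|n IH] a b //=; rewrite !IH; field. Qed.

Lemma eq_midsum K f g n a b : midconvex K -> K a -> K b ->
  (forall z, K z -> f z = g z) -> midsum f n a b = midsum g n a b.
Proof.
move=> mK + + fg; elim: n a b => [|n IH] a b Ka Kb /=; first by rewrite fg//; exact: mK.
by rewrite !IH//; exact: mK.
Qed.

Lemma midsum_le K f n a b (M : R) : midconvex K -> K a -> K b ->
  (forall z, K z -> nc (f z) <= M) -> nc (midsum f n a b) <= nc (b - a) * M.
Proof.
move=> mK + + fM; elim: n a b => [|n IH] a b Ka Kb /=.
  by rewrite Normc.normcM ler_wpM2l ?nc_ge0// fM//; exact: mK.
apply: le_trans (ler_ncD _ _) _.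
have h1 := IH _ _ Ka (mK _ _ Ka Kb); have h2 := IH _ _ (mK _ _ Ka Kb) Kb.
apply: le_trans (lerD h1 h2) _; rewrite -mulrDl.
have -> : (a + b) / 2 - a = (b - a) / 2 by field.
have -> : b - (a + b) / 2 = (b - a) / 2 by field.
by rewrite nc_half -splitr.
Qed.

Lemma midconvexI K L : midconvex K -> midconvex L ->
  midconvex (fun z => K z /\ L z).
Proof. by move=> mK mL a b [? ?] [? ?]; split; [exact: mK | exact: mL]. Qed.

Lemma midconvex_ball p (r : R) : midconvex (fun z => nc (z - p) <= r).
Proof.
move=> a b ha hb; have -> : (a + b) / 2 - p = ((a - p) + (b - p)) / 2 by field.
rewrite nc_half; have := ler_ncD (a - p) (b - p); lra.
Qed.

Lemma midconvex_oball p (r : R) : midconvex (fun z => nc (z - p) < r).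
Proof.
move=> a b ha hb; have -> : (a + b) / 2 - p = ((a - p) + (b - p)) / 2 by field.
rewrite nc_half; have := ler_ncD (a - p) (b - p); lra.
Qed.

Lemma limclosed_ball p (r : R) : limclosed (fun z => nc (z - p) <= r).
Proof.
move=> l h; apply/ler_addgt0Pr => e /h[z hz hl].
by have := ler_nc_dist (l - p) (z - p); rewrite opprB addrA subrK (ncB l z); lra.
Qed.

Definition eventually_le (u : nat -> C) (M : R) :=
  exists N, forall n, (N <= n)%N -> nc (u n) <= M.

Lemma nest_in K (T : Type) (P : T -> Prop) (pt : T -> C) (dia : T -> R) (x0 : T) :
  limclosed K -> (forall x, P x -> K (pt x)) ->
  (forall x, P x -> exists y,
     [/\ P y, dia y = dia x / 2 & nc (pt y - pt x) <= dia x]) ->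
  P x0 -> 0 <= dia x0 ->
  exists2 l, K l & forall e : R, 0 < e ->
    exists x, [/\ P x, dia x < e, 0 <= dia x & nc (pt x - l) <= 4 * dia x].
Proof.
move=> cK PK step Px0 d0; have [x [l hx]] := nest step Px0.
have small e : 0 < e ->
    exists y, [/\ P y, dia y < e, 0 <= dia y & nc (pt y - l) <= 4 * dia y].
  move=> /(exp2_lt (dia x0))[n hn]; have [Pn dn ln] := hx n.
  exists (x n); split=> //; rewrite dn//.
  by rewrite mulr_ge0// exprn_ge0// invr_ge0.
exists l => //; apply: cK => e e0.
have [|y [Py dy _ ly]] := small (e / 4); first by rewrite divr_gt0.
by exists (pt y); [exact: PK | lra].
Qed.

(** Cousin's lemma for a segment. If [Q] failed, it would fail on one half at every stage, and the
    failing pieces would shrink to a point of [K], where the local hypothesis contradicts them. The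
    factor 4 is the one of [nest]. *)
Lemma segment_bisection K (Q : C -> C -> Prop) a b :
  midconvex K -> limclosed K -> K a -> K b ->
  (forall a b, K a -> K b -> Q a ((a + b) / 2) -> Q ((a + b) / 2) b -> Q a b) ->
  (forall x, K x -> exists2 d : R, 0 < d & forall a b, K a -> K b ->
     nc (a - x) <= 4 * nc (b - a) -> nc (b - a) < d -> Q a b) ->
  Q a b.
Proof.
move=> mK cK Ka Kb glue loc; apply: contrapT => nQ.
pose P (s : C * C) := [/\ K s.1, K s.2 & ~ Q s.1 s.2].
have [||||l Kl small] := @nest_in K _ P fst (fun s => nc (s.2 - s.1)) (a, b) cK.
- by move=> s [].
- move=> [u v] [/= Ku Kv nQuv]; have Km := mK _ _ Ku Kv.
  have e1 : (u + v) / 2 - u = (v - u) / 2 by field.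
  have e2 : v - (u + v) / 2 = (v - u) / 2 by field.
  have := nc_ge0 (v - u) => v0.
  have [Q1|nQ1] := pselect (Q u ((u + v) / 2)); last first.
    by exists (u, (u + v) / 2); split=> //=; rewrite ?e1 ?nc_half// subrr Normc.normc0.
  have [Q2|nQ2] := pselect (Q ((u + v) / 2) v).
    by case: nQuv; exact: glue.
  by exists ((u + v) / 2, v); split=> //=; rewrite ?e1 ?e2 ?nc_half//; lra.
- by [].
- exact: nc_ge0.
have [d d0 hd] := loc l Kl; have [[u v] [[/= Ku Kv nQ'] h1 _ h2]] := small d d0.
exact/nQ'/hd.
Qed.

(** The difference is the midpoint sum of [f - f x]. The factor 5 is 4 + 1: a piece whose start is
    within four lengths of [x] has both ends within five lengths, hence inside the ball of radius
    [d]. *)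
Lemma midsum_near K f x (e d : R) n a b : midconvex K -> K a -> K b ->
  (forall y, K y -> nc (y - x) < d -> nc (f y - f x) <= e) ->
  nc (a - x) <= 4 * nc (b - a) -> nc (b - a) < d / 5 ->
  nc (midsum f n a b - (b - a) * f x) <= nc (b - a) * e.
Proof.
move=> mK Ka Kb hf ha hb.
rewrite -(midsum_cst n) -[- midsum _ _ _ _]mulN1r -midsumZ -midsumD.
apply: (@midsum_le (fun y => K y /\ nc (y - x) < d)).
- by apply: midconvexI => //; exact: midconvex_oball.
- by split=> //; have := nc_ge0 (b - a); lra.
- split=> //; have := ler_ncD (b - a) (a - x).
  by rewrite addrA subrK; have := nc_ge0 (b - a); lra.
- by move=> z [Kz hz]; rewrite mulN1r hf.
Qed.

(** The allowed error is proportional to the length of the segment, so the errors on two halves add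
    up to the error on the whole and [segment_bisection] applies. *)
Lemma midsum_cauchy K f a b (e : R) : midconvex K -> limclosed K -> cont_on K f ->
  K a -> K b -> 0 < e -> exists N, forall n m, (N <= n)%N -> (N <= m)%N ->
  nc (midsum f n a b - midsum f m a b) <= e * nc (b - a).
Proof.
move=> mK cK cf Ka Kb e0; move: a b Ka Kb => a0 b0 Ka0 Kb0.
apply: (@segment_bisection K (fun a b => exists N, forall n m,
  (N <= n)%N -> (N <= m)%N ->
  nc (midsum f n a b - midsum f m a b) <= e * nc (b - a))) => //.
  (* The successor accounts for the level of bisection that separates the whole segment from its
     halves. *)
  move=> a b Ka Kb [N1 h1] [N2 h2]; exists (N1 + N2).+1 => -[//|n] [//|m] hn hm /=.
  have := h1 n m (leq_trans (leq_addr _ _) hn) (leq_trans (leq_addr _ _) hm).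
  have := h2 n m (leq_trans (leq_addl _ _) hn) (leq_trans (leq_addl _ _) hm).
  have -> : (a + b) / 2 - a = (b - a) / 2 by field.
  have -> : b - (a + b) / 2 = (b - a) / 2 by field.
  set s := midsum _ _ _ _; set s' := midsum _ _ _ _; set t := midsum _ _ _ _.
  set t' := midsum _ _ _ _; rewrite nc_half.
  have -> : t + s - (t' + s') = (t - t') + (s - s') by ring.
  by have := ler_ncD (t - t') (s - s'); lra.
move=> x Kx; have [|d d0 hd] := cf x Kx (e / 2); first by rewrite divr_gt0.
exists (d / 5); first by rewrite divr_gt0.
move=> a b Ka Kb ha hb; exists 0%N => n m _ _.
have h1 := midsum_near n mK Ka Kb hd ha hb.
have h2 := midsum_near m mK Ka Kb hd ha hb.
have -> : midsum f n a b - midsum f m a b =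
  (midsum f n a b - (b - a) * f x) - (midsum f m a b - (b - a) * f x) by ring.
by apply: le_trans (ler_ncB _ _) _; lra.
Qed.

Lemma cauchy_tends (u : nat -> C) :
  (forall e : R, 0 < e -> exists N, forall n m, (N <= n)%N -> (N <= m)%N ->
    nc (u n - u m) <= e) -> exists l, tends u l.
Proof.
move=> h.
have /choice[N hN] k : exists N, forall n m, (N <= n)%N -> (N <= m)%N ->
    nc (u n - u m) <= 2^-1 ^+ k by apply: h; rewrite exprn_gt0// invr_gt0.
(* [M] is nondecreasing and [M k] is at least [N k], so [u (M k)] moves by at most [2^-1 ^+ k] and
   [real_nest] applies to its real and imaginary parts. *)
pose M := fix M k := if k is k'.+1 then (M k' + N k)%N else N 0%N.
have NM k : (N k <= M k)%N by case: k => //= k; exact: leq_addl.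
have MS k : (M k <= M k.+1)%N by exact: leq_addr.
have hv k : nc (u (M k.+1) - u (M k)) <= 2^-1 ^+ k.
  by apply: hN => //; exact: leq_trans (MS k).
have [k|lr hlr] := @real_nest _ (fun n => complex.Re (u (M n))) 1.
  by rewrite -ReB mul1r; exact: le_trans (Re_le_nc _) (hv k).
have [k|li hli] := @real_nest _ (fun n => complex.Im (u (M n))) 1.
  by rewrite -ImB mul1r; exact: le_trans (Im_le_nc _) (hv k).
exists (lr +i* li)%C => e e0; have [k hk] := exp2_lt 5 e0.
exists (M k) => n hn.
have h1 := hN k n (M k) (leq_trans (NM k) hn) (NM k).
have h2 : nc (u (M k) - (lr +i* li)%C) <= 4 * 2^-1 ^+ k.
  apply: le_trans (nc_ReIm _) _; have := hlr k; have := hli k.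
  by case: (u (M k)) => x y /=; lra.
have -> : u n - (lr +i* li)%C = (u n - u (M k)) + (u (M k) - (lr +i* li)%C) by ring.
by apply: le_trans (ler_ncD _ _) _; lra.
Qed.

(** The value is 0 when the midpoint sums have no limit. *)
Definition integral (f : C -> C) (a b : C) : C :=
  xget 0 [set l | tends (fun n => midsum f n a b) l].

Lemma integralP f a b l : tends (fun n => midsum f n a b) l -> integral f a b = l.
Proof. by move=> h; apply: xget_unique => // l' h'; exact: tends_unique h' h. Qed.

Lemma integral_tends K f a b : midconvex K -> limclosed K -> cont_on K f ->
  K a -> K b -> tends (fun n => midsum f n a b) (integral f a b).
Proof.
move=> mK cK cf Ka Kb; have [|l hl] := @cauchy_tends (fun n => midsum f n a b).
  move=> e e0; have ab0 : 0 < nc (b - a) + 1 by have := nc_ge0 (b - a); lra.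
  have [N hN] := midsum_cauchy mK cK cf Ka Kb (divr_gt0 e0 ab0).
  exists N => n m hn hm; apply: le_trans (hN n m hn hm) _.
  by rewrite mulrAC ler_pdivrMr// ler_pM2l//; lra.
by rewrite (integralP hl).
Qed.

Lemma integral_cst k a b : integral (fun=> k) a b = (b - a) * k.
Proof.
by apply: integralP; apply: (eq_tends (u := fun=> (b - a) * k)) => [n|];
  [rewrite midsum_cst | exact: tends_cst].
Qed.

Lemma integral_affine k l a b :
  integral (fun z => k + l * z) a b = (b - a) * (k + l * ((a + b) / 2)).
Proof.
by apply: integralP; apply: (eq_tends (u := fun=> (b - a) * (k + l * ((a + b) / 2))))
   => [n|]; [rewrite midsum_affine | exact: tends_cst].
Qed.

Lemma integral_id f a : integral f a a = 0.
Proof.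
have aa : (a + a) / 2 = a by field.
apply: integralP; apply: eq_tends (tends_cst 0) => n.
by elim: n => [|n IH] /=; rewrite aa ?subrr ?mul0r// -IH addr0.
Qed.

Section OnConvex.
Variables (K : C -> Prop) (mK : midconvex K) (cK : limclosed K).

Lemma integralN f a b : cont_on K f -> K a -> K b ->
  integral f b a = - integral f a b.
Proof.
move=> cf Ka Kb; apply: integralP.
apply: eq_tends (tendsN (integral_tends mK cK cf Ka Kb)) => n.
exact/esym/midsumN.
Qed.

Lemma integralD f g a b : cont_on K f -> cont_on K g -> K a -> K b ->
  integral (fun z => f z + g z) a b = integral f a b + integral g a b.
Proof.
move=> cf cg Ka Kb; apply: integralP.
apply: eq_tends (tendsD (integral_tends mK cK cf Ka Kb)
  (integral_tends mK cK cg Ka Kb)) => n.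
by rewrite midsumD.
Qed.

Lemma integralZ k f a b : cont_on K f -> K a -> K b ->
  integral (fun z => k * f z) a b = k * integral f a b.
Proof.
move=> cf Ka Kb; apply: integralP.
by apply: eq_tends (tendsZ k (integral_tends mK cK cf Ka Kb)) => n; rewrite midsumZ.
Qed.

Lemma eq_integral f g a b : cont_on K f -> K a -> K b ->
  (forall z, K z -> f z = g z) -> integral f a b = integral g a b.
Proof.
move=> cf Ka Kb fg; apply/esym/integralP.
by apply: eq_tends (integral_tends mK cK cf Ka Kb) => n; exact: (eq_midsum n mK).
Qed.

Lemma integral_le f a b (M : R) : cont_on K f -> K a -> K b ->
  (forall z, K z -> nc (f z) <= M) -> nc (integral f a b) <= nc (b - a) * M.
Proof.
move=> cf Ka Kb fM; apply: tends_le (integral_tends mK cK cf Ka Kb) _ => n.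
exact: (midsum_le n mK).
Qed.

End OnConvex.

(** The quotient-free form of complex differentiability makes estimates additive and treats [u = 0]
    like any other increment; [cderivP] links it to [is_derive]. *)
Definition cderiv (f : C -> C) (z l : C) := forall e : R, 0 < e ->
  exists2 d : R, 0 < d & forall u, nc u < d ->
    nc (f (z + u) - f z - u * l) <= e * nc u.

Lemma cderiv_cont K f : (forall z, K z -> exists l, cderiv f z l) -> cont_on K f.
Proof.
move=> df x /df[l hl] e e0; have [d d0 hd] := hl 1 ltr01.
have l0 := nc_ge0 l; have c0 : 0 < nc l + 1 by lra.
exists (Num.min d (e / (nc l + 1))); first by rewrite lt_min d0 divr_gt0.
move=> y _; rewrite lt_min ltr_pdivlMr// => /andP[h1 h2].
have := hd _ h1; rewrite [x + _]addrC subrK => h3.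
have -> : f y - f x = (f y - f x - (y - x) * l) + (y - x) * l by ring.
by apply: le_trans (ler_ncD _ _) _; rewrite (Normc.normcM _ l); nra.
Qed.

Lemma integral_deriv K F f a b : midconvex K -> limclosed K -> cont_on K f ->
  (forall z, K z -> cderiv F z (f z)) -> K a -> K b ->
  integral f a b = F b - F a.
Proof.
move=> mK cK cf dF Ka Kb.
suff lim (e : R) : 0 < e ->
    eventually_le (fun n => F b - F a - midsum f n a b) (e * nc (b - a)).
  apply: integralP => e e0; have ab0 : 0 < nc (b - a) + 1 by have := nc_ge0 (b - a); lra.
  have [N hN] := lim _ (divr_gt0 e0 ab0); exists N => n hn.
  rewrite ncB; apply: le_trans (hN n hn) _.
  by rewrite mulrAC ler_pdivrMr// ler_pM2l//; lra.
move=> e0; move: a b Ka Kb => a0 b0 Ka0 Kb0.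
apply: (@segment_bisection K (fun a b =>
  eventually_le (fun n => F b - F a - midsum f n a b) (e * nc (b - a)))) => //.
  move=> a b Ka Kb [N1 h1] [N2 h2]; exists (N1 + N2).+1 => -[//|n] hn /=.
  have := h1 n (leq_trans (leq_addr _ _) hn).
  have := h2 n (leq_trans (leq_addl _ _) hn).
  have -> : (a + b) / 2 - a = (b - a) / 2 by field.
  have -> : b - (a + b) / 2 = (b - a) / 2 by field.
  rewrite nc_half; set m := (a + b) / 2.
  have -> : F b - F a - (midsum f n a m + midsum f n m b) =
    (F m - F a - midsum f n a m) + (F b - F m - midsum f n m b) by ring.
  by move=> ? ?; apply: le_trans (ler_ncD _ _) _; lra.
(* With [a] within 4 and [b] within 5 lengths of [x], the three errors are at most 4, 5 and 1
   twentieths of [e * nc (b - a)]. *)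
move=> x Kx; have e20 : 0 < e / 20 by rewrite divr_gt0.
have [d d0 hd] := cf x Kx _ e20; have [d' d'0 hd'] := dF x Kx _ e20.
exists (Num.min (d / 5) (d' / 5)); first by rewrite lt_min !divr_gt0.
move=> a b Ka Kb ha; rewrite lt_min => /andP[hb hb'].
exists 0%N => n _; have h1 := midsum_near n mK Ka Kb hd ha hb.
have ab0 := nc_ge0 (b - a).
have hbx : nc (b - x) <= 5 * nc (b - a).
  by have := ler_ncD (b - a) (a - x); rewrite addrA subrK; lra.
have h2 : nc (F a - F x - (a - x) * f x) <= e / 20 * nc (a - x).
  by have := hd' (a - x); rewrite [x + _]addrC subrK; apply; lra.
have h3 : nc (F b - F x - (b - x) * f x) <= e / 20 * nc (b - x).
  by have := hd' (b - x); rewrite [x + _]addrC subrK; apply; lra.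
have -> : F b - F a - midsum f n a b = (F b - F x - (b - x) * f x) -
  (F a - F x - (a - x) * f x) - (midsum f n a b - (b - a) * f x) by ring.
apply: le_trans (ler_ncB _ _) _.
have h4 := ler_ncB (F b - F x - (b - x) * f x) (F a - F x - (a - x) * f x).
nra.
Qed.

End ContourIntegrals.

Section ComplexDerivative.
Variable R : realType.
Local Notation C := (R[i]%C).
Local Notation nc := (@Normc.normc R).

Lemma normCE (z : C) : `|z| = ((nc z)%:C)%C.
Proof. by []. Qed.

Lemma gt0_realC (e : C) : 0 < e -> exists2 x : R, 0 < x & e = (x%:C)%C.
Proof.
case: e => x y; rewrite ltcE /= => /andP[/eqP y0 x0].
by exists x => //; rewrite y0.
Qed.

Lemma cderiv_cvg (f : C -> C) (z l : C) :
  cderiv f z l <-> (h^-1 *: (f (h *: 1 + z) - f z) @[h --> (0:C)^'] --> l).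
Proof.
split=> [h|].
  apply/cvgrPdist_le => _ /gt0_realC[e e0 ->].
  have [d d0 hd] := h e e0.
  rewrite near_withinE; apply/nbhs_ballP; exists (d%:C)%C => /=.
    by rewrite ltcR.
  move=> u; rewrite /ball /= sub0r normrN normCE ltcR => ud u0.
  have := hd u ud; rewrite normCE lecR ncB => hu.
  have u1 : 0 < nc u by exact: nc_gt0.
  rewrite -(ler_pM2l u1) mulrC [nc u * _]mulrC -Normc.normcM.
  apply: le_trans hu; rewrite le_eqVlt; apply/orP; left; apply/eqP; congr nc.
  rewrite /GRing.scale /= mulr1 mulrBl mulrAC mulVf// mul1r [u + z]addrC.
  by ring.
move=> /cvgrPdist_le h e e0.
have /h : 0 < (e%:C)%C by rewrite ltcR.
rewrite near_withinE => /nbhs_ballP[_ /= /gt0_realC[d d0 ->] hd].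
exists d => // u ud; have [->|u0] := eqVneq u 0.
  by rewrite addr0 subrr mul0r subr0 Normc.normc0 mulr0.
have /hd /(_ u0) : ball (0:C) (d%:C)%C u by rewrite /ball /= sub0r normrN normCE ltcR.
rewrite normCE lecR => hu; have u1 : 0 < nc u by exact: nc_gt0.
rewrite -(ler_pM2l u1) in hu; rewrite (mulrC e); apply: le_trans hu.
rewrite -Normc.normcM -normcN le_eqVlt; apply/orP; left; apply/eqP; congr nc.
rewrite /GRing.scale /= mulr1 mulrBr mulrA divff// mul1r [u + z]addrC.
by ring.
Qed.

Lemma cderivP (f : C -> C) (z l : C) : cderiv f z l <-> is_derive z (1:C) f l.
Proof.
rewrite cderiv_cvg; split=> [h|[df <-]]; last exact: df.
by split; [apply/cvg_ex; exists l | exact: cvg_lim].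
Qed.

Implicit Types (f g : C -> C) (z l k p : C).

Lemma cderiv_unique f z l l' : cderiv f z l -> cderiv f z l' -> l = l'.
Proof. by move=> /cderivP[_ <-] /cderivP[_ <-]. Qed.

Lemma cderiv_near f g z l (d : R) : 0 < d ->
  (forall w, nc (w - z) < d -> f w = g w) -> cderiv f z l -> cderiv g z l.
Proof.
move=> d0 fg h e /h[d' d'0 hd]; exists (Num.min d d'); first by rewrite lt_min d0.
move=> u; rewrite lt_min => /andP[ud ud'].
rewrite -!fg; first exact: hd.
  by rewrite subrr Normc.normc0.
by rewrite addrC addKr.
Qed.

Lemma eq_cderiv f g z l : f =1 g -> cderiv f z l -> cderiv g z l.
Proof. by move=> fg; apply: (@cderiv_near _ _ _ _ 1). Qed.

Lemma cderiv_cst k z : cderiv (fun=> k) z 0.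
Proof. by apply/cderivP; exact: is_derive_cst. Qed.

Lemma cderiv_id z : cderiv id z 1.
Proof. by apply/cderivP; exact: is_derive_id. Qed.

Lemma cderivD f g z l k : cderiv f z l -> cderiv g z k ->
  cderiv (fun w => f w + g w) z (l + k).
Proof. by move=> /cderivP hf /cderivP hg; apply/cderivP; exact: is_deriveD. Qed.

Lemma cderivM f g z l k : cderiv f z l -> cderiv g z k ->
  cderiv (fun w => f w * g w) z (f z * k + g z * l).
Proof. by move=> /cderivP hf /cderivP hg; apply/cderivP; exact: is_deriveM. Qed.

Lemma cderivZ f z l k : cderiv f z l -> cderiv (fun w => k * f w) z (k * l).
Proof.
by move=> hf; have := cderivM (cderiv_cst k z) hf; rewrite mulr0 addr0.
Qed.

Lemma cderivN f z l : cderiv f z l -> cderiv (fun w => - f w) z (- l).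
Proof. by move=> /(cderivZ (-1)); rewrite mulN1r; apply: eq_cderiv => w; rewrite mulN1r. Qed.

Lemma cderivB f g z l k : cderiv f z l -> cderiv g z k ->
  cderiv (fun w => f w - g w) z (l - k).
Proof. by move=> hf /cderivN; exact: cderivD. Qed.

Lemma cderivV f z l : f z != 0 -> cderiv f z l ->
  cderiv (fun w => (f w)^-1) z (- (f z) ^- 2 * l).
Proof.
move=> f0 /cderivP[df <-]; apply/cderivP; split; first exact: derivableV.
by rewrite deriveV.
Qed.

Lemma cderivX f z l n : cderiv f z l ->
  cderiv (fun w => f w ^+ n) z (n%:R * f z ^+ n.-1 * l).
Proof.
move=> df; elim: n => [|n IH]; first by rewrite !mul0r; exact: cderiv_cst.
have := cderivM df IH; rewrite (_ : _ + _ = n.+1%:R * f z ^+ n * l).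
  by apply: eq_cderiv => w; rewrite exprS.
by case: n {IH} => [|n] /=; rewrite ?exprS -?natr1; ring.
Qed.

Lemma cderiv_sum (I : Type) (s : seq I) (P : pred I) (f_ : I -> C -> C) (l_ : I -> C) z :
  (forall i, P i -> cderiv (f_ i) z (l_ i)) ->
  cderiv (fun w => \sum_(i <- s | P i) f_ i w) z (\sum_(i <- s | P i) l_ i).
Proof.
move=> h; elim: s => [|i s IH].
  by rewrite big_nil; apply: eq_cderiv (cderiv_cst 0 z) => w; rewrite big_nil.
rewrite big_cons; case: ifP => Pi.
  by apply: eq_cderiv (cderivD (h _ Pi) IH) => w; rewrite big_cons Pi.
by apply: eq_cderiv IH => w; rewrite big_cons Pi.
Qed.

Lemma cderiv_shift f p k z l : cderiv f (p + k * z) l ->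
  cderiv (fun w => f (p + k * w)) z (k * l).
Proof.
move=> h e e0; have k1 : 0 < nc k + 1 by have := nc_ge0 k; lra.
have [d d0 hd] := h _ (divr_gt0 e0 k1).
exists (d / (nc k + 1)); first by rewrite divr_gt0.
move=> u; rewrite ltr_pdivlMr// => ud.
have k0 := nc_ge0 k; have u0 := nc_ge0 u.
have := hd (k * u); rewrite Normc.normcM.
have -> : p + k * (z + u) = p + k * z + k * u by ring.
have -> : u * (k * l) = k * u * l by ring.
move=> H; apply: le_trans (H _) _; first by nra.
rewrite mulrA ler_wpM2r// mulrAC ler_pdivrMr//; nra.
Qed.

End ComplexDerivative.

(** * Goursat's theorem and primitives on a disc *)

Section Goursat.
Variable R : realType.
Local Notation C := (R[i]%C).
Local Notation nc := (@Normc.normc R).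
Implicit Types (f g F : C -> C) (a b c z w l p : C) (K : C -> Prop).

Definition trisum f n a b c := midsum f n a b + midsum f n b c + midsum f n c a.

Lemma trisum_le K f n a b c (M : R) : midconvex K -> K a -> K b -> K c ->
  (forall z, K z -> nc (f z) <= M) ->
  nc (trisum f n a b c) <= (nc (b - a) + nc (c - b) + nc (a - c)) * M.
Proof.
move=> mK Ka Kb Kc fM; rewrite !mulrDl.
apply: le_trans (ler_ncD _ _) (lerD _ (midsum_le n mK Kc Ka fM)).
by apply: le_trans (ler_ncD _ _) (lerD _ _); exact: (midsum_le n mK).
Qed.

(** Goursat's bisection, run on midpoint sums. Cutting at the midpoints of the sides gives four
    triangles of half the perimeter [s], and the bound [e * s ^+ 2] is a quarter for each, so a bad
    triangle contains a bad one. Near the limit point [f] is affine up to a small remainder, and the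
    midpoint sums of the affine part around a triangle add up to 0. *)
Lemma goursat K f a b c : midconvex K -> limclosed K ->
  (forall z, K z -> exists l, cderiv f z l) -> K a -> K b -> K c ->
  integral f a b + integral f b c + integral f c a = 0.
Proof.
move=> mK cK df Ka Kb Kc; have cf := cderiv_cont df.
have T1 := tendsD (tendsD (integral_tends mK cK cf Ka Kb)
  (integral_tends mK cK cf Kb Kc)) (integral_tends mK cK cf Kc Ka).
apply: (tends_unique T1); move: {T1} I => _.
pose s (t : C * C * C) := nc (t.1.2 - t.1.1) + nc (t.2 - t.1.2) + nc (t.1.1 - t.2).
have s_ge0 t : 0 <= s t by rewrite !addr_ge0 ?nc_ge0.
suff lim (e : R) : 0 < e ->
    eventually_le (fun n => trisum f n a b c) (e * s (a, b, c) ^+ 2).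
  move=> e e0; have c0 : 0 < s (a, b, c) ^+ 2 + 1.
    by have := sqr_ge0 (s (a, b, c)); lra.
  have [N hN] := lim _ (divr_gt0 e0 c0); exists N => n hn.
  rewrite subr0; apply: le_trans (hN n hn) _.
  by rewrite mulrAC ler_pdivrMr// ler_pM2l//; lra.
move=> e0; apply: contrapT => bad.
pose P (t : C * C * C) := [/\ K t.1.1, K t.1.2, K t.2 &
  ~ eventually_le (fun n => trisum f n t.1.1 t.1.2 t.2) (e * s t ^+ 2)].
have [||||l Kl small] := @nest_in R K _ P (fun t => t.1.1) s (a, b, c) cK.
- by move=> t [].
- move=> [[u v] w] [/= Ku Kv Kw nE].
  have Kuv := mK _ _ Ku Kv; have Kvw := mK _ _ Kv Kw; have Kwu := mK _ _ Kw Ku.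
  have [x xE] : exists x : C, x = (u + v) / 2 by eexists.
  have [y yE] : exists y : C, y = (v + w) / 2 by eexists.
  have [z zE] : exists z : C, z = (w + u) / 2 by eexists.
  rewrite -xE in Kuv; rewrite -yE in Kvw; rewrite -zE in Kwu.
  have d1 : nc (v - u) = 2 * nc (x - u).
    by rewrite (_ : x - u = (v - u) / 2) ?nc_half; [lra | rewrite xE; field].
  have d2 : nc (w - v) = 2 * nc (y - v).
    by rewrite (_ : y - v = (w - v) / 2) ?nc_half; [lra | rewrite yE; field].
  have d3 : nc (u - w) = 2 * nc (z - w).
    by rewrite (_ : z - w = (u - w) / 2) ?nc_half; [lra | rewrite zE; field].
  have e1 : nc (v - x) = nc (x - u) by congr nc; rewrite xE; field.
  have e2 : nc (w - y) = nc (y - v) by congr nc; rewrite yE; field.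
  have e3 : nc (u - z) = nc (z - w) by congr nc; rewrite zE; field.
  have e4 : nc (z - x) = nc (y - v) by congr nc; rewrite xE yE zE; field.
  have e5 : nc (x - y) = nc (z - w) by congr nc; rewrite xE yE zE; field.
  have e6 : nc (y - z) = nc (x - u) by congr nc; rewrite xE yE zE; field.
  have s1 : s (u, x, z) = s (u, v, w) / 2 by rewrite /s /= d1 d2 d3 e4 e3; lra.
  have s2 : s (x, v, y) = s (u, v, w) / 2 by rewrite /s /= d1 d2 d3 e1 e5; lra.
  have s3 : s (z, y, w) = s (u, v, w) / 2.
    by rewrite /s /= d1 d2 d3 e6 e2; lra.
  have s4 : s (x, y, z) = s (u, v, w) / 2.
    by rewrite /s /= (ncB y x) (ncB z y) (ncB x z) d1 d2 d3 e4 e5 e6; lra.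
  have x0 := nc_ge0 (x - u); have y0 := nc_ge0 (y - v); have z0 := nc_ge0 (z - w).
  have E t : s t = s (u, v, w) / 2 -> K t.1.1 -> K t.1.2 -> K t.2 ->
      nc (t.1.1 - u) <= s (u, v, w) ->
      eventually_le (fun n => trisum f n t.1.1 t.1.2 t.2) (e * s t ^+ 2) \/
      exists y, [/\ P y, s y = s (u, v, w) / 2 & nc (y.1.1 - u) <= s (u, v, w)].
    move=> st K1 K2 K3 ht; case: (pselect (eventually_le
       (fun n => trisum f n t.1.1 t.1.2 t.2) (e * s t ^+ 2))) => h; first by left.
    by right; exists t.
  have [||||[N1 h1]|//] := E (u, x, z) s1 => //=; first by rewrite subrr Normc.normc0.
  have [||||[N2 h2]|//] := E (x, v, y) s2 => //=; first by rewrite /s /= d1 d2 d3; lra.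
  have [||||[N3 h3]|//] := E (z, y, w) s3 => //=.
    by rewrite ncB e3 /s /= d1 d2 d3; lra.
  have [||||[N4 h4]|//] := E (x, y, z) s4 => //=; first by rewrite /s /= d1 d2 d3; lra.
  case: nE; exists (N1 + N2 + N3 + N4).+1 => -[//|n] hn.
  have {}h1 := h1 n ltac:(lia); have {}h2 := h2 n ltac:(lia).
  have {}h3 := h3 n ltac:(lia); have {}h4 := h4 n ltac:(lia).
  rewrite /= in h1 h2 h3 h4; rewrite s1 in h1; rewrite s2 in h2.
  rewrite s3 in h3; rewrite s4 in h4.
  have -> : trisum f n.+1 u v w = (trisum f n u x z + trisum f n x v y) +
      (trisum f n z y w + trisum f n x y z).
    rewrite /trisum /= -xE -yE -zE (midsumN f n x z) (midsumN f n y x).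
    by rewrite (midsumN f n y z); ring.
  apply: le_trans (ler_ncD _ _) _.
  have h12 := ler_ncD (trisum f n u x z) (trisum f n x v y).
  have h34 := ler_ncD (trisum f n z y w) (trisum f n x y z).
  lra.
- by [].
- exact: s_ge0.
(* The vertices of the small triangle are within [5 * S] of [l] and its perimeter is [S], so the
   remainder costs at most [S * (e / 10 * (5 * S))]. *)
have [k dk] := df l Kl; have e10 : 0 < e / 10 by rewrite divr_gt0.
have [d d0 hd] := dk _ e10.
have [[[u v] w] [[/= Ku Kv Kw nE] sd s0 ul]] := small (d / 10) (divr_gt0 d0 (ltr0Sn _ 9)).
apply: nE; exists 0%N => n _; move: sd s0 ul; set S := s _ => sd s0 ul.
pose h z := f z - ((f l - k * l) + k * z).
have fh z : f z = ((f l - k * l) + k * z) + h z by rewrite /h; ring.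
have -> : trisum f n u v w = trisum h n u v w.
  rewrite /trisum !(eq_midsum n (K := fun=> True) _ _ _ (fun z _ => fh z))//.
  by rewrite !(midsumD (fun z => (f l - k * l) + k * z) h) !midsum_affine; field.
have S1 : nc (v - u) <= S /\ nc (u - w) <= S.
  by rewrite /S /s /=; have := nc_ge0 (v - u); have := nc_ge0 (w - v);
    have := nc_ge0 (u - w); lra.
rewrite [X in _ <= X](_ : _ = S * (e / 10 * (10 * S))); last by field.
apply: (@trisum_le (fun z => K z /\ nc (z - l) <= 5 * S)).
- by apply: midconvexI => //; exact: midconvex_ball.
- by split=> //; lra.
- by split=> //; have := ler_ncD (v - u) (u - l); rewrite addrA subrK; lra.
- split=> //; have := ler_ncD (w - u) (u - l); rewrite addrA subrK (ncB w u); lra.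
move=> z [Kz hz]; have := hd (z - l); rewrite [l + _]addrC subrK.
have -> : f z - f l - (z - l) * k = h z by rewrite /h; ring.
have zl := nc_ge0 (z - l); move=> /(_ ltac:(lra)) H; apply: le_trans H _.
by apply: ler_wpM2l; lra.
Qed.

Definition primitive f p z := integral f p z.

Lemma cont_on_sub K K' f : (forall z, K' z -> K z) -> cont_on K f -> cont_on K' f.
Proof.
move=> sub cf x /sub/cf h e /h[d d0 hd]; exists d => // y /sub; exact: hd.
Qed.

Section Disc.
Variables (f : C -> C) (p : C) (r : R).
Hypothesis df : forall z, nc (z - p) < r -> exists l, cderiv f z l.

Lemma primitive_integral a b : nc (a - p) < r -> nc (b - p) < r ->
  integral f a b = primitive f p b - primitive f p a.
Proof.
(* The closed disc through the farther of [a] and [b]: [goursat] asks for a [limclosed] set, and the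
   open disc is not one. *)
move=> ha hb; pose K := fun z => nc (z - p) <= Num.max (nc (a - p)) (nc (b - p)).
have dK z : K z -> exists l, cderiv f z l.
  by move=> hz; apply: df; apply: le_lt_trans hz _; rewrite gt_max ha.
have mK : midconvex K := @midconvex_ball _ p _.
have cK : limclosed K := @limclosed_ball _ p _.
have Ka : K a by rewrite /K le_max lexx.
have Kb : K b by rewrite /K le_max lexx orbT.
have Kp : K p by rewrite /K subrr Normc.normc0 le_max nc_ge0.
have := goursat mK cK dK Kp Ka Kb.
rewrite (integralN mK cK (cderiv_cont dK) Kp Kb) /primitive => /eqP.
by rewrite subr_eq0 => /eqP <-; rewrite addrAC subrr add0r.
Qed.

Lemma primitive_deriv z : nc (z - p) < r -> cderiv (primitive f p) z (f z).
Proof.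
move=> hz e e0; pose K := fun w => nc (w - p) <= (nc (z - p) + r) / 2.
have dK w : K w -> exists l, cderiv f w l by move=> hw; apply: df; rewrite /K in hw; lra.
have mK : midconvex K := @midconvex_ball _ p _.
have cK : limclosed K := @limclosed_ball _ p _.
have cf := cderiv_cont dK; have Kz : K z by rewrite /K; lra.
have [d d0 hd] := cf z Kz e e0.
exists (Num.min (d / 5) ((r - nc (z - p)) / 2)).
  by rewrite lt_min !divr_gt0// subr_gt0.
move=> u; rewrite lt_min => /andP[u1 u2].
have hu : nc (z + u - p) <= nc u + nc (z - p).
  by rewrite addrAC [z - p + u]addrC; exact: ler_ncD.
have Ku : K (z + u) by rewrite /K; lra.
rewrite -primitive_integral//; last by lra.
have eu : z + u - z = u by rewrite addrAC subrr add0r.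
have T := tendsD (integral_tends mK cK cf Kz Ku) (tends_cst (- (u * f z))).
apply: tends_le T _ => n.
have := midsum_near n mK Kz Ku hd; rewrite eu subrr Normc.normc0 (mulrC e).
by apply=> //; rewrite mulr_ge0// nc_ge0.
Qed.

End Disc.
End Goursat.

(** * Integration along a square around the origin *)

Section CauchyFormula.
Variable R : realType.
Local Notation C := (R[i]%C).
Local Notation nc := (@Normc.normc R).
Local Notation I := ('i%C : C).
Implicit Types (f g F : C -> C) (a b c z w l p v : C) (K : C -> Prop).

Lemma nc_I : nc I = 1.
Proof. by rewrite /= expr0n expr1n add0r sqrtr1. Qed.

Lemma nc_IX k : nc (I ^+ k) = 1.
Proof.
elim: k => [|k IH]; first by rewrite Normc.normc1.
by rewrite exprS Normc.normcM IH nc_I mulr1.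
Qed.

Lemma nc_conj z : nc (z^*)%C = nc z.
Proof. by case: z => x y /=; rewrite sqrrN. Qed.

Lemma Re_conjM v : complex.Re (v * (v^*)%C) = nc v ^+ 2.
Proof.
case: v => x y; rewrite [nc _]/= sqr_sqrtr ?addr_ge0 ?sqr_ge0// /=; ring.
Qed.

(* The cap of the disc of radius |v| cut off by the line through v and iv: it is
   convex, contains the segment from v to iv and stays away from the origin. *)
Definition cap v z :=
  nc z <= nc v /\ nc v ^+ 2 <= complex.Re (z * (v^*)%C * (1 - I)).

Lemma midconvex_cap v : midconvex (cap v).
Proof.
move=> a b [a1 a2] [b1 b2]; split.
  by have := @midconvex_ball R 0 (nc v) a b; rewrite !subr0; apply.
have -> : (a + b) / 2 * (v^*)%C * (1 - I) =
   ((2^-1)%:C)%C * (a * (v^*)%C * (1 - I) + b * (v^*)%C * (1 - I)).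
  by rewrite rmorphV ?unitfE ?pnatr_eq0// rmorph_nat; ring.
move: a2 b2; case: (a * _ * _) => x y; case: (b * _ * _) => x' y' /=; lra.
Qed.

Lemma limclosed_cap v : limclosed (cap v).
Proof.
move=> l h; split.
  have := @limclosed_ball R 0 (nc v) l; rewrite subr0; apply => e /h[z [z1 _] ?].
  by exists z => //; rewrite subr0.
set k := (v^*)%C * (1 - I); have k0 := nc_ge0 k.
apply/ler_addgt0Pr => e e0; have k1 : 0 < nc k + 1 by lra.
have [z [_]] := h _ (divr_gt0 e0 k1); rewrite -!mulrA -/k ltr_pdivlMr// => zk zl.
have := Re_le_nc (z * k - l * k); rewrite -mulrBl Normc.normcM mulrBl ReB.
rewrite ler_norml => /andP[h1 h2]; have := nc_ge0 (z - l); nra.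
Qed.

Lemma cap_ge v z : cap v z -> nc v / 2 <= nc z.
Proof.
move=> [_ h]; have z0 := nc_ge0 z; have := nc_ge0 v.
rewrite le_eqVlt => /orP[/eqP <-|v0]; first by rewrite mul0r.
have := le_trans h (le_trans (ler_norm _) (Re_le_nc _)).
rewrite !Normc.normcM nc_conj => h1.
have h2 : nc (1 - I) <= 2.
  by have := ler_ncB 1 I; rewrite nc_I Normc.normc1; lra.
have h3 : nc z * nc v * nc (1 - I) <= nc z * nc v * 2.
  by rewrite ler_wpM2l// mulr_ge0// ltW.
have := le_trans h1 h3; rewrite expr2 mulrAC ler_pM2r//; lra.
Qed.

Lemma cap_start v : cap v v.
Proof.
split=> //; have := Re_conjM v; case: v => x y /=; lra.
Qed.

Lemma cap_end v : cap v (I * v).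
Proof.
split; first by rewrite Normc.normcM nc_I mul1r.
have := Re_conjM v; case: v => x y /=; lra.
Qed.

Section Square.
Variable rho : R.
Hypothesis rho_gt0 : 0 < rho.

(** The contour is the square whose vertices are [rho] times the powers of i. The annulus contains
    the four caps over its sides, and integrands are controlled there. *)
Definition annulus z := rho / 2 <= nc z <= rho.
Definition vertex k : C := I ^+ k * (rho%:C)%C.

Lemma nc_vertex k : nc (vertex k) = rho.
Proof. by rewrite Normc.normcM nc_IX mul1r nc_real gtr0_norm. Qed.

Lemma vertexS k : vertex k.+1 = I * vertex k.
Proof. by rewrite /vertex exprS mulrA. Qed.

Lemma cap_annulus k z : cap (vertex k) z -> annulus z.
Proof. by move=> h; have [h1 _] := h; rewrite /annulus -(nc_vertex k) cap_ge. Qed.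

Definition contour f := \sum_(k < 4) integral f (vertex k) (vertex k.+1).

Let mK k := @midconvex_cap (vertex k).
Let cK k := @limclosed_cap (vertex k).
Let K0 k : cap (vertex k) (vertex k) := cap_start (vertex k).
Let K1 k : cap (vertex k) (vertex k.+1).
Proof. by rewrite vertexS; exact: cap_end. Qed.
Let cont_cap k f : cont_on annulus f -> cont_on (cap (vertex k)) f.
Proof. exact: cont_on_sub (@cap_annulus k). Qed.

Lemma contourD f g : cont_on annulus f -> cont_on annulus g ->
  contour (fun z => f z + g z) = contour f + contour g.
Proof.
move=> cf cg; rewrite -big_split; apply: eq_bigr => k _.
by rewrite (integralD (@mK k) (@cK k) (cont_cap cf) (cont_cap cg) (K0 k) (K1 k)).
Qed.

Lemma contourZ k f : cont_on annulus f ->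
  contour (fun z => k * f z) = k * contour f.
Proof.
move=> cf; rewrite mulr_sumr; apply: eq_bigr => j _.
by rewrite (integralZ (@mK j) (@cK j) _ (cont_cap cf) (K0 j) (K1 j)).
Qed.

Lemma eq_contour f g : cont_on annulus f ->
  (forall z, annulus z -> f z = g z) -> contour f = contour g.
Proof.
move=> cf fg; apply: eq_bigr => k _.
apply: (eq_integral (@mK k) (@cK k) (cont_cap cf) (K0 k) (K1 k)) => z /cap_annulus.
exact: fg.
Qed.

Lemma contour_deriv f F : cont_on annulus f ->
  (forall z, annulus z -> cderiv F z (f z)) -> contour f = 0.
Proof.
move=> cf dF; rewrite /contour.
rewrite (eq_bigr (fun k : 'I_4 => F (vertex k.+1) - F (vertex k))); last first.
  move=> k _; apply: (integral_deriv (@mK k) (@cK k) (cont_cap cf) _ (K0 k) (K1 k)).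
  by move=> z /cap_annulus; exact: dF.
rewrite -(big_mkord xpredT (fun k => F (vertex k.+1) - F (vertex k))).
rewrite telescope_sumr// /vertex expr0.
by rewrite (exprM I 2 2) sqr_i expr2 mulrNN mulr1 subrr.
Qed.

(* The bound M of F comes from bisection, so no compactness is needed. *)
Lemma contour_le F : cont_on annulus F ->
  exists M : R, 0 <= M /\ forall g E, (forall z, annulus z -> nc (g z) <= E) ->
    cont_on annulus (fun z => F z * g z) ->
    nc (contour (fun z => F z * g z)) <= M * E.
Proof.
move=> cF.
have /choice[M hM] (k : nat) : exists M : R, 0 <= M /\ forall g E,
    (forall z, annulus z -> nc (g z) <= E) -> forall n,
    nc (midsum (fun z => F z * g z) n (vertex k) (vertex k.+1)) <= M * E.
  apply: (@segment_bisection R (cap (vertex k)) (fun a b => exists M : R,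
    0 <= M /\ forall g E, (forall z, annulus z -> nc (g z) <= E) -> forall n,
    nc (midsum (fun z => F z * g z) n a b) <= M * E)) => //.
  + move=> a b Ka Kb [M1 [M10 h1]] [M2 [M20 h2]].
    (* The third summand covers [n = 0], where the midpoint of the whole segment is evaluated before
       any splitting. *)
    exists (M1 + M2 + nc (b - a) * nc (F ((a + b) / 2))); split.
      by rewrite !addr_ge0// mulr_ge0// nc_ge0.
    move=> g E gE; have Am := cap_annulus (mK Ka Kb).
    have E0 : 0 <= E := le_trans (nc_ge0 _) (gE _ Am).
    case=> [|n] /=.
      rewrite !Normc.normcM mulrA [leRHS]mulrDl.
      have H : 0 <= (M1 + M2) * E by rewrite mulr_ge0// addr_ge0.
      apply: le_trans (_ : nc (b - a) * nc (F ((a + b) / 2)) * E <= _); last by lra.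
      by rewrite ler_wpM2l ?gE// mulr_ge0// nc_ge0.
    apply: le_trans (ler_ncD _ _) _.
    rewrite [leRHS]mulrDl [(M1 + M2) * E]mulrDl.
    have := h1 _ _ gE n; have := h2 _ _ gE n.
    have : 0 <= nc (b - a) * nc (F ((a + b) / 2)) * E by rewrite !mulr_ge0 ?nc_ge0.
    lra.
  + move=> x Kx; have [d d0 hd] := cF x (cap_annulus Kx) 1 ltr01.
    exists (d / 5); first by rewrite divr_gt0.
    move=> a b Ka Kb ha hb; have Fx := nc_ge0 (F x); have ab := nc_ge0 (b - a).
    exists (nc (b - a) * (nc (F x) + 1)); split; first by rewrite mulr_ge0//; lra.
    move=> g E gE n; rewrite -mulrA.
    apply: (@midsum_le R (fun y => cap (vertex k) y /\ nc (y - x) < d)).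
    * by apply: midconvexI; [exact: mK | exact: midconvex_oball].
    * by split=> //; lra.
    * by split=> //; have := ler_ncD (b - a) (a - x); rewrite addrA subrK; lra.
    * move=> z [Kz zx]; rewrite Normc.normcM; apply: ler_pM; rewrite ?nc_ge0//.
        have := hd z (cap_annulus Kz) zx; have := ler_nc_dist (F z) (F x); lra.
      exact/gE/cap_annulus/Kz.
exists (\sum_(k < 4) M k); split.
  by apply: sumr_ge0 => k _; have [] := hM k.
move=> g E gE cFg; rewrite mulr_suml.
rewrite /contour; elim/big_ind2: _ => [|x1 x2 y1 y2 h1 h2|k _].
- by rewrite Normc.normc0.
- by apply: le_trans (ler_ncD _ _) _; exact: lerD.
- have [_ h] := hM k.
  apply: tends_le (integral_tends (@mK k) (@cK k) (cont_cap cFg) (K0 k) (K1 k)) _.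
  exact: h gE.
Qed.

(** Invariance of dz / z under scaling reduces the four sides of the square to the segment from 1 to
    i. *)
Lemma midsum_inv_scale k n a b : k != 0 ->
  midsum (fun z => z^-1) n (k * a) (k * b) = midsum (fun z => z^-1) n a b.
Proof.
move=> k0; elim: n a b => [|n IH] a b /=.
  by rewrite -mulrBr -mulrDr -mulrA invfM mulrACA mulfV// mul1r.
by rewrite -mulrDr -mulrA !IH.
Qed.

(** On the segment z = (1 - u) + i u the imaginary part of dz / z is du / ((1 - u) ^ 2 + u ^ 2), and
    this denominator is at most 1. The bound serves to show that the integral of 1 / z along the
    square, the normalizing constant of Cauchy's formula, is nonzero. *)
Lemma midsum_inv_Im n (s t : R) : 0 <= s -> s <= t -> t <= 1 ->
  t - s <= complex.Im (midsum (fun z => z^-1) n ((1 - s) +i* s)%C ((1 - t) +i* t)%C).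
Proof.
have mid (u x : R) : (((1 - u) +i* u)%C + ((1 - x) +i* x)%C) / 2 =
    ((1 - (u + x) / 2) +i* ((u + x) / 2))%C :> C.
  apply: (canLR (mulfK _)); first by rewrite pnatr_eq0.
  rewrite -(rmorph_nat (real_complex R)) /=; apply/eqP; rewrite eq_complex /=.
  by apply/andP; split; apply/eqP; field.
have midsumS f k a b : midsum f k.+1 a b =
    midsum f k a ((a + b) / 2) + midsum f k ((a + b) / 2) b by [].
elim: n s t => [|n IH] s t s0 st t1; rewrite ?midsumS.
  rewrite /midsum mid.
  set u := (s + t) / 2; have u0 : 0 <= u by rewrite /u; lra.
  have u1 : u <= 1 by rewrite /u; lra.
  rewrite /=; set D := (1 - u) ^+ 2 + u ^+ 2.
  have D0 : 0 < D by rewrite /D; nra.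
  have D1 : D <= 1 by rewrite /D; nra.
  rewrite [leRHS](_ : _ = (t - s) / D); last by field; rewrite ?gt_eqF.
  by rewrite ler_pdivlMr//; nra.
rewrite mid; set u := (s + t) / 2; have su : s <= u by rewrite /u; lra.
have ut : u <= t by rewrite /u; lra.
have h1 := IH s u s0 su (le_trans ut t1); have h2 := IH u t (le_trans s0 su) ut t1.
by move: h1 h2; case: (midsum _ _ _ _) => x y; case: (midsum _ _ _ _) => x' y' /=; lra.
Qed.

End Square.
End CauchyFormula.

(** * Cauchy transforms and their derivatives *)

Section CauchyTransform.
Variable R : realType.
Local Notation C := (R[i]%C).
Local Notation nc := (@Normc.normc R).
Local Notation I := ('i%C : C).
Implicit Types (f g F : C -> C) (a b c z w l p v : C).

(** Second-order remainder of x ^ (- j), uniform over the x with |1 / x| <= [B]. With [a = z - w]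
    and [b = z - (w + u)] it justifies differentiating a Cauchy kernel under the contour
    integral. *)
Lemma inv_power_bound j (B : R) : 0 <= B -> exists M : R, 0 <= M /\
  forall a b : C, a != 0 -> b != 0 -> nc a^-1 <= B -> nc b^-1 <= B ->
  nc (b^-1 ^+ j - a^-1 ^+ j - (a - b) * (j%:R * a^-1 ^+ j.+1)) <=
    M * nc (a - b) ^+ 2.
Proof.
move=> B0; have ncX (x : C) n : nc x <= B -> nc (x ^+ n) <= B ^+ n.
  move=> xB; elim: n => [|n IH]; first by rewrite !expr0 Normc.normc1.
  by rewrite !exprS Normc.normcM; exact: ler_pM (nc_ge0 _) (nc_ge0 _) xB IH.
elim: j => [|j [M [M0 IH]]].
  exists 0; split=> // a b _ _ _ _.
  by rewrite !expr0 !mul0r mulr0 subrr subr0 Normc.normc0.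
exists (B * M + B ^+ j.+3 + nc j%:R * B ^+ j.+3); split.
  have Bj : 0 <= B ^+ j.+3 by exact: exprn_ge0.
  by rewrite !addr_ge0 // mulr_ge0 // nc_ge0.
move=> a b a0 b0 aB bB; have := IH a b a0 b0 aB bB.
set u := a - b; set E := _ - _ - _ => hE.
have dxy : b^-1 - a^-1 = u * (a^-1 * b^-1) by rewrite /u; field; rewrite ?a0 ?b0.
have -> : b^-1 ^+ j.+1 - a^-1 ^+ j.+1 - u * (j.+1%:R * a^-1 ^+ j.+2) =
    b^-1 * E + u ^+ 2 * (a^-1 ^+ j.+2 * b^-1) + j%:R * (u ^+ 2 * (a^-1 ^+ j.+2 * b^-1)).
  (* Inverses are atoms for [ring]; the two sides differ by a multiple of the relation [dxy] between
     them. *)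
  apply/eqP; rewrite -subr_eq0 [X in X == 0](_ : _ = a^-1 ^+ j *
    (1 + u * j.+1%:R * a^-1) * (b^-1 - a^-1 - u * (a^-1 * b^-1))).
    by rewrite dxy subrr mulr0.
  rewrite /E !exprS -natr1; move: (b^-1 ^+ j) (a^-1 ^+ j) (a^-1) (b^-1) (j%:R : C).
  by move=> Y X x y J; ring.
have h1 : nc (a^-1 ^+ j.+2 * b^-1) <= B ^+ j.+3.
  rewrite [leRHS]exprSr Normc.normcM.
  exact: ler_pM (nc_ge0 _) (nc_ge0 _) (ncX _ _ aB) bB.
have nu : nc (u ^+ 2) = nc u ^+ 2 by rewrite !expr2 Normc.normcM.
have h2 : nc (u ^+ 2 * (a^-1 ^+ j.+2 * b^-1)) <= B ^+ j.+3 * nc u ^+ 2.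
  by rewrite Normc.normcM nu mulrC ler_wpM2r// sqr_ge0.
apply: le_trans (ler_ncD _ _) _; rewrite [leRHS]mulrDl; apply: lerD; last first.
  by rewrite Normc.normcM -[leRHS]mulrA; apply: ler_wpM2l h2; exact: nc_ge0.
apply: le_trans (ler_ncD _ _) _; rewrite [leRHS]mulrDl; apply: lerD h2.
by rewrite Normc.normcM -[leRHS]mulrA; exact: ler_pM (nc_ge0 _) (nc_ge0 _) bB hE.
Qed.

Section Square.
Variable rho : R.
Hypothesis rho_gt0 : 0 < rho.
Local Notation annulus := (annulus rho).
Local Notation contour := (contour rho).

Lemma annulus_shift z w : annulus z -> nc w < rho / 4 ->
  z - w != 0 /\ nc (z - w)^-1 <= 4 / rho.
Proof.
move=> /andP[z1 _] w1; have h := ler_nc_dist z w.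
have zw : rho / 4 <= nc (z - w) by lra.
have zw0 : 0 < nc (z - w) by have := rho_gt0; lra.
split; first by apply: contraTneq zw0 => ->; rewrite Normc.normc0 ltxx.
rewrite Normc.normcV -[4 / rho]invf_div lef_pV2 ?posrE//; have := rho_gt0; lra.
Qed.

Definition cauchy_transform F j w := contour (fun z => F z * (z - w)^-1 ^+ j).

Definition derivable_on_annulus F := forall z, annulus z -> exists l, cderiv F z l.

Lemma derivable_kernel F j w : derivable_on_annulus F -> nc w < rho / 4 ->
  derivable_on_annulus (fun z => F z * (z - w)^-1 ^+ j).
Proof.
move=> dF hw z hz; have [l dl] := dF z hz; have [zw _] := annulus_shift hz hw.
eexists; apply: cderivM dl _; apply: cderivX; apply: (cderivV (f := fun z => z - w)) => //.
by apply: cderivB; [exact: cderiv_id | exact: cderiv_cst].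
Qed.

(** With [F] fixed, [contour_le] turns the uniform bound on the remainder [g] of the kernel into a
    bound on its contour integral against [F]. *)
Lemma cauchy_transform_deriv F j w : derivable_on_annulus F -> nc w < rho / 4 ->
  cderiv (cauchy_transform F j) w (j%:R * cauchy_transform F j.+1 w).
Proof.
move=> dF hw e e0.
have cker k v : nc v < rho / 4 -> cont_on annulus (fun z => F z * (z - v)^-1 ^+ k).
  by move=> hv; apply: cderiv_cont; exact: derivable_kernel.
have [M [M0 hM]] := contour_le rho_gt0 (cderiv_cont dF).
have B0 : 0 <= 4 / rho by rewrite divr_ge0// ltW.
have [M' [M'0 hM']] := inv_power_bound j B0.
have MM : 0 < M * M' + 1 by have := mulr_ge0 M0 M'0; lra.
exists (Num.min (rho / 4 - nc w) (e / (M * M' + 1))).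
  by rewrite lt_min subr_gt0 hw divr_gt0.
move=> u; rewrite lt_min ltr_pdivlMr// => /andP[u1 u2].
have hwu : nc (w + u) < rho / 4 by have := ler_ncD w u; lra.
pose g z := (z - (w + u))^-1 ^+ j - (z - w)^-1 ^+ j - u * (j%:R * (z - w)^-1 ^+ j.+1).
have -> : cauchy_transform F j (w + u) - cauchy_transform F j w -
    u * (j%:R * cauchy_transform F j.+1 w) = contour (fun z => F z * g z).
  rewrite /cauchy_transform [RHS](_ : _ = contour (fun z =>
    (F z * (z - (w + u))^-1 ^+ j + (-1) * (F z * (z - w)^-1 ^+ j)) +
    (- (u * j%:R)) * (F z * (z - w)^-1 ^+ j.+1))); last first.
    by congr contour; apply/funext => z; rewrite /g; ring.
  have c1 := cker j _ hwu; have c2 := cker j _ hw; have c3 := cker j.+1 _ hw.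
  have dZ k v a : nc v < rho / 4 ->
      derivable_on_annulus (fun z => a * (F z * (z - v)^-1 ^+ k)).
    move=> hv z hz; have [l dl] := derivable_kernel k dF hv hz.
    by exists (a * l); exact: cderivZ.
  have cA := cderiv_cont (dZ j w (-1) hw).
  have cB := cderiv_cont (dZ j.+1 w (- (u * j%:R)) hw).
  have cAB : cont_on annulus (fun z => F z * (z - (w + u))^-1 ^+ j +
      (-1) * (F z * (z - w)^-1 ^+ j)).
    apply: cderiv_cont => z hz; have [l1 d1] := derivable_kernel j dF hwu hz.
    have [l2 d2] := dZ j w (-1) hw z hz; eexists; exact: cderivD d1 d2.
  rewrite (contourD rho_gt0 cAB cB) (contourD rho_gt0 c1 cA).
  rewrite (contourZ rho_gt0 _ c2) (contourZ rho_gt0 _ c3).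
  have E (X Y Z k l : C) : X - Y - k * (l * Z) = X + -1 * Y + - (k * l) * Z by ring.
  exact: E.
apply: le_trans (hM g (M' * nc u ^+ 2) _ _) _.
- move=> z hz; have [z1 z2] := annulus_shift hz hw.
  have [z3 z4] := annulus_shift hz hwu.
  have := hM' (z - w) (z - (w + u)) z1 z3 z2 z4.
  by have -> : z - w - (z - (w + u)) = u by ring.
- apply: cderiv_cont => z hz.
  have [l1 d1] := derivable_kernel j dF hwu hz.
  have [l2 d2] := derivable_kernel j dF hw hz.
  have [l3 d3] := derivable_kernel j.+1 dF hw hz.
  eexists; apply: eq_cderiv (cderivB (cderivB d1 d2) (cderivZ (u * j%:R) d3)) => v.
  by rewrite /g; ring.
have u0 := nc_ge0 u; rewrite mulrA expr2 mulrA ler_wpM2r//.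
by have := mulr_ge0 M0 M'0; nra.
Qed.

(** By scaling, each side contributes the integral from 1 to i, whose midpoint sums have imaginary
    part at least 1. *)
Lemma contour_inv_neq0 : contour (fun z => z^-1) != 0.
Proof.
have E k : integral (fun z : C => z^-1) (vertex rho k) (vertex rho k.+1) =
    integral (fun z : C => z^-1) 1 I.
  have k0 : vertex rho k != 0.
    by apply: contraTneq rho_gt0 => h; rewrite -(nc_vertex rho_gt0 k) h Normc.normc0 ltxx.
  have H n : midsum (fun z => z^-1) n (vertex rho k) (vertex rho k.+1) =
      midsum (fun z => z^-1) n 1 I.
    by rewrite vertexS -[X in midsum _ _ X _]mulr1 (mulrC I) midsum_inv_scale.
  by congr (xget _ _); apply/seteqP; split=> l; apply: eq_tends => n; rewrite H.
rewrite /contour (eq_bigr (fun=> integral (fun z : C => z^-1) 1 I)) => [|k _]; last exact: E.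
rewrite sumr_const card_ord mulrn_eq0 /=; apply/eqP => J0.
have dinv : derivable_on_annulus (fun z => z^-1).
  move=> z hz; have [|z0 _] := annulus_shift hz (w := 0).
    by rewrite Normc.normc0 divr_gt0.
  rewrite subr0 in z0; eexists; exact: cderivV z0 (cderiv_id _).
have T := integral_tends (@midconvex_cap _ (vertex rho 0)) (@limclosed_cap _ (vertex rho 0))
  (cont_on_sub (@cap_annulus _ _ rho_gt0 0) (cderiv_cont dinv)) (cap_start _).
have T1 := T (vertex rho 1); rewrite E vertexS in T1.
have {T1} := T1 (cap_end _) (1 / 2); rewrite divr_gt0// => /(_ isT) [n /(_ n (leqnn _))].
rewrite J0 subr0 => h; have := Im_le_nc (midsum (fun z => z^-1) n (vertex rho 0) (I * vertex rho 0)).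
have v0 : vertex rho 0 != 0.
  by apply: contraTneq rho_gt0 => v0; rewrite -(nc_vertex rho_gt0 0) v0 Normc.normc0 ltxx.
have := @midsum_inv_Im R n 0 1 (lexx _) ler01 (lexx _).
have -> : ((1 - 0) +i* 0)%C = 1 :> C by rewrite subr0.
have -> : ((1 - 1) +i* 1)%C = I :> C by rewrite subrr.
rewrite -(midsum_inv_scale n _ _ v0) mulr1 (mulrC _ I) subr0 => h1.
by have := ler_norm (complex.Im (midsum (fun z => z^-1) n (vertex rho 0) (I * vertex rho 0))); lra.
Qed.

(** The w-derivative is the contour integral of (z - w) ^ (- 2), which has the primitive - 1 / (z -
    w) on the annulus; hence the left side is constant in [w]. *)
Lemma contour_inv_shift w : nc w < rho / 4 ->
  contour (fun z => (z - w)^-1) = contour (fun z => z^-1).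
Proof.
move=> hw; have d1 : derivable_on_annulus (fun=> 1).
  by move=> z _; exists 0; exact: cderiv_cst.
pose K v := nc (v - 0) <= nc w.
have sub v : K v -> nc v < rho / 4 by rewrite /K subr0; lra.
have dK v : K v -> cderiv (cauchy_transform (fun=> 1) 1) v 0.
  move=> /sub hv; have := cauchy_transform_deriv 1 d1 hv.
  rewrite mul1r /cauchy_transform (contour_deriv rho_gt0 (F := fun z => - (z - v)^-1))//.
    exact/cderiv_cont/derivable_kernel.
  move=> z hz; have [zv _] := annulus_shift hz hv.
  have := cderivN (cderivV (f := fun z => z - v) zv (cderivB (cderiv_id z) (cderiv_cst v z))).
  by rewrite subr0 mulr1 opprK mul1r exprVn.
have E v : contour (fun z => (z - v)^-1) = cauchy_transform (fun=> 1) 1 v.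
  by congr contour; apply/funext => z; rewrite mul1r expr1.
have -> : contour (fun z => z^-1) = contour (fun z => (z - 0)^-1).
  by congr contour; apply/funext => z; rewrite subr0.
rewrite !E; apply/eqP; rewrite -subr_eq0; apply/eqP.
rewrite -(integral_deriv (K := K) (f := fun=> 0)) ?integral_cst ?mulr0//.
- exact: midconvex_ball.
- exact: limclosed_ball.
- by move=> x _ e e0; exists 1 => // y _ _; rewrite subrr Normc.normc0 ltW.
- by rewrite /K subrr Normc.normc0 nc_ge0.
- by rewrite /K subr0.
Qed.

End Square.
End CauchyTransform.

(** * Smoothness and the identity theorem on a disc *)

Section Holomorphic.
Variable R : realType.
Local Notation C := (R[i]%C).
Local Notation nc := (@Normc.normc R).
Implicit Types (f g F : C -> C) (a b c z w l p v : C).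

Definition holo_disc p (r : R) f :=
  forall z, nc (z - p) < r -> exists l, cderiv f z l.

Section AtOrigin.
Variables (f : C -> C) (r : R).
Hypotheses (r_gt0 : 0 < r) (df : holo_disc 0 r f).

Let F := primitive f 0.
Let rho := r / 2.
Let rho_gt0 : 0 < rho. Proof. exact: divr_gt0. Qed.

Let ball0 z : nc z < r -> nc (z - 0) < r. Proof. by rewrite subr0. Qed.

Let dF z : nc z < r -> cderiv F z (f z).
Proof. by move=> /ball0; exact: primitive_deriv. Qed.

Let dFA : derivable_on_annulus rho F.
Proof. by move=> z /andP[_ h]; exists (f z); apply: dF; rewrite /rho in h; have := r_gt0; lra. Qed.

Let quot w z := if z == w then f w else (F z - F w) / (z - w).

(* A primitive is twice differentiable, which makes its difference quotient
   differentiable even at the removable point. *)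
Let quot_deriv w z : nc w < r -> nc z < r -> exists l, cderiv (quot w) z l.
Proof.
move=> hw hz; have [->|zw] := eqVneq z w; last first.
  have zw0 : z - w != 0 by rewrite subr_eq0.
  have D := cderivM (cderivB (dF hz) (cderiv_cst (F w) z))
    (cderivV (f := fun v => v - w) zw0 (cderivB (cderiv_id z) (cderiv_cst w z))).
  eexists; apply: cderiv_near (nc_gt0 zw0) _ D => v hv.
  rewrite /quot ifF//; apply: contraTF hv => /eqP ->.
  by rewrite -leNgt ncB.
(* [l] is the derivative of [f] at [w]. Integrating the affine approximation of [f] gives F(w + u) =
   F(w) + u f(w) + u ^ 2 l / 2 + o(u ^ 2), so the difference quotient has slope [l / 2]. *)
have [l dl] := df (ball0 hw); exists (l / 2) => e e0.
have [d d0 hd] := dl e e0.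
exists (Num.min d (r - nc w)); first by rewrite lt_min d0 subr_gt0.
move=> u; rewrite lt_min => /andP[u1 u2].
have hwu : nc (w + u) < r by have := ler_ncD w u; lra.
rewrite /quot eqxx; have [->|u0] := eqVneq u 0.
  by rewrite addr0 eqxx subrr mul0r subr0 Normc.normc0 mulr0.
rewrite ifF; last by rewrite -subr_eq0 addrAC subrr add0r (negPf u0).
have -> : w + u - w = u by rewrite addrAC subrr add0r.
pose K z := nc (z - w) <= nc u.
have dK v : K v -> exists l, cderiv f v l.
  move=> Kv; apply: df; rewrite subr0; rewrite /K in Kv.
  by have := ler_ncD (v - w) w; rewrite subrK; lra.
have mK : midconvex K by exact: midconvex_ball.
have cK : limclosed K by exact: limclosed_ball.
have Kw : K w by rewrite /K subrr Normc.normc0 nc_ge0.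
have Ku : K (w + u) by rewrite /K addrAC subrr add0r.
have dKF v : K v -> cderiv F v (f v).
  move=> Kv; apply: dF; rewrite /K in Kv.
  by have := ler_ncD (v - w) w; rewrite subrK; lra.
have cf := cderiv_cont dK.
pose g v := f v - ((f w - l * w) + l * v).
have dg v : K v -> exists k, cderiv g v k.
  move=> /dK[k dk]; eexists; apply: cderivB dk _.
  exact: cderivD (cderiv_cst _ _) (cderivZ l (cderiv_id v)).
have daff : cont_on K (fun v => (f w - l * w) + l * v).
  apply: cderiv_cont => v _; eexists.
  exact: cderivD (cderiv_cst _ _) (cderivZ l (cderiv_id v)).
have := integral_deriv mK cK cf dKF Kw Ku.
rewrite (eq_integral mK cK (g := fun v => g v + ((f w - l * w) + l * v)) cf Kw Ku); last first.
  by move=> v _; rewrite /g subrK.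
rewrite (integralD mK cK (cderiv_cont dg) daff Kw Ku) integral_affine => E.
have Eg : F (w + u) - F w - u * f w - u ^+ 2 * (l / 2) = integral g w (w + u).
  by rewrite -E; field.
have ge : nc (integral g w (w + u)) <= nc u * (e * nc u).
  rewrite -[X in nc X * _](_ : w + u - w = u); last by rewrite addrAC subrr add0r.
  apply: (integral_le mK cK (cderiv_cont dg) Kw Ku) => v Kv.
  have := hd (v - w); rewrite [w + _]addrC subrK.
  have -> : f v - f w - (v - w) * l = g v by rewrite /g; ring.
  move=> H; apply: le_trans (H _) _; first exact: le_lt_trans Kv u1.
  by rewrite ler_wpM2l ?(ltW e0).
have u3 := nc_gt0 u0; rewrite -(ler_pM2l u3) -Normc.normcM.
apply: le_trans ge; rewrite -Eg.
rewrite le_eqVlt; apply/orP; left; apply/eqP; congr nc; field.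
exact: u0.
Qed.

Let c := contour rho (fun z => z^-1).

(** The quotient [quot w] has a primitive on the disc, so its contour integral vanishes; what is
    left is F(w) times the integral of 1 / (z - w), which equals [c]. *)
Let cauchy_formula w : nc w < rho / 4 -> cauchy_transform rho F 1 w = c * F w.
Proof.
move=> hw; have hwr : nc w < r by rewrite /rho in hw; have := r_gt0; lra.
have dq z : nc (z - 0) < r -> exists l, cderiv (quot w) z l.
  by rewrite subr0; exact: quot_deriv.
have annr z : annulus rho z -> nc (z - 0) < r.
  by move=> /andP[_]; rewrite subr0 /rho; have := r_gt0; lra.
have cq : cont_on (annulus rho) (quot w).
  by apply: cderiv_cont => z /annr; exact: dq.
have q0 : contour rho (quot w) = 0.
  apply: (contour_deriv rho_gt0 (F := primitive (quot w) 0)) => // z /annr.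
  exact: primitive_deriv.
have c1 := cderiv_cont (derivable_kernel rho_gt0 1 dFA hw).
have d1 : derivable_on_annulus rho (fun=> 1 : C).
  by move=> z _; exists 0; exact: cderiv_cst.
have c2 := cderiv_cont (derivable_kernel rho_gt0 1 d1 hw).
have E : cauchy_transform rho F 1 w = contour rho (fun z =>
    quot w z + F w * (1 * (z - w)^-1 ^+ 1)).
  apply: (eq_contour rho_gt0 c1) => z hz.
  have [zw _] := annulus_shift rho_gt0 hz hw.
  rewrite /quot ifF; last by rewrite -subr_eq0 (negPf zw).
  by rewrite !expr1; ring.
have c3 : cont_on (annulus rho) (fun z => F w * (1 * (z - w)^-1 ^+ 1)).
  apply: cderiv_cont => z hz; have [k dk] := derivable_kernel rho_gt0 1 d1 hw hz.
  by eexists; exact: cderivZ dk.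
rewrite E (contourD rho_gt0 cq c3) (contourZ rho_gt0 _ c2) q0 add0r mulrC.
rewrite /c -(contour_inv_shift rho_gt0 hw); congr (_ * _).
by congr (contour _ _); apply/funext => z; rewrite mul1r expr1.
Qed.

(** The index counts derivatives of the primitive [F]: near 0, [taylor 0] is [F], [taylor 1] is [f]
    and [taylor 2] is the derivative of [f]. *)
Let taylor j w := j`!%:R / c * cauchy_transform rho F j.+1 w.

Let taylor_deriv j w : nc w < rho / 4 -> cderiv (taylor j) w (taylor j.+1 w).
Proof.
move=> hw; have := cderivZ (j`!%:R / c) (cauchy_transform_deriv rho_gt0 j.+1 dFA hw).
by rewrite /taylor factS natrM mulrA (mulrC j.+1%:R) (mulrAC j`!%:R).
Qed.

Let taylor0 w : nc w < rho / 4 -> taylor 0 w = F w.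
Proof.
move=> hw; rewrite /taylor cauchy_formula// mulrA mulfVK ?mul1r//.
exact: contour_inv_neq0.
Qed.

Let near_ball w : nc w < rho / 4 -> exists2 d : R, 0 < d &
  forall z, nc (z - w) < d -> nc z < rho / 4.
Proof.
move=> hw; exists (rho / 4 - nc w); first by rewrite subr_gt0.
by move=> z hz; have := ler_ncD (z - w) w; rewrite subrK; lra.
Qed.

Let taylor1 w : nc w < rho / 4 -> taylor 1 w = f w.
Proof.
move=> hw; have [d d0 hd] := near_ball hw.
have D : cderiv F w (taylor 1 w).
  by apply: cderiv_near d0 _ (taylor_deriv 0 hw) => z /hd; exact: taylor0.
apply: cderiv_unique D (dF _).
by rewrite /rho in hw; have := r_gt0; lra.
Qed.

Lemma deriv_holo_at0 f' : (forall z, nc z < r -> cderiv f z (f' z)) ->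
  exists l, cderiv f' 0 l.
Proof.
move=> df'; exists (taylor 3 0).
have h0 : nc 0 < rho / 4 by rewrite Normc.normc0 divr_gt0.
have [d d0 hd] := near_ball h0.
apply: cderiv_near d0 _ (taylor_deriv 2 h0) => w /hd hw.
have [d' d'0 hd'] := near_ball hw.
have D : cderiv f w (taylor 2 w).
  by apply: cderiv_near d'0 _ (taylor_deriv 1 hw) => z /hd'; exact: taylor1.
apply: cderiv_unique D (df' _ _).
by rewrite /rho in hw; have := r_gt0; lra.
Qed.

(** The moments of [F] against z ^ (- j - 1) all vanish, the first one because [F] is 0 at the
    origin. Iterating 1 / (z - w) = 1 / z + (w / z) / (z - w) in Cauchy's formula thus writes
    [c * F w] as the integral of F(z) (w / z) ^ J / (z - w) for every J, and |w / z| <= 1 / 2 drives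
    it to 0. The radius is [r / 8] because the square has radius [r / 2] and [w] stays within a
    quarter of it. *)
Lemma flat_at0 (f_ : nat -> C -> C) : f_ 0%N = f ->
  (forall j z, nc z < r -> cderiv (f_ j) z (f_ j.+1 z)) ->
  (forall j, f_ j 0 = 0) -> forall w, nc w < r / 8 -> f w = 0.
Proof.
move=> f0 dfj z0.
have wr w : nc w < rho / 4 -> nc w < r by rewrite /rho; have := r_gt0; lra.
have Tf j w : nc w < rho / 4 -> taylor j.+1 w = f_ j w.
  elim: j w => [|j IH] w hw; first by rewrite f0; exact: taylor1.
  have [d d0 hd] := near_ball hw.
  have D : cderiv (f_ j) w (taylor j.+2 w).
    by apply: cderiv_near d0 _ (taylor_deriv j.+1 hw) => z /hd; exact: IH.
  exact: cderiv_unique D (dfj _ _ (wr _ hw)).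
have c0 : c != 0 := contour_inv_neq0 rho_gt0.
have h0 : nc 0 < rho / 4 by rewrite Normc.normc0 divr_gt0.
have T0 j : cauchy_transform rho F j.+1 0 = 0.
  have : taylor j 0 = 0.
    case: j => [|j]; last by rewrite Tf.
    by rewrite taylor0// /F /primitive integral_id.
  move=> /eqP; rewrite mulf_eq0 (negPf (_ : _ / c != 0)) => [/eqP//|].
  by rewrite mulf_neq0 ?invr_eq0// pnatr_eq0 -lt0n fact_gt0.
have [M [M0 hM]] := contour_le rho_gt0 (cderiv_cont dFA).
have F0 w : nc w < rho / 4 -> F w = 0.
  move=> hw; pose k J z := w ^+ J * z^-1 ^+ J * (z - w)^-1.
  have dk J : derivable_on_annulus rho (fun z => F z * k J z).
    move=> z hz; have [z1 _] := annulus_shift rho_gt0 hz h0; rewrite subr0 in z1.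
    have [l dl] := derivable_kernel rho_gt0 1 dFA hw hz.
    have := cderivM (cderivZ (w ^+ J) (cderivX J (cderivV z1 (cderiv_id z)))) dl.
    by move=> D; eexists; apply: eq_cderiv D => v; rewrite /k; ring.
  have E J : contour rho (fun z => F z * k J z) = c * F w.
    elim: J => [|J IH].
      rewrite -cauchy_formula//; congr (contour _ _); apply/funext => z.
      by rewrite /k !expr0 !mul1r expr1.
    have dp := derivable_kernel rho_gt0 J.+1 dFA h0.
    rewrite -IH (eq_contour rho_gt0 (f := fun z => F z * k J z) (g := fun z =>
      w ^+ J * (F z * (z - 0)^-1 ^+ J.+1) + F z * k J.+1 z)).
    - have cp : cont_on (annulus rho) (fun z => w ^+ J * (F z * (z - 0)^-1 ^+ J.+1)).
        by apply: cderiv_cont => z /dp[l dl]; eexists; exact: cderivZ dl.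
      rewrite (contourD rho_gt0 cp (cderiv_cont (dk J.+1))).
      rewrite (contourZ rho_gt0 _ (cderiv_cont dp)).
      by rewrite -/(cauchy_transform rho F J.+1 0) T0 mulr0 add0r.
    - exact: cderiv_cont (dk J).
    - move=> z hz; have [z1 _] := annulus_shift rho_gt0 hz h0; rewrite subr0 in z1.
      have [z2 _] := annulus_shift rho_gt0 hz hw.
      have -> : F z * k J z = F z * (w ^+ J * z^-1 ^+ J) * (z - w)^-1 by rewrite /k; ring.
      have -> : (z - w)^-1 = z^-1 + w * z^-1 * (z - w)^-1.
        by field; rewrite z1 z2.
      by rewrite /k subr0 !exprS; ring.
  have B J : nc (c * F w) <= M * (4 / rho) * 2^-1 ^+ J.
    rewrite -(E J) -mulrA; apply: hM; last exact: cderiv_cont (dk J).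
    move=> z hz; have [_ z2] := annulus_shift rho_gt0 hz hw.
    have [z1 _] := annulus_shift rho_gt0 hz h0; rewrite subr0 in z1.
    rewrite /k -exprMn Normc.normcM mulrC; apply: ler_pM => //; try exact: nc_ge0.
    have wz : nc (w * z^-1) <= 2^-1.
      rewrite Normc.normcM Normc.normcV ler_pdivrMr ?nc_gt0//.
      by move: hz => /andP[hz _]; lra.
    elim: J => [|J IH]; first by rewrite !expr0 Normc.normc1.
    rewrite !exprS Normc.normcM; exact: ler_pM (nc_ge0 _) (nc_ge0 _) wz IH.
  have : c * F w = 0.
    apply: nc_le0 => e e0; have [J hJ] := exp2_lt (M * (4 / rho)) e0.
    exact: le_trans (B J) (ltW hJ).
  by move=> /eqP; rewrite mulf_eq0 (negPf c0) => /eqP.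
move=> w; rewrite (_ : r / 8 = rho / 4); last by rewrite /rho; field.
move=> hw; have [d d0 hd] := near_ball hw.
have D : cderiv F w 0.
  by apply: cderiv_near d0 _ (cderiv_cst 0 w) => z /hd/F0 ->.
exact: cderiv_unique (dF (wr _ hw)) D.
Qed.

End AtOrigin.

(** [deriv_holo_at0] speaks of the centre alone, so it is applied to the translates of [f] that
    bring each point [q] of the disc to the origin. *)
Lemma deriv_holo p r f f' : (forall z, nc (z - p) < r -> cderiv f z (f' z)) ->
  holo_disc p r f'.
Proof.
move=> df q hq; have r0 : 0 < r - nc (q - p) by rewrite subr_gt0.
have hz z : nc z < r - nc (q - p) -> nc (q + 1 * z - p) < r.
  by rewrite mul1r addrAC => h; have := ler_ncD (q - p) z; lra.
have df0 z : nc z < r - nc (q - p) -> cderiv (fun w => f (q + 1 * w)) z (f' (q + 1 * z)).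
  by move=> /hz/df /cderiv_shift; rewrite (mul1r (f' _)).
have [|l dl] := @deriv_holo_at0 (fun z => f (q + 1 * z)) _ r0 _ (fun z => f' (q + 1 * z)) df0.
  by move=> z; rewrite subr0 => /df0 ?; eexists; eassumption.
exists l; have := @cderiv_shift _ (fun z => f' (q + 1 * z)) (- q) 1 q l.
rewrite mul1r addNr mul1r => /(_ dl); apply: eq_cderiv => z.
by rewrite !mul1r addrA subrr add0r.
Qed.

Lemma flat_disc p r (f_ : nat -> C -> C) : 0 < r ->
  (forall j z, nc (z - p) < r -> cderiv (f_ j) z (f_ j.+1 z)) ->
  (forall j, f_ j p = 0) -> forall w, nc (w - p) < r / 8 -> f_ 0%N w = 0.
Proof.
move=> r0 df z0 w hw.
have df0 j z : nc z < r -> cderiv (fun v => f_ j (p + 1 * v)) z (f_ j.+1 (p + 1 * z)).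
  move=> hz; have hz' : nc (p + 1 * z - p) < r by rewrite mul1r addrAC subrr add0r.
  by have := cderiv_shift (df j _ hz'); rewrite [1 * f_ _ _]mul1r.
have H := @flat_at0 (fun v => f_ 0%N (p + 1 * v)) r r0 _ (fun j v => f_ j (p + 1 * v)) erefl df0.
have E : p + 1 * (w - p) = w by ring.
have := H _ _ (w - p); rewrite E; apply=> //.
- by move=> z; rewrite subr0 => /(df0 0%N) ?; eexists; eassumption.
- by move=> j; rewrite mulr0 addr0.
Qed.

(* Junk value 0 where f is not complex differentiable. *)
Definition cder f z : C := xget 0 [set l | cderiv f z l].

Lemma cderP f z l : cderiv f z l -> cder f z = l.
Proof. by move=> h; apply: xget_unique => // l' h'; exact: cderiv_unique h' h. Qed.

Lemma cderE f z : (exists l, cderiv f z l) -> cderiv f z (cder f z).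
Proof. by move=> [l hl]; have := hl; rewrite -{1}(cderP hl). Qed.

Lemma holo_cder p r f : holo_disc p r f -> holo_disc p r (cder f).
Proof. by move=> hf; apply: (@deriv_holo p r f) => z /hf/cderE. Qed.

Lemma holo_iter p r f j : holo_disc p r f -> holo_disc p r (iter j cder f).
Proof. by move=> hf; elim: j => //= j; exact: holo_cder. Qed.

Lemma holo_flat p r f : 0 < r -> holo_disc p r f ->
  (forall j, iter j cder f p = 0) -> forall w, nc (w - p) < r / 8 -> f w = 0.
Proof.
move=> r0 hf h0; apply: (@flat_disc p r (fun j => iter j cder f)) => // j z hz.
exact/cderE/(holo_iter j hf).
Qed.

Lemma holo_vanish_near p r f (d : R) : 0 < r -> holo_disc p r f -> 0 < d ->
  (forall w, nc (w - p) < d -> f w = 0) -> forall w, nc (w - p) < r / 8 -> f w = 0.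
Proof.
move=> r0 hf d0 f0; apply: holo_flat => // j.
have : forall w, nc (w - p) < d -> iter j cder f w = 0.
  elim: j => //= j IH w hw; apply: cderP.
  apply: (@cderiv_near _ (fun=> 0) _ _ _ (d - nc (w - p))); last exact: cderiv_cst.
    by rewrite subr_gt0.
  move=> v hv; rewrite IH//.
  by have := ler_ncD (v - w) (w - p); rewrite addrA subrK; lra.
by apply; rewrite subrr Normc.normc0.
Qed.

Lemma holo_deriv0_cst p r f : (forall z, nc (z - p) < r -> cderiv f z 0) ->
  forall a b, nc (a - p) < r -> nc (b - p) < r -> f a = f b.
Proof.
move=> df a b ha hb; apply/esym/eqP; rewrite -subr_eq0; apply/eqP.
pose K z := nc (z - p) <= Num.max (nc (a - p)) (nc (b - p)).
rewrite -(integral_deriv (K := K) (f := fun=> 0)) ?integral_cst ?mulr0//.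
- exact: midconvex_ball.
- exact: limclosed_ball.
- by move=> x _ e e0; exists 1 => // y _ _; rewrite subrr Normc.normc0 ltW.
- by move=> z hz; apply: df; apply: le_lt_trans hz _; rewrite gt_max ha.
- by rewrite /K le_max lexx.
- by rewrite /K le_max lexx orbT.
Qed.

End Holomorphic.

(** * Polarization and kernels on a disc *)

Section Polarization.
Variable R : realType.
Local Notation C := (R[i]%C).
Local Notation nc := (@Normc.normc R).
Local Notation I := ('i%C : C).
Local Notation conj := (@conjc R).
Implicit Types (f g : C -> C) (a b z w p : C).

Lemma conjcM z w : conj (z * w) = conj z * conj w.
Proof. exact: rmorphM. Qed.

Lemma conjcD z w : conj (z + w) = conj z + conj w.
Proof. exact: rmorphD. Qed.

(* X and Y are the Wirtinger derivatives dg/dz and dg/dzbar at the origin. *)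
Definition real_expansion (g : C -> C) (X Y : C) := forall e : R, 0 < e ->
  exists2 d : R, 0 < d & forall u, nc u < d ->
    nc (g u - g 0 - (u * X + conj u * Y)) <= e * nc u.

Lemma real_expansion_sum (T : finType) (g : T -> C -> C) (X Y : T -> C) :
  (forall i, real_expansion (g i) (X i) (Y i)) ->
  real_expansion (fun u => \sum_i g i u) (\sum_i X i) (\sum_i Y i).
Proof.
move=> h; rewrite /index_enum; elim: (Finite.enum T) => [|i s IH] e e0.
  exists 1 => // u _; rewrite !big_nil !mulr0 addr0 !subr0 Normc.normc0.
  by rewrite mulr_ge0 ?nc_ge0 ?ltW.
have e2 : 0 < e / 2 by rewrite divr_gt0.
have [d1 d10 h1] := h i _ e2; have [d2 d20 h2] := IH _ e2.
exists (Num.min d1 d2); first by rewrite lt_min d10.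
move=> u; rewrite lt_min => /andP[/h1 {}h1 /h2 {}h2]; rewrite !big_cons.
move: h1 h2; set S := bigop _ _ _; set S0 := bigop _ _ _; set SX := bigop _ _ _.
set SY := bigop _ _ _ => h1 h2.
have -> : g i u + S - (g i 0 + S0) - (u * (X i + SX) + conj u * (Y i + SY)) =
  (g i u - g i 0 - (u * X i + conj u * Y i)) + (S - S0 - (u * SX + conj u * SY)).
  by ring.
by apply: le_trans (ler_ncD _ _) _; lra.
Qed.

Lemma real_expansionM f g z a b : cderiv f z a -> cderiv g z b ->
  real_expansion (fun u => f (z + u) * conj (g (z + u)))
    (a * conj (g z)) (f z * conj b).
Proof.
move=> df dg e e0.
have f0 := nc_ge0 (f z); have g0 := nc_ge0 (g z).
have a0 := nc_ge0 a; have b0 := nc_ge0 b.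
(* [k] dominates the factors that multiply the two remainders, and [m] comes from the product of the
   two increments, which is quadratic in [u]. *)
set k := nc (f z) + nc (g z) + 1; have k0 : 0 < k by rewrite /k; lra.
set m := (nc a + 1) * (nc b + 1); have m0 : 0 < m by rewrite /m mulr_gt0//; lra.
have e1 : 0 < Num.min 1 (e / 2 / k) by rewrite lt_min ltr01 !divr_gt0.
have [d1 d10 h1] := df _ e1; have [d2 d20 h2] := dg _ e1.
exists (Num.min (Num.min d1 d2) (e / 2 / m)).
  by rewrite !lt_min d10 d20 !divr_gt0.
move=> u; rewrite !lt_min => /andP[/andP[/h1 {}h1 /h2 {}h2] um].
set al := f (z + u) - f z - u * a in h1; set be := g (z + u) - g z - u * b in h2.
have -> : f (z + u) = f z + (u * a + al) by rewrite /al; ring.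
have -> : g (z + u) = g z + (u * b + be) by rewrite /be; ring.
rewrite !addr0.
have -> : (f z + (u * a + al)) * conj (g z + (u * b + be)) - f z * conj (g z) -
   (u * (a * conj (g z)) + conj u * (f z * conj b)) =
   (al * conj (g z) + f z * conj be) + (u * a + al) * conj (u * b + be).
  by rewrite !rmorphD !rmorphM /=; ring.
have u0 := nc_ge0 u.
move: (h1) (h2); set ep := Num.min _ _ => h1' h2'.
have ep1 : ep <= 1 by rewrite /ep ge_min lexx.
have epk : ep * k <= e / 2 by rewrite -ler_pdivlMr// /ep ge_min lexx orbT.
have ua : nc (u * a + al) <= nc u * (nc a + 1).
  apply: le_trans (ler_ncD _ _) _; rewrite Normc.normcM mulrDr mulr1.
  rewrite lerD2l; apply: le_trans h1' _; nra.
have ub : nc (u * b + be) <= nc u * (nc b + 1).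
  apply: le_trans (ler_ncD _ _) _; rewrite Normc.normcM mulrDr mulr1.
  rewrite lerD2l; apply: le_trans h2' _; nra.
apply: le_trans (ler_ncD _ _) _; have -> : e * nc u = e / 2 * nc u + e / 2 * nc u by field.
apply: lerD.
  apply: le_trans (ler_ncD _ _) _; rewrite !Normc.normcM !nc_conj.
  have H1 : nc al * nc (g z) <= ep * nc u * nc (g z) by rewrite ler_wpM2r.
  have H2 : nc (f z) * nc be <= nc (f z) * (ep * nc u) by rewrite ler_wpM2l.
  have H3 : ep * k * nc u <= e / 2 * nc u by rewrite ler_wpM2r.
  have ep0 : 0 <= ep * nc u by rewrite mulr_ge0// ltW.
  by move: H3; rewrite /k; nra.
rewrite Normc.normcM nc_conj.
have H := ler_pM (nc_ge0 _) (nc_ge0 _) ua ub; apply: le_trans H _.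
have -> : nc u * (nc a + 1) * (nc u * (nc b + 1)) = nc u * m * nc u by rewrite /m; ring.
by rewrite ler_wpM2r// -ler_pdivlMr// ltW.
Qed.

(** Small real multiples of 1 and of i as increments give X + Y = 0 and X - Y = 0. *)
Lemma real_expansion0 g X Y (d : R) : 0 < d -> real_expansion g X Y ->
  (forall u, nc u < d -> g u = 0) -> X = 0.
Proof.
move=> d0 hg g0.
have lin k : nc k = 1 -> k * X + conj k * Y = 0.
  move=> k1; apply: nc_le0 => e e0; have [d' d'0 hd'] := hg e e0.
  pose t := Num.min d d' / 2; have t0 : 0 < t by rewrite divr_gt0// lt_min d0.
  have td : t < d by apply: lt_le_trans (_ : t < Num.min d d') _;
    [rewrite /t ltr_pdivrMr// mulr_natr mulr2n ltrDl lt_min d0 | rewrite ge_min lexx].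
  have td' : t < d' by apply: lt_le_trans (_ : t < Num.min d d') _;
    [rewrite /t ltr_pdivrMr// mulr_natr mulr2n ltrDl lt_min d0 | rewrite ge_min lexx orbT].
  have nt : nc ((t%:C)%C * k) = t by rewrite Normc.normcM k1 mulr1 nc_real gtr0_norm.
  have := hd' ((t%:C)%C * k); rewrite nt => /(_ td').
  rewrite !g0 ?Normc.normc0 ?nt// subrr sub0r normcN conjcM conjc_real.
  rewrite -!mulrA -mulrDr Normc.normcM nc_real gtr0_norm// mulrC ler_pM2r//.
have h1 : X + Y = 0 by have := lin 1 (Normc.normc1 _); rewrite rmorph1 !mul1r.
have h2 : X - Y = 0.
  have := lin I (nc_I R); have -> : conj I = - I by rewrite /= /conjc; congr (_ +i* _)%C; rewrite oppr0.
  rewrite mulNr -mulrBr => /eqP; rewrite mulf_eq0 => /orP[/eqP I0|/eqP//].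
  by have := nc_I R; rewrite I0 Normc.normc0 => /eqP; rewrite eq_sym oner_eq0.
have : X * 2 = 0 by rewrite -[RHS](addr0 0) -{1}h1 -h2; ring.
by move=> /eqP; rewrite mulf_eq0 pnatr_eq0 orbF => /eqP.
Qed.

(** The identity is differentiated by d / dz, for which the factors conj(B_i) are constants; the
    result is the coefficient of [u] in the real expansion. *)
Lemma diagonal_deriv (T : finType) (A B : T -> C -> C) p (r : R) :
  (forall i, holo_disc p r (A i)) -> (forall i, holo_disc p r (B i)) ->
  (forall z, nc (z - p) < r -> \sum_i A i z * conj (B i z) = 0) ->
  forall z, nc (z - p) < r -> \sum_i cder (A i) z * conj (B i z) = 0.
Proof.
move=> hA hB AB0 z hz.
have E i : real_expansion (fun u => A i (z + u) * conj (B i (z + u)))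
    (cder (A i) z * conj (B i z)) (A i z * conj (cder (B i) z)).
  by apply: real_expansionM; apply: cderE; [exact: hA|exact: hB].
apply: (real_expansion0 (d := r - nc (z - p)) _ (real_expansion_sum E)).
  by rewrite subr_gt0.
by move=> u hu; apply: AB0; have := ler_ncD u (z - p); rewrite addrA (addrC u); lra.
Qed.

(** For fixed [w], iterating [diagonal_deriv] shows that all derivatives of the holomorphic function
    of z on the left vanish at z = w, and [flat_disc] centred at [w] applies. *)
Lemma polarization (T : finType) (A B : T -> C -> C) p (r : R) :
  (forall i, holo_disc p r (A i)) -> (forall i, holo_disc p r (B i)) ->
  (forall z, nc (z - p) < r -> \sum_i A i z * conj (B i z) = 0) ->
  forall z w, nc (w - p) < r -> nc (z - w) < (r - nc (w - p)) / 8 ->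
  \sum_i A i z * conj (B i w) = 0.
Proof.
move=> hA hB AB0 z w hw hz.
have D j : forall z, nc (z - p) < r -> \sum_i iter j (@cder R) (A i) z * conj (B i z) = 0.
  elim: j => // j IH v hv.
  by apply: (diagonal_deriv (A := fun i => iter j (@cder R) (A i))) hv => // i; exact: holo_iter.
apply: (@flat_disc R w (r - nc (w - p))
  (fun j z => \sum_i iter j (@cder R) (A i) z * conj (B i w))) hz => //.
- by rewrite subr_gt0.
- move=> j v hv; apply: cderiv_sum => i _.
  have hvr : nc (v - p) < r by have := ler_ncD (v - w) (w - p); rewrite addrA subrK; lra.
  have := cderivM (cderE (holo_iter j (hA i) hvr)) (cderiv_cst (conj (B i w)) v).
  by rewrite mulr0 add0r mulrC.
- by move=> j; exact: D.
Qed.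

Definition sesquiholo p (r : R) (Phi : C -> C -> C) :=
  exists (T : finType) (A B : T -> C -> C),
  [/\ forall i, holo_disc p r (A i), forall i, holo_disc p r (B i) &
      forall z w, Phi z w = \sum_i A i z * conj (B i w)].

Lemma sesquiholoD p r Phi Psi : sesquiholo p r Phi -> sesquiholo p r Psi ->
  sesquiholo p r (fun z w => Phi z w + Psi z w).
Proof.
move=> [T [A [B [hA hB E]]]] [T' [A' [B' [hA' hB' E']]]].
exists (T + T')%type, (fun i => match i with inl i => A i | inr i => A' i end),
  (fun i => match i with inl i => B i | inr i => B' i end).
by split; [case|case|move=> z w; rewrite big_sumType /= E E'].
Qed.

Lemma holo_discM p r f g : holo_disc p r f -> holo_disc p r g ->
  holo_disc p r (fun z => f z * g z).
Proof.
by move=> hf hg z hz; have [l dl] := hf z hz; have [k dk] := hg z hz;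
  eexists; exact: cderivM dl dk.
Qed.

Lemma sesquiholoM p r Phi Psi : sesquiholo p r Phi -> sesquiholo p r Psi ->
  sesquiholo p r (fun z w => Phi z w * Psi z w).
Proof.
move=> [T [A [B [hA hB E]]]] [T' [A' [B' [hA' hB' E']]]].
exists (T * T')%type, (fun i z => A i.1 z * A' i.2 z), (fun i z => B i.1 z * B' i.2 z).
split=> [i|i|z w]; [exact: holo_discM|exact: holo_discM|].
rewrite E E' big_distrlr /= pair_big; apply: eq_bigr => i _ /=.
by rewrite rmorphM mulrACA.
Qed.

Lemma sesquiholoN p r Phi : sesquiholo p r Phi ->
  sesquiholo p r (fun z w => - Phi z w).
Proof.
move=> [T [A [B [hA hB E]]]]; exists T, (fun i z => - A i z), B; split=> //.
  by move=> i z /(hA i)[l dl]; exists (- l); exact: cderivN.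
by move=> z w; rewrite E -sumrN; apply: eq_bigr => i _; rewrite mulNr.
Qed.

Lemma sesquiholo_polarization p r Phi : sesquiholo p r Phi ->
  (forall z, nc (z - p) < r -> Phi z z = 0) ->
  forall z w, nc (w - p) < r -> nc (z - w) < (r - nc (w - p)) / 8 -> Phi z w = 0.
Proof.
move=> [T [A [B [hA hB E]]]] Phi0 z w hw hz; rewrite E.
by apply: polarization hz => // v hv; rewrite -E; exact: Phi0.
Qed.

End Polarization.

(** * Curvature of kernels on a disc *)

Section KernelsOnDisc.
Variable R : realType.
Local Notation C := (R[i]%C).
Local Notation nc := (@Normc.normc R).
Local Notation conj := (@conjc R).

Definition hker (T : finType) (X Y : T -> C -> C) (z w : C) : C :=
  \sum_i X i z * conj (Y i w).

Definition dfam (T : finType) (X : T -> C -> C) : T -> C -> C := fun i => cder (X i).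

(* |X|^4 d dbar log |X|^2, polarized. *)
Definition hker_curv (T : finType) (X : T -> C -> C) (z w : C) : C :=
  hker X X z w * hker (dfam X) (dfam X) z w -
  hker (dfam X) X z w * hker X (dfam X) z w.

Lemma hker_conj (T : finType) (X Y : T -> C -> C) z w :
  conj (hker X Y z w) = hker Y X w z.
Proof.
rewrite [LHS]rmorph_sum; apply: eq_bigr => i _.
by rewrite [LHS]rmorphM /= conjcK mulrC.
Qed.

Lemma hker_deriv (T : finType) (X Y : T -> C -> C) p r z w :
  (forall i, holo_disc p r (X i)) -> nc (z - p) < r ->
  cderiv (fun z => hker X Y z w) z (hker (dfam X) Y z w).
Proof.
move=> hX hz; apply: cderiv_sum => i _.
have := cderivM (cderE (hX i z hz)) (cderiv_cst (conj (Y i w)) z).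
by rewrite mulr0 add0r mulrC.
Qed.

Lemma sesquiholo_hker (T : finType) (X Y : T -> C -> C) p r :
  (forall i, holo_disc p r (X i)) -> (forall i, holo_disc p r (Y i)) ->
  sesquiholo p r (hker X Y).
Proof. by move=> hX hY; exists T, X, Y. Qed.

Lemma holo_dfam (T : finType) (X : T -> C -> C) p r :
  (forall i, holo_disc p r (X i)) -> forall i, holo_disc p r (dfam X i).
Proof. by move=> hX i; exact: holo_cder. Qed.

Lemma sesquiholo_curv (T : finType) (X : T -> C -> C) p r :
  (forall i, holo_disc p r (X i)) -> sesquiholo p r (hker_curv X).
Proof.
move=> hX; have hX' := holo_dfam hX.
apply: sesquiholoD; first by apply: sesquiholoM; exact: sesquiholo_hker.
by apply: sesquiholoN; apply: sesquiholoM; exact: sesquiholo_hker.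
Qed.

(** The quotient is the derivative of log K(z, w) in the conjugate of [w], so its z-derivative is
    the polarized d dbar log K. *)
Lemma hker_log_deriv (T : finType) (X : T -> C -> C) p r z w :
  (forall i, holo_disc p r (X i)) -> nc (z - p) < r -> hker X X z w != 0 ->
  cderiv (fun z => hker X (dfam X) z w / hker X X z w) z
    (hker_curv X z w / hker X X z w ^+ 2).
Proof.
move=> hX hz h0.
have := cderivM (hker_deriv (dfam X) w hX hz) (cderivV (f := fun z => hker X X z w) h0 (hker_deriv X w hX hz)).
congr (cderiv _ _ _); rewrite /hker_curv; move: h0.
move: (hker X X z w) (hker X (dfam X) z w) (hker (dfam X) X z w)
  (hker (dfam X) (dfam X) z w) => a b c d a0.
by field.
Qed.

Section Line.
Variables (TH TP TF : finType) (H : TH -> C -> C) (P : TP -> C -> C) (F : TF -> C -> C).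
Variable r : R.
Hypothesis r_gt0 : 0 < r.
Hypotheses (hH : forall i, holo_disc 0 (20 * r) (H i))
  (hP : forall i, holo_disc 0 (20 * r) (P i))
  (hF : forall i, holo_disc 0 (20 * r) (F i)).
Hypotheses (H0 : forall t s, nc t < r -> nc s < r -> hker H H t s != 0)
  (P0 : forall t s, nc t < r -> nc s < r -> hker P P t s != 0)
  (F0 : forall t s, nc t < r -> nc s < r -> hker F F t s != 0).
Hypothesis curv : forall t, nc t < 20 * r ->
  hker_curv H t t * (hker P P t t ^+ 2 * hker F F t t ^+ 2) =
  (hker_curv P t t * hker F F t t ^+ 2 + hker_curv F t t * hker P P t t ^+ 2) *
    hker H H t t ^+ 2.

Let r20 t : nc t < r -> nc (t - 0) < 20 * r.
Proof. by rewrite subr0; have := r_gt0; lra. Qed.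

Let curv_polar t s : nc t < r -> nc s < r ->
  hker_curv H t s / hker H H t s ^+ 2 =
  hker_curv P t s / hker P P t s ^+ 2 + hker_curv F t s / hker F F t s ^+ 2.
Proof.
move=> ht hs.
have SH := sesquiholo_hker hH hH; have SP := sesquiholo_hker hP hP.
have SF := sesquiholo_hker hF hF.
have := sesquiholo_polarization (sesquiholoD
  (sesquiholoM (sesquiholo_curv hH) (sesquiholoM (sesquiholoM SP SP) (sesquiholoM SF SF)))
  (sesquiholoN (sesquiholoM (sesquiholoD
    (sesquiholoM (sesquiholo_curv hP) (sesquiholoM SF SF))
    (sesquiholoM (sesquiholo_curv hF) (sesquiholoM SP SP))) (sesquiholoM SH SH)))) _
  (z := t) (w := s) (r20 hs).
(* The source of the factor 20: |t - s| < 2 r, while the right side exceeds 19 r / 8. *)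
have hts : nc (t - s) < (20 * r - nc (s - 0)) / 8.
  by have := ler_ncB t s; rewrite subr0; have := r_gt0; lra.
move=> /(_ _ hts) E.
have {}E := E ltac:(by move=> z; rewrite subr0 => /curv; rewrite !expr2 => ->; rewrite subrr).
move: E (H0 ht hs) (P0 ht hs) (F0 ht hs).
move: (hker H H t s) (hker P P t s) (hker F F t s) (hker_curv H t s)
  (hker_curv P t s) (hker_curv F t s) => a b c x y z E a0 b0 c0.
have {}E : x * (b ^+ 2 * c ^+ 2) = (y * c ^+ 2 + z * b ^+ 2) * a ^+ 2.
  by apply/eqP; rewrite -subr_eq0 !expr2; apply/eqP.
apply: (mulIf (_ : a ^+ 2 * b ^+ 2 * c ^+ 2 != 0)).
  by rewrite !mulf_neq0 ?expf_neq0.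
transitivity (x * (b ^+ 2 * c ^+ 2)); first by field.
by rewrite E; field; rewrite b0 c0.
Qed.

Let q t s := hker H H t s / (hker P P t s * hker F F t s).

(** The mixed derivative of log q vanishes. Hence the logarithmic derivative of q in its first
    argument is the same for the second arguments [s] and 0 ([Lsum]), so q(t, s) / q(t, 0) is
    constant in [t] ([G]). *)
Lemma line_diastasis t s : nc t < r -> nc s < r -> q t s * q 0 0 = q t 0 * q 0 s.
Proof.
move=> ht hs; have r0 : nc 0 < r by rewrite Normc.normc0.
pose L (T : finType) (X : T -> C -> C) t s := hker (dfam X) X t s / hker X X t s.
have Lsum v : nc v < r -> L _ H v s - (L _ P v s + L _ F v s) =
    L _ H v 0 - (L _ P v 0 + L _ F v 0).
  move=> hv.
  (* Hermitian symmetry exchanges the arguments: [N] is holomorphic in [u], and its conjugate is the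
     logarithmic derivative of q with [u] in the second place. *)
  pose N u := hker H (dfam H) u v / hker H H u v -
    (hker P (dfam P) u v / hker P P u v + hker F (dfam F) u v / hker F F u v).
  have NL u : conj (N u) = L _ H v u - (L _ P v u + L _ F v u).
    by rewrite /N /L [LHS]rmorphB [X in _ - X]rmorphD /= !fmorph_div /= !hker_conj.
  rewrite -!NL; congr conj; apply: (@holo_deriv0_cst R 0 r); rewrite ?subr0// => u.
  rewrite subr0 => hu.
  have := cderivB (hker_log_deriv hH (r20 hu) (H0 hu hv))
    (cderivD (hker_log_deriv hP (r20 hu) (P0 hu hv))
       (hker_log_deriv hF (r20 hu) (F0 hu hv))).
  by rewrite curv_polar// subrr.
pose num u := hker H H u s * (hker P P u 0 * hker F F u 0).
pose den u := hker H H u 0 * (hker P P u s * hker F F u s).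
have den0 u : nc u < r -> den u != 0.
  by move=> hu; rewrite !mulf_neq0 ?H0 ?P0 ?F0.
have G : num t / den t = num 0 / den 0.
  apply: (@holo_deriv0_cst R 0 r (fun u => num u / den u)); rewrite ?subr0// => u.
  rewrite subr0 => hu; have hu' := r20 hu.
  have dn := cderivM (hker_deriv H s hH hu')
    (cderivM (hker_deriv P 0 hP hu') (hker_deriv F 0 hF hu')).
  have dd := cderivM (hker_deriv H 0 hH hu')
    (cderivM (hker_deriv P s hP hu') (hker_deriv F s hF hu')).
  have := cderivM dn (cderivV (f := den) (den0 u hu) dd).
  congr (cderiv _ _ _); have := Lsum u hu; rewrite /L /den.
  move: (H0 hu hs) (P0 hu hs) (F0 hu hs) (H0 hu r0) (P0 hu r0) (F0 hu r0).
  move: (hker H H u s) (hker P P u s) (hker F F u s).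
  move: (hker H H u 0) (hker P P u 0) (hker F F u 0).
  move: (hker (dfam H) H u s) (hker (dfam P) P u s) (hker (dfam F) F u s).
  move: (hker (dfam H) H u 0) (hker (dfam P) P u 0) (hker (dfam F) F u 0).
  move=> a' b' c' x' y' z' a b c x y z x0 y0 z0 a0 b0 c0 E.
  transitivity (x * b * c / (a * y * z) *
    ((x' / x - (y' / y + z' / z)) - (a' / a - (b' / b + c' / c)))).
    by field; rewrite ?a0 ?b0 ?c0 ?x0 ?y0 ?z0.
  by rewrite E subrr mulr0.
move: G; rewrite /q /num /den.
move: (H0 ht hs) (P0 ht hs) (F0 ht hs) (H0 ht r0) (P0 ht r0) (F0 ht r0).
move: (H0 r0 hs) (P0 r0 hs) (F0 r0 hs) (H0 r0 r0) (P0 r0 r0) (F0 r0 r0).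
move: (hker H H t s) (hker P P t s) (hker F F t s).
move: (hker H H t 0) (hker P P t 0) (hker F F t 0).
move: (hker H H 0 s) (hker P P 0 s) (hker F F 0 s).
move: (hker H H 0 0) (hker P P 0 0) (hker F F 0 0).
move=> a1 b1 c1 a2 b2 c2 a3 b3 c3 a4 b4 c4.
move=> n1 n2 n3 n4 n5 n6 n7 n8 n9 n10 n11 n12 G.
transitivity (a1 / (b1 * c1) * (a3 / (b3 * c3)) * (a4 * (b3 * c3) / (a3 * (b4 * c4)))).
  by field; rewrite ?n1 ?n2 ?n3 ?n4 ?n5 ?n6 ?n7 ?n8 ?n9 ?n10 ?n11 ?n12.
by rewrite G; field; rewrite ?n1 ?n2 ?n3 ?n4 ?n5 ?n6 ?n7 ?n8 ?n9 ?n10 ?n11 ?n12.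
Qed.

End Line.
End KernelsOnDisc.

(** * The Fubini-Study form *)

Section FubiniStudyForm.
Variable R : realType.
Local Notation C := (R[i]%C).
Local Notation nc := (@Normc.normc R).
Local Notation I := ('i%C : C).
Local Notation conj := (@conjc R).
Variable N : nat.
Implicit Types (z v w x : 'rV[C]_N).

Definition nsq z : R := 1 + \sum_(i < N) nc (z 0 i) ^+ 2.

Lemma nsq_gt0 z : 0 < nsq z.
Proof. by rewrite ltr_pwDl// sumr_ge0// => i _; exact: sqr_ge0. Qed.

Definition nsq_slope z v : R := 2 * \sum_(i < N) complex.Re (z 0 i * conj (v 0 i)).

Lemma nc_sqE (a : C) : nc a ^+ 2 = complex.Re a ^+ 2 + complex.Im a ^+ 2.
Proof. by case: a => x y; rewrite /= sqr_sqrtr// addr_ge0// sqr_ge0. Qed.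

(** On a real line [nsq] is a quadratic polynomial in [t], from which its real derivatives are read
    off. *)
Lemma nsq_line z v (t : R) : nsq (z + (t%:C)%C *: v) =
  nsq z + (nsq_slope z v * t + (\sum_(i < N) nc (v 0 i) ^+ 2) * t ^+ 2).
Proof.
rewrite /nsq /nsq_slope -addrA; congr (1 + _).
rewrite mulr_sumr !mulr_suml -!big_split; apply: eq_bigr => i _ /=.
rewrite !mxE !nc_sqE; case: (z 0 i) => a b; case: (v 0 i) => c d /=; ring.
Qed.

Lemma nsq_derive z v :
  is_derive (0 : R) (1 : R) (fun t => nsq (z + (t%:C)%C *: v)) (nsq_slope z v).
Proof.
rewrite (_ : (fun t => _) = (fun t => nsq z + (nsq_slope z v * t +
  (\sum_(i < N) nc (v 0 i) ^+ 2) * t ^+ 2))); last first.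
  by apply/funext => t; exact: nsq_line.
apply: is_derive_eq; rewrite /GRing.scale /=; ring.
Qed.

Lemma line0 z v : z + ((0 : R)%:C)%C *: v = z.
Proof. by rewrite scale0r addr0. Qed.

Lemma real_deriveP (F : 'rV[C]_N -> C) z v (l : C) :
  is_derive (0 : R) (1 : R) (fun t : R => complex.Re (F (z + (t%:C)%C *: v))) (complex.Re l) ->
  is_derive (0 : R) (1 : R) (fun t : R => complex.Im (F (z + (t%:C)%C *: v))) (complex.Im l) ->
  real_derive v F z = l.
Proof.
move=> [_ h1] [_ h2]; rewrite /real_derive !derive1E h1 h2.
by case: l {h1 h2}.
Qed.

Lemma FS_potential_derive z v :
  real_derive v (fun w => ((FS_potential w)%:C)%C) z = ((nsq_slope z v / nsq z)%:C)%C.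
Proof.
apply: real_deriveP => /=; last exact: is_derive_cst.
have D := nsq_derive z v; have n0 := nsq_gt0 z.
have D' : is_derive (nsq (z + ((0 : R)%:C)%C *: v)) 1 (@ln R) (nsq z)^-1.
  by rewrite line0; exact: is_derive1_ln.
have := @is_derive1_comp R (@ln R) (fun t => nsq (z + (t%:C)%C *: v)) 0 _ _ D' D.
by rewrite mulrC.
Qed.

Lemma nsq_slope_delta z k : nsq_slope z (delta_mx 0 k) = 2 * complex.Re (z 0 k) /\
  nsq_slope z (I *: delta_mx 0 k) = 2 * complex.Im (z 0 k).
Proof.
split; congr (2 * _); rewrite (bigD1 k)//= big1 ?addr0.
- by rewrite mxE !eqxx; case: (z 0 k) => a b /=; ring.
- move=> i ik; rewrite mxE (negPf ik) andbF; case: (z 0 i) => a b /=; ring.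
- by rewrite !mxE !eqxx; case: (z 0 k) => a b /=; ring.
- move=> i ik; rewrite !mxE (negPf ik) andbF; case: (z 0 i) => a b /=; ring.
Qed.

Lemma FS_wirtinger_bar k z :
  wirtinger_bar k (fun w => ((FS_potential w)%:C)%C) z = ((nsq z)^-1%:C)%C * z 0 k.
Proof.
rewrite /wirtinger_bar !FS_potential_derive.
have [-> ->] := nsq_slope_delta z k.
have n0 := nsq_gt0 z; apply: (mulIf (_ : 2 != 0)); first by rewrite pnatr_eq0.
rewrite divfK ?pnatr_eq0//.
have -> : (2 : C) = (2%:C)%C by rewrite rmorph_nat.
case: (z 0 k) => a b; apply/eqP; rewrite eq_complex /=.
by apply/andP; split; apply/eqP; field; rewrite gt_eqF.
Qed.

Lemma FS_wirtinger_bar_derive k z v :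
  real_derive v (wirtinger_bar k (fun w => ((FS_potential w)%:C)%C)) z =
  ((nsq z)^-1%:C)%C * v 0 k - ((nsq_slope z v / nsq z ^+ 2)%:C)%C * z 0 k.
Proof.
have n0 := nsq_gt0 z; have nN0 : nsq z != 0 by rewrite gt_eqF.
have D := nsq_derive z v.
have DV : is_derive (0 : R) (1 : R) (fun t : R => (nsq (z + (t%:C)%C *: v))^-1)
    (- (nsq z) ^- 2 * nsq_slope z v).
  case: D => D1 D2; split; first by apply: derivableV => //; rewrite line0.
  by rewrite deriveV ?line0// D2 /GRing.scale.
have lin (a b : R) : is_derive (0 : R) (1 : R) (fun t : R => a + t * b) b.
  by apply: is_derive_eq; rewrite /GRing.scale /=; ring.
have prod (a b : R) : is_derive (0 : R) (1 : R)
    (fun t : R => (nsq (z + (t%:C)%C *: v))^-1 * (a + t * b))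
    ((nsq z)^-1 * b - nsq_slope z v / nsq z ^+ 2 * a).
  have L := lin a b; have := is_deriveM DV L; rewrite line0.
  congr (is_derive _ _ _ _); rewrite /GRing.scale /= mul0r addr0; field; exact: nN0.
apply: real_deriveP.
- have := prod (complex.Re (z 0 k)) (complex.Re (v 0 k)).
  congr (is_derive _ _ _ _); last by case: (z 0 k) => a b; case: (v 0 k) => c d /=; ring.
  apply/funext => t; rewrite FS_wirtinger_bar !mxE.
  by case: (z 0 k) => a b; case: (v 0 k) => c d /=; ring.
- have := prod (complex.Im (z 0 k)) (complex.Im (v 0 k)).
  congr (is_derive _ _ _ _); last by case: (z 0 k) => a b; case: (v 0 k) => c d /=; ring.
  apply/funext => t; rewrite FS_wirtinger_bar !mxE.
  by case: (z 0 k) => a b; case: (v 0 k) => c d /=; ring.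
Qed.

Lemma FS_ddbar z j k : ddbar (fun w => ((FS_potential w)%:C)%C) z j k =
  ((nsq z)^-1%:C)%C * (j == k)%:R - ((nsq z ^- 2)%:C)%C * (conj (z 0 j) * z 0 k).
Proof.
rewrite /ddbar mxE /wirtinger !FS_wirtinger_bar_derive.
have [-> ->] := nsq_slope_delta z j.
have n0 := nsq_gt0 z; apply: (mulIf (_ : 2 != 0)); first by rewrite pnatr_eq0.
rewrite divfK ?pnatr_eq0// !mxE eqxx /= (eq_sym k).
have -> : (2 : C) = (2%:C)%C by rewrite rmorph_nat.
have -> : ((j == k)%:R : C) = ((j == k)%:R%:C)%C by rewrite rmorph_nat.
move: ((j == k)%:R) => e.
case: (z 0 k) => a b; case: (z 0 j) => c d; apply/eqP; rewrite eq_complex /=.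
by apply/andP; split; apply/eqP; field; rewrite gt_eqF.
Qed.

(** The value on a vector and its conjugate is what a form of type (1,1) retains when restricted to
    a complex line with velocity [x]. *)
Lemma FS_quadratic w x : (x *m FS N w *m (map_mx conj x)^T) 0 0 =
  (I / (2 * pi)%:C)%C * (((nsq w)^-1%:C)%C * (\sum_j x 0 j * conj (x 0 j)) -
   ((nsq w ^- 2)%:C)%C * ((\sum_j x 0 j * conj (w 0 j)) * (\sum_k w 0 k * conj (x 0 k)))).
Proof.
rewrite /FS -scalemxAr -scalemxAl mxE; congr (_ * _).
rewrite mxE (eq_bigr (fun k => ((nsq w)^-1%:C)%C * (x 0 k * conj (x 0 k)) -
   ((nsq w ^- 2)%:C)%C * ((\sum_j x 0 j * conj (w 0 j)) * (w 0 k * conj (x 0 k))))).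
  by rewrite big_split /= sumrN -!mulr_sumr.
move=> k _; rewrite !mxE.
rewrite (eq_bigr (fun j => ((nsq w)^-1%:C)%C * (x 0 j * (j == k)%:R) -
   ((nsq w ^- 2)%:C)%C * (x 0 j * conj (w 0 j)) * w 0 k)); last first.
  by move=> j _; rewrite FS_ddbar; ring.
rewrite big_split /= sumrN -mulr_suml -!mulr_sumr.
rewrite (bigD1 k)//= big1 ?addr0 => [|j jk]; last by rewrite (negPf jk) mulr0.
by rewrite eqxx mulr1; ring.
Qed.

End FubiniStudyForm.

(** * Kernels in several variables *)

Section SeveralVariables.
Variable R : realType.
Local Notation C := (R[i]%C).
Local Notation nc := (@Normc.normc R).

(** A ball of ['rV[C]_n] with a real radius, the radii of [ball] being elements of C. *)
Definition polydisc n (p : 'rV[C]_n) (e : R) (z : 'rV[C]_n) :=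
  forall i, nc (z 0 i - p 0 i) < e.

Lemma ball_polydisc n (p : 'rV[C]_n) (e : R) z : 0 < e ->
  ball p (e%:C)%C z <-> polydisc p e z.
Proof.
move=> e0; split=> [[_ h] i|h].
  by have := h 0 i; rewrite /ball /= normCE ltcR ncB.
split=> [|i j]; first by rewrite ltcR.
by rewrite (ord1 i) /ball /= normCE ltcR ncB.
Qed.

Lemma nbhs_polydisc n (p : 'rV[C]_n) (A : set 'rV[C]_n) :
  nbhs p A <-> exists2 e : R, 0 < e & forall z, polydisc p e z -> A z.
Proof.
split=> [/nbhs_ballP[_ /= /gt0_realC[e e0 ->] h]|[e e0 h]].
  by exists e => // z /(ball_polydisc p z e0); exact: h.
apply/nbhs_ballP; exists (e%:C)%C; first by rewrite /= ltcR.
by move=> z /(ball_polydisc p z e0); exact: h.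
Qed.

Lemma polydisc_center n (p : 'rV[C]_n) (e : R) : 0 < e -> polydisc p e p.
Proof. by move=> e0 i; rewrite subrr Normc.normc0. Qed.

Lemma polydiscC n (p q : 'rV[C]_n) (e : R) : polydisc p e q -> polydisc q e p.
Proof. by move=> h i; rewrite ncB. Qed.

Lemma polydiscD n (p q z : 'rV[C]_n) (e d : R) :
  polydisc p e q -> polydisc q d z -> polydisc p (e + d) z.
Proof.
move=> h1 h2 i; have := ler_ncD (z 0 i - q 0 i) (q 0 i - p 0 i).
by rewrite addrA subrK; have := h1 i; have := h2 i; lra.
Qed.

Lemma sub_polydisc n (p z : 'rV[C]_n) (e d : R) : e <= d ->
  polydisc p e z -> polydisc p d z.
Proof. by move=> ed h i; exact: lt_le_trans (h i) ed. Qed.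

Lemma polydisc_line n (p u w : 'rV[C]_n) (r : R) (t : C) :
  polydisc p r u -> polydisc p r w ->
  polydisc p (r * (1 + 2 * nc t)) (u + t *: (w - u)).
Proof.
move=> hu hw i; rewrite !mxE.
have -> : u 0 i + t * (w 0 i - u 0 i) - p 0 i =
  (u 0 i - p 0 i) + t * ((w 0 i - p 0 i) - (u 0 i - p 0 i)) by ring.
have h1 := ler_ncD (u 0 i - p 0 i) (t * ((w 0 i - p 0 i) - (u 0 i - p 0 i))).
have h2 := ler_ncB (w 0 i - p 0 i) (u 0 i - p 0 i).
have := hu i; have := hw i; rewrite Normc.normcM in h1; have := nc_ge0 t.
nra.
Qed.

Lemma differentiable_polydisc n N (phi : 'rV[C]_n -> 'rV[C]_N) p (e : R) :
  differentiable phi p -> 0 < e ->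
  exists2 d : R, 0 < d & forall z, polydisc p d z -> polydisc (phi p) e (phi z).
Proof.
move=> /differentiable_continuous cphi e0.
have /cphi : nbhs (phi p) (polydisc (phi p) e) by apply/nbhs_polydisc; exists e.
by move=> /nbhs_polydisc[d d0 hd]; exists d.
Qed.

Lemma line_cderiv n N (phi : 'rV[C]_n -> 'rV[C]_N) u v t i :
  differentiable phi (u + t *: v) ->
  cderiv (fun t => phi (u + t *: v) 0 i) t ((v *m 'J phi (u + t *: v)) 0 i).
Proof.
move=> dphi; apply/cderiv_cvg; rewrite -(deriveEjacobian v dphi).
have D : derivable phi (u + t *: v) v by exact: diff_derivable.
rewrite (_ : (fun h => _) = (fun M : 'rV[C]_N => M 0 i) \o
  (fun h => h^-1 *: ((phi \o shift (u + t *: v)) (h *: v) - phi (u + t *: v)))).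
  exact: cvg_comp D (@coord_continuous _ 1 N 0 i _).
apply/funext => h /=; rewrite !mxE; congr (_ * (phi _ 0 i - _)).
by rewrite (_ : h *: 1 = h); [rewrite scalerDl addrCA | exact: mulr1].
Qed.

(* Homogeneous coordinates of the point [1 : phi z]. *)
Definition hom n N (phi : 'rV[C]_n -> 'rV[C]_N) z : 'rV[C]_(1 + N) :=
  row_mx 1 (phi z).

Lemma hom_line_cderiv n N (phi : 'rV[C]_n -> 'rV[C]_N) u v t
    (y : 'rV[C]_N) :
  (forall j, cderiv (fun t => phi (u + t *: v) 0 j) t (y 0 j)) ->
  forall i, cderiv (fun t => hom phi (u + t *: v) 0 i) t (row_mx (0 : 'rV_1) y 0 i).
Proof.
move=> dy i; rewrite -(splitK i); case: (split i) => j /=.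
  rewrite row_mxEl mxE; apply: eq_cderiv (cderiv_cst (1%:M (0 : 'I_1) j) t) => s.
  by rewrite /hom row_mxEl.
by rewrite row_mxEr; apply: eq_cderiv (dy j) => s; rewrite /hom row_mxEr.
Qed.

(** The set [Z] of points near which the linear form vanishes is open and closed in [Omega]. For
    closedness, a limit point z has some [w] of [Z] nearby, and the one-variable identity theorem
    runs along the complex line from [w] to each point [x] near z. *)
Lemma unique_continuation n N (Omega : set 'rV[C]_n) (phi : 'rV[C]_n -> 'rV[C]_N)
    (c : 'cV[C]_(1 + N)) (p : 'rV[C]_n) (e : R) :
  open Omega -> connected Omega -> holomorphic_on Omega phi -> Omega p -> 0 < e ->
  (forall z, Omega z -> polydisc p e z -> hom phi z *m c = 0) ->
  forall z, Omega z -> hom phi z *m c = 0.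
Proof.
move=> oO cO hphi Op e0 h0.
pose Z := [set z | Omega z /\
  exists2 d : R, 0 < d & forall w, Omega w -> polydisc z d w -> hom phi w *m c = 0].
have ZO : Z `<=` Omega by move=> z [].
have oZ : open Z.
  rewrite openE => z [Oz [d d0 hd]]; apply/nbhs_polydisc.
  have /nbhs_polydisc[d' d'0 hd'] := open_nbhs_nbhs (conj oO Oz).
  exists (Num.min (d / 2) d'); first by rewrite lt_min divr_gt0.
  move=> w zw; split; first by apply: hd'; apply: sub_polydisc zw; rewrite ge_min lexx orbT.
  exists (d / 2); first by rewrite divr_gt0.
  move=> x Ox wx; apply: hd => //.
  have zw' : polydisc z (d / 2) w by apply: sub_polydisc zw; rewrite ge_min lexx.
  by have := polydiscD zw' wx; rewrite -splitr.
suff -> : Omega = Z by move=> z [Oz [d d0 hd]]; apply: hd => //; exact: polydisc_center.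
apply/esym/(cO Z).
- by exists p; split=> //; exists e.
- by exists Z => //; apply/seteqP; split=> z; [move=> Zz; split=> //; exact: ZO|case].
exists (closure Z); first exact: closed_closure.
apply/seteqP; split=> z; first by move=> Zz; split; [exact: ZO|exact: subset_closure].
move=> [Oz cz]; split=> //.
have /nbhs_polydisc[d d0 hd] := open_nbhs_nbhs (conj oO Oz).
(* For |t| < 19 the line stays within [39 * r] of [z], hence in the polydisc of radius [40 * r]; and
   t = 1, which is the point [x], satisfies 1 < 19 / 8. *)
pose r := d / 40; have r0 : 0 < r by rewrite divr_gt0.
have /cz[w [[Ow [d' d'0 hd']] zw]] : nbhs z (polydisc z r) by apply/nbhs_polydisc; exists r.
exists r => // x Ox zx.
pose g i t := hom phi (w + t *: (x - w)) 0 i * c i 0.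
have inO t : nc (t - 0) < 19 -> Omega (w + t *: (x - w)).
  rewrite subr0 => ht; apply: hd; apply: sub_polydisc (polydisc_line t zw zx).
  by rewrite /r; have := nc_ge0 t; nra.
have hg : holo_disc 0 19 (fun t => \sum_i g i t).
  move=> t /inO /hphi dphi; eexists; apply: cderiv_sum => i _.
  have := hom_line_cderiv (fun j => line_cderiv j dphi) i.
  by move=> D; apply: cderivM D (cderiv_cst _ _).
have sumE t : (hom phi (w + t *: (x - w)) *m c) 0 0 = \sum_i g i t by rewrite mxE.
have M0 : exists M : R, 0 < M /\ forall i, nc ((x - w) 0 i) < M.
  exists (2 * r); split; first by rewrite mulr_gt0.
  move=> i; rewrite !mxE; have := polydiscD (polydiscC zw) zx i; lra.
have [M [M1 hM]] := M0.
have near0 t : nc (t - 0) < Num.min (d' / M) 19 -> \sum_i g i t = 0.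
  rewrite lt_min => /andP[ht1 ht2]; rewrite -sumE hd' ?mxE//; first exact: inO.
  move=> i; rewrite !mxE addrAC subrr add0r Normc.normcM; have := hM i; rewrite !mxE => h.
  rewrite subr0 ltr_pdivlMr// in ht1; apply: le_lt_trans ht1.
  by rewrite ler_wpM2l ?nc_ge0// ltW.
have : \sum_i g i 1 = 0.
  apply: (holo_vanish_near (r := 19) _ hg (d := Num.min (d' / M) 19)) => //.
  - by rewrite lt_min divr_gt0//=; lra.
  - by rewrite subr0 Normc.normc1; lra.
rewrite -sumE scale1r addrC subrK => h.
by apply/matrixP => a b; rewrite (ord1 a) (ord1 b) h mxE.
Qed.

End SeveralVariables.

(** * Factorization of the kernel ratio near a point *)

Section Factorization.
Variable R : realType.
Local Notation C := (R[i]%C).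
Local Notation nc := (@Normc.normc R).
Local Notation conj := (@conjc R).

Definition kern n N (phi : 'rV[C]_n -> 'rV[C]_N) z w : C :=
  \sum_i hom phi z 0 i * conj (hom phi w 0 i).

Lemma kern_conj n N (phi : 'rV[C]_n -> 'rV[C]_N) z w :
  conj (kern phi z w) = kern phi w z.
Proof.
rewrite [LHS]rmorph_sum; apply: eq_bigr => i _.
by rewrite [LHS]rmorphM /= conjcK mulrC.
Qed.

Lemma kernE n N (phi : 'rV[C]_n -> 'rV[C]_N) z w :
  kern phi z w = 1 + \sum_j phi z 0 j * conj (phi w 0 j).
Proof.
rewrite /kern big_split_ord big_ord1 /hom !row_mxEl.
have -> : (1 : 'rV[C]_1) 0 ord0 = 1 by rewrite mxE eqxx.
rewrite conjc1 mulr1.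
by congr (_ + _); apply: eq_bigr => j _; rewrite !row_mxEr.
Qed.

Lemma kern_diag n N (phi : 'rV[C]_n -> 'rV[C]_N) z :
  kern phi z z = ((nsq (phi z))%:C)%C.
Proof.
rewrite kernE /nsq [RHS]rmorphD /= rmorph1 [in RHS]rmorph_sum /=.
congr (_ + _); apply: eq_bigr => j _; case: (phi z 0 j) => a b.
apply/eqP; rewrite eq_complex /= sqr_sqrtr ?addr_ge0 ?sqr_ge0//.
by apply/andP; split; apply/eqP; ring.
Qed.

Lemma kern_neq0 n N (phi : 'rV[C]_n -> 'rV[C]_N) p :
  differentiable phi p -> exists2 d : R, 0 < d &
    forall z w, polydisc p d z -> polydisc p d w -> kern phi z w != 0.
Proof.
move=> dphi; pose e : R := (2 * N.+1%:R)^-1.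
have e0 : 0 < e by rewrite invr_gt0 mulr_gt0.
have [d d0 hd] := differentiable_polydisc dphi e0.
exists d => // z w /hd hz /hd hw; apply/eqP => K0.
have : complex.Re (kern phi z w) = 0 by rewrite K0.
rewrite kernE.
have -> : complex.Re (1 + \sum_j phi z 0 j * conj (phi w 0 j)) =
    1 + \sum_j complex.Re (phi z 0 j * conj (phi w 0 j)).
  rewrite -[LHS]/((@complex.Re R : Rcomplex R -> R) _) raddfD raddf_sum; congr (_ + _).
(* Completing the square, |a| ^ 2 - 2 e |a| - e ^ 2 >= - 2 e ^ 2 whatever the value [a] of the
   coordinate at [p]; so the size of [e] depends on [N] alone. *)
move=> Re0; have lb j : - (2 * e ^+ 2) <= complex.Re (phi z 0 j * conj (phi w 0 j)).
  have := hz j; have := hw j; set a := phi p 0 j.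
  have -> : phi z 0 j = a + (phi z 0 j - a) by rewrite addrC subrK.
  have -> : phi w 0 j = a + (phi w 0 j - a) by rewrite addrC subrK.
  rewrite ![a + _ - a]addrAC !subrr !add0r.
  move: (phi z 0 j - a) (phi w 0 j - a) => x y hy hx.
  have -> : (a + x) * conj (a + y) = a * conj a + (a * conj y + x * conj a) + x * conj y.
    by rewrite conjcD; ring.
  have ReD (s t : C) : complex.Re (s + t) = complex.Re s + complex.Re t.
    by case: s; case: t.
  have lo (s : C) : - nc s <= complex.Re s by have := Re_le_nc s; rewrite ler_norml => /andP[].
  rewrite !ReD Re_conjM.
  have := lo (a * conj y); have := lo (x * conj a); have := lo (x * conj y).
  rewrite !Normc.normcM !nc_conj; have := nc_ge0 x; have := nc_ge0 y; have := nc_ge0 a.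
  move: (complex.Re _) (complex.Re _) (complex.Re _) => r1 r2 r3 a0 y0 x0 h1 h2 h3.
  have := sqr_ge0 (nc a - e); nra.
have lbs : (- (2 * e ^+ 2)) *+ N <= \sum_j complex.Re (phi z 0 j * conj (phi w 0 j)).
  by rewrite -[X in _ *+ X]card_ord -sumr_const; apply: ler_sum => j _; exact: lb.
have eN : 2 * e * (N%:R + 1) = 1.
  by rewrite natr1 /e mulrAC divff// mulf_neq0 ?pnatr_eq0.
have ex : 0 <= e * N%:R by rewrite mulr_ge0 ?ler0n// ltW.
have h2 : 2 * e ^+ 2 * N%:R = e - 2 * e ^+ 2.
  apply: (addIr (2 * e ^+ 2)); rewrite subrK.
  transitivity (2 * e * (N%:R + 1) * e); first by ring.
  by rewrite eN mul1r.
rewrite -(mulr_natr (- (2 * e ^+ 2)) N) mulNr h2 in lbs.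
have := sqr_ge0 e; lra.
Qed.

(** Bridge from forms to kernels of one variable. The velocity [y] is kept abstract: it is [v] times
    the Jacobian for [h] and [f], and [v] itself for [id], where [FS n] occurs without a
    pullback. *)
Lemma curv_FS n N (phi : 'rV[C]_n -> 'rV[C]_N) u v t (y : 'rV[C]_N) :
  (forall j, cderiv (fun t => phi (u + t *: v) 0 j) t (y 0 j)) ->
  let X := fun i t => hom phi (u + t *: v) 0 i in
  (y *m FS N (phi (u + t *: v)) *m (map_mx conj y)^T) 0 0 =
  ('i / (2 * pi)%:C)%C * (hker_curv X t t / hker X X t t ^+ 2).
Proof.
move=> dy X; rewrite FS_quadratic; congr (_ * _).
have dX i : dfam X i t = row_mx (0 : 'rV_1) y 0 i.
  exact/cderP/(hom_line_cderiv dy).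
set w := phi (u + t *: v).
have h0 : hker X X t t = ((nsq w)%:C)%C := kern_diag phi (u + t *: v).
have h1 : hker (dfam X) (dfam X) t t = \sum_j y 0 j * conj (y 0 j).
  rewrite /hker big_split_ord big_ord1 !dX !row_mxEl !mxE mul0r /= add0r.
  by apply: eq_bigr => j _; rewrite !dX !row_mxEr.
have h2 : hker (dfam X) X t t = \sum_j y 0 j * conj (w 0 j).
  rewrite /hker big_split_ord big_ord1 !dX !row_mxEl !mxE mul0r /= add0r.
  by apply: eq_bigr => j _; rewrite !dX /X /hom !row_mxEr.
have h3 : hker X (dfam X) t t = \sum_j w 0 j * conj (y 0 j).
  rewrite /hker big_split_ord big_ord1 !dX !row_mxEl !mxE conjc0 mulr0 /= add0r.
  by apply: eq_bigr => j _; rewrite !dX /X /hom !row_mxEr.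
rewrite /hker_curv h0 h1 h2 h3.
have n0 : ((nsq w)%:C)%C != 0 :> C.
  by rewrite (inj_eq (@complexI R)) gt_eqF// nsq_gt0.
rewrite fmorphV fmorphV rmorphXn /=.
move: (\sum_j _) (\sum_j _) (\sum_j _) => a b c; field; exact: n0.
Qed.

Lemma twopi_neq0 : ('i / (2 * pi)%:C)%C != 0 :> C.
Proof.
rewrite mulf_neq0//.
  by apply/eqP => -[] /eqP; rewrite oner_eq0.
by rewrite invr_eq0 (inj_eq (@complexI R)) mulf_neq0 ?pnatr_eq0// gt_eqF// pi_gt0.
Qed.

Section Local.
Variables (n m d : nat) (Omega : set 'rV[C]_n).
Variables (h : 'rV[C]_n -> 'rV[C]_m) (f : 'rV[C]_n -> 'rV[C]_d).
Hypothesis oO : open Omega.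
Hypotheses (hh : holomorphic_on Omega h) (hf : holomorphic_on Omega f).
Hypothesis eqn : forall z, Omega z -> pullback h (FS m) z = one_modification f z.

Definition kratio z w : C := kern h z w / (kern id z w * kern f z w).

Lemma kratio_conj z w : conj (kratio z w) = kratio w z.
Proof. by rewrite /kratio [LHS]fmorph_div /= [X in _ / X]rmorphM /= !kern_conj. Qed.

Let id_deriv (u v : 'rV[C]_n) t j :
  cderiv (fun t => (id : 'rV[C]_n -> 'rV[C]_n) (u + t *: v) 0 j) t (v 0 j).
Proof.
have D := cderivD (cderiv_cst (u 0 j) t) (cderivM (cderiv_id t) (cderiv_cst (v 0 j) t)).
by rewrite mulr0 !add0r mulr1 in D; apply: eq_cderiv D => s; rewrite !mxE.
Qed.

Lemma curv_equation u v t : Omega (u + t *: v) ->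
  let X N (phi : 'rV[C]_n -> 'rV[C]_N) := fun i t => hom phi (u + t *: v) 0 i in
  hker_curv (X _ h) t t / hker (X _ h) (X _ h) t t ^+ 2 =
  hker_curv (X _ id) t t / hker (X _ id) (X _ id) t t ^+ 2 +
  hker_curv (X _ f) t t / hker (X _ f) (X _ f) t t ^+ 2.
Proof.
move=> Ox X; apply: (mulfI twopi_neq0); rewrite [RHS]mulrDr.
have Eh := curv_FS (fun j => line_cderiv j (hh Ox)).
have Ef := curv_FS (fun j => line_cderiv j (hf Ox)).
have Ei := curv_FS (id_deriv u v t).
rewrite -[LHS]Eh -[X in _ = X + _]Ei -[X in _ = _ + X]Ef {Eh Ei Ef}.
have cmx N (J : 'M[C]_(n, N)) (B : 'M[C]_N) :
    (v *m J *m B *m (map_mx conj (v *m J))^T) 0 0 =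
    (v *m (J *m B *m (map_mx conj J)^T) *m (map_mx conj v)^T) 0 0.
  by rewrite map_mxM trmx_mul !mulmxA.
have := congr1 (fun A => (v *m A *m (map_mx conj v)^T) 0 0) (eqn Ox).
rewrite /= /one_modification mulmxDr mulmxDl [RHS]mxE /pullback -!cmx. exact: id.
Qed.

Lemma local_factorization p : Omega p -> exists2 r : R, 0 < r &
  (forall z, polydisc p r z -> Omega z) /\
  forall z w, polydisc p r z -> polydisc p r w ->
    [/\ kratio z w != 0, kern id z w != 0, kern f z w != 0 &
        kratio z w * kratio p p = kratio z p * kratio p w].
Proof.
move=> Op.
have [e e0 he] : exists2 e : R, 0 < e & forall z, polydisc p e z -> Omega z.
  by apply/nbhs_polydisc; exact: open_nbhs_nbhs (Logic.conj oO Op).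
have [d1 d10 h1] := kern_neq0 (hh Op).
have [d2 d20 h2] := kern_neq0 (hf Op).
have [d3 d30 h3] := @kern_neq0 _ _ (id : 'rV[C]_n -> 'rV[C]_n) p (ex_diff (f := id) (df := id)).
pose dd := Num.min d1 (Num.min d2 d3).
have dd0 : 0 < dd by rewrite !lt_min d10 d20.
have K0 z w : polydisc p dd z -> polydisc p dd w ->
    [/\ kern h z w != 0, kern id z w != 0 & kern f z w != 0].
  move=> hz hw; split; [apply: h1|apply: h3|apply: h2];
    by apply: (sub_polydisc _ hz) || apply: (sub_polydisc _ hw);
    rewrite /dd !ge_min lexx ?orbT.
have q0 z w : polydisc p dd z -> polydisc p dd w -> kratio z w != 0.
  by move=> hz hw; have [k1 k2 k3] := K0 _ _ hz hw; rewrite !mulf_neq0 ?invr_eq0 ?mulf_neq0.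
(* [line_diastasis] is used with r = 2, which admits t = 1. The line must then stay in [Omega] for
   |t| < 40 and in the polydisc of radius [dd] for |t| < 2; [polydisc_line] gives the factors 81 = 1
   + 2 * 40 and 5 = 1 + 2 * 2. *)
pose r1 := Num.min (e / 81) (dd / 5); have r10 : 0 < r1 by rewrite lt_min !divr_gt0.
have r1e : r1 * 81 <= e by rewrite -ler_pdivlMr// ge_min lexx.
have r1d : r1 * 5 <= dd by rewrite -ler_pdivlMr// ge_min lexx orbT.
have step1 u w : polydisc p r1 u -> polydisc p r1 w ->
    kratio w w * kratio u u = kratio w u * kratio u w.
  move=> hu hw; pose v := w - u.
  pose X N (phi : 'rV[C]_n -> 'rV[C]_N) := fun i t => hom phi (u + t *: v) 0 i.
  have inO t : nc (t - 0) < 20 * 2 -> Omega (u + t *: v).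
    rewrite subr0 => ht; apply: he; apply: sub_polydisc (polydisc_line t hu hw).
    by have := nc_ge0 t; nra.
  have ind t : nc t < 2 -> polydisc p dd (u + t *: v).
    move=> ht; apply: sub_polydisc (polydisc_line t hu hw).
    by have := nc_ge0 t; nra.
  have hX N (phi : 'rV[C]_n -> 'rV[C]_N) : holomorphic_on Omega phi ->
      forall i, holo_disc 0 (20 * 2) (X N phi i).
    move=> hphi i t /inO Ot; eexists.
    exact: (hom_line_cderiv (fun j => line_cderiv j (hphi _ Ot)) i).
  have hid i : holo_disc 0 (20 * 2) (X n id i).
    by move=> t _; eexists; exact: (hom_line_cderiv (id_deriv u v t) i).
  have := @line_diastasis R _ _ _ (X _ h) (X _ id) (X _ f) 2 (ltr0Sn _ _)
    (hX _ _ hh) hid (hX _ _ hf) _ _ _ _ 1 1.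
  have E0 : u + 0 *: v = u by rewrite scale0r addr0.
  have E1 : u + 1 *: v = w by rewrite scale1r /v addrC subrK.
  have XE N (phi : 'rV[C]_n -> 'rV[C]_N) t s :
    hker (X _ phi) (X _ phi) t s = kern phi (u + t *: v) (u + s *: v) by [].
  rewrite !XE E0 E1; apply.
  - by move=> t s /ind ht /ind hs; have [] := K0 _ _ ht hs.
  - by move=> t s /ind ht /ind hs; have [] := K0 _ _ ht hs.
  - by move=> t s /ind ht /ind hs; have [] := K0 _ _ ht hs.
  - move=> t ht; have Ot : Omega (u + t *: v) by apply: inO; rewrite subr0.
    have n1 N (phi : 'rV[C]_n -> 'rV[C]_N) : hker (X _ phi) (X _ phi) t t != 0.
      by rewrite XE kern_diag (inj_eq (@complexI R)) gt_eqF// nsq_gt0.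
    have : hker_curv (X _ h) t t / hker (X _ h) (X _ h) t t ^+ 2 =
        hker_curv (X _ id) t t / hker (X _ id) (X _ id) t t ^+ 2 +
        hker_curv (X _ f) t t / hker (X _ f) (X _ f) t t ^+ 2 := curv_equation Ot.
    move: (n1 _ h) (n1 _ id) (n1 _ f).
    move: (hker (X _ h) (X _ h) t t) (hker (X _ id) (X _ id) t t)
      (hker (X _ f) (X _ f) t t) => a b c.
    move: (hker_curv (X _ h) t t) (hker_curv (X _ id) t t)
      (hker_curv (X _ f) t t) => x y z a0 b0 c0 E.
    transitivity (x / a ^+ 2 * (a ^+ 2 * b ^+ 2 * c ^+ 2)); first by field.
    by rewrite E; field; rewrite b0 c0.
  - by rewrite Normc.normc1; lra.
  - by rewrite Normc.normc1; lra.
(* Lines through [p] are followed for |t| < 9, because 1 < 9 / 8 is what polarization asks at t = 1;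
   the factor is 19 = 1 + 2 * 9. *)
exists (r1 / 19); first by rewrite divr_gt0.
split; first by move=> z hz; apply: he; apply: sub_polydisc hz; lra.
have sub1 z : polydisc p (r1 / 19) z -> polydisc p r1 z by apply: sub_polydisc; lra.
have subd z : polydisc p r1 z -> polydisc p dd z by apply: sub_polydisc; lra.
have pp e' : 0 < e' -> polydisc p e' p := @polydisc_center R n p e'.
move=> z w hz hw.
have dz := subd _ (sub1 _ hz); have dw := subd _ (sub1 _ hw); have dp := pp _ dd0.
have [k1 k2 k3] := K0 _ _ dz dw; split=> //; first exact: q0.
pose x t := p + t *: (z - p).
have x1 t : nc (t - 0) < 9 -> polydisc p r1 (x t).
  rewrite subr0 => ht; have hp : polydisc p (r1 / 19) p by apply: pp; rewrite divr_gt0.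
  by apply: sub_polydisc (polydisc_line t hp hz); have := nc_ge0 t; nra.
have inO t : nc (t - 0) < 9 -> Omega (x t).
  by move=> /x1; move=> hx; apply: he; apply: sub_polydisc hx; lra.
have hk N (phi : 'rV[C]_n -> 'rV[C]_N) y t (l : 'I_(1 + N) -> C) :
    (forall i, cderiv (fun t => hom phi (x t) 0 i) t (l i)) ->
    exists l, cderiv (fun t => kern phi (x t) y) t l.
  move=> dl; eexists; apply: cderiv_sum => j _.
  by apply: cderivM (dl j) (cderiv_cst _ _).
have hq y t : polydisc p dd y -> nc (t - 0) < 9 ->
    exists l, cderiv (fun t => kratio (x t) y) t l.
  move=> dy ht; have Ot := inO t ht; have dxt := subd _ (x1 t ht).
  have [j1 j2 j3] := K0 _ _ dxt dy.
  have [l1 D1] := hk _ h y t _ (hom_line_cderiv (fun j => line_cderiv j (hh Ot))).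
  have [l2 D2] := hk _ f y t _ (hom_line_cderiv (fun j => line_cderiv j (hf Ot))).
  have [l3 D3] := hk _ id y t _ (hom_line_cderiv (id_deriv p (z - p) t)).
  eexists; apply: cderivM D1 _.
  by apply: (cderivV (f := fun t => kern id (x t) y * kern f (x t) y) _ (cderivM D3 D2));
    rewrite mulf_neq0.
(* [step1] for the three pairs among [x t], [w] and [p] gives |g(t)| = 1. Polarizing g(t) conj(g(s))
   = 1 from the diagonal to (1, 0), where g(0) = 1, gives g(1) = 1, the claim for [z] and [w]. *)
pose g t := kratio (x t) w * kratio p p / (kratio (x t) p * kratio p w).
have holog : holo_disc 0 9 g.
  move=> t ht; have [l1 D1] := hq w t dw ht; have [l2 D2] := hq p t dp ht.
  have dxt := subd _ (x1 t ht); eexists.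
  apply: cderivM (cderivM D1 (cderiv_cst _ _)) _.
  apply: (cderivV (f := fun t => kratio (x t) p * kratio p w) _
    (cderivM D2 (cderiv_cst _ _))).
  by rewrite mulf_neq0 ?q0.
have S : sesquiholo 0 9 (fun t s => g t * conj (g s) + - (1 * conj 1)).
  apply: sesquiholoD.
    by exists unit, (fun _ => g), (fun _ => g); split=> // t s; rewrite big_const card_unit /= addr0.
  apply: sesquiholoN; exists unit, (fun _ _ => 1), (fun _ _ => 1); split=> [i t _|i t _|t s].
  - by exists 0; exact: cderiv_cst.
  - by exists 0; exact: cderiv_cst.
  - by rewrite big_const card_unit /= addr0.
have gg t : nc (t - 0) < 9 -> g t * conj (g t) + - (1 * conj 1) = 0.
  move=> ht; have hx := x1 t ht; have dx := subd _ hx; have w1 := sub1 _ hw.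
  have p1 := pp _ r10.
  have -> : conj (g t) = kratio w (x t) * kratio p p / (kratio p (x t) * kratio w p).
    rewrite /g [LHS]fmorph_div /= [X in X / _]rmorphM [X in _ / X]rmorphM /=.
    by rewrite !kratio_conj.
  apply/eqP; rewrite conjc1 mul1r subr_eq0; apply/eqP; rewrite /g.
  have s1 := step1 _ _ w1 hx; have s2 := step1 _ _ p1 hx; have s3 := step1 _ _ p1 w1.
  move: s1 s2 s3 (q0 _ _ dx dx) (q0 _ _ dp dp) (q0 _ _ dw dw)
    (q0 _ _ dx dp) (q0 _ _ dp dx) (q0 _ _ dp dw) (q0 _ _ dw dp).
  move: (kratio (x t) w) (kratio w (x t)) (kratio (x t) p) (kratio p (x t)).
  move: (kratio (x t) (x t)) (kratio w w) (kratio p p) (kratio p w) (kratio w p).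
  move=> a b c i j s u v y s1 s2 s3 a0 c0 b0 v0 y0 i0 j0.
  transitivity (s * u * c ^+ 2 / ((v * y) * (i * j))); first by field; rewrite ?v0 ?y0 ?i0 ?j0.
  rewrite -s1 -s2 (mulrC i j) -s3; field; rewrite ?a0 ?b0 ?c0//.
have := sesquiholo_polarization S gg (z := 1) (w := 0).
have x0E : x 0 = p by rewrite /x scale0r addr0.
have x1E : x 1 = z by rewrite /x scale1r addrC subrK.
rewrite !subr0 Normc.normc0 Normc.normc1 subr0 => /(_ _ _) H.
have {H} := H ltac:(lra) ltac:(lra).
have g0 : g 0 = 1.
  by rewrite /g x0E (mulrC (kratio p p)) divff// mulf_neq0 ?q0.
rewrite g0 conjc1 !mulr1 => /eqP; rewrite subr_eq0 /g x1E => /eqP E.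
have nz : kratio z p * kratio p w != 0 by rewrite mulf_neq0 ?q0.
by rewrite -[LHS](divfK nz) E mul1r.
Qed.

End Local.
End Factorization.

(** * Ranks *)

Section Relations.
Variable F : fieldType.

(* [dim_matrix] is stated with the ring product of nat. *)
Let dim_mx m n : dim 'M[F]_(m, n) = (m * n)%N := dim_matrix F m n.

Lemma row_basis m n k (A : 'M[F]_(m, n)) : \rank A = k ->
  exists2 B : 'M_(k, n), row_free B & (B :=: A)%MS.
Proof. by move=> <-; exists (row_base A); [exact: row_base_free | exact: eq_row_base]. Qed.

Lemma dim_limg_le (U V : vectType F) (f : 'Hom(U, V)) (W : {vspace U}) :
  (\dim (f @: W) <= \dim W)%N.
Proof. by rewrite -(limg_ker_dim f W) leq_addl. Qed.

(* The relations sum_b l_b g_b = 0 with affine-linear coefficients l_b.  At a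
   point p with g(p) <> 0, a relation L and its first derivatives show that
   L g(p)^T depends only on the row Z(p) L, which is orthogonal to g(p); and the
   relations with L g(p)^T = 0 are relations between one function fewer. *)
Lemma dim_relations (T : Type) n r (Z : T -> 'rV[F]_(1 + n)) (g : T -> 'rV[F]_r) :
  (forall p, lsubmx (Z p) = 1) ->
  (forall p, exists D : 'M[F]_(n, r), forall L : 'M[F]_(1 + n, r),
     (forall q, Z q *m L *m (g q)^T = 0) ->
     dsubmx L *m (g p)^T + D *m (Z p *m L)^T = 0) ->
  (forall c : 'cV[F]_r, (forall q, g q *m c = 0) -> c = 0) ->
  forall U : {vspace 'M[F]_(1 + n, r)},
    (forall L, L \in U -> forall q, Z q *m L *m (g q)^T = 0) ->
    (\dim U <= 'C(r, 2))%N.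
Proof.
move=> Z1; elim: r g => [|r IH] g jet free U relU.
  by apply: leq_trans (dimvS (subvf U)) _; rewrite dimvf dim_mx muln0.
have [p gp0] : exists p, g p != 0.
  apply: contrapT => h; have /(congr1 (fun c : 'cV_r.+1 => c ord0 ord0)) : const_mx 1 = 0 :> 'cV[F]_r.+1.
    apply: free => q; have [->|q0] := eqVneq (g q) 0; first by rewrite mul0mx.
    by case: h; exists q.
  by rewrite !mxE => /eqP; rewrite oner_eq0.
have [D hD] := jet p.
pose phi : 'Hom('M[F]_(1 + n, r.+1), 'cV[F]_(1 + n)) := linfun (mulmxr (g p)^T).
have phiE L : phi L = L *m (g p)^T by rewrite lfunE.
rewrite -(limg_ker_dim phi U) binS bin1 [leqLHS]addnC [leqRHS]addnC; apply: leq_add.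
  pose psi : 'Hom('rV[F]_r.+1, 'M[F]_1) := linfun (mulmxr (g p)^T).
  (* [M] recovers L g(p)^T from the row Z(p) L: the jet hypothesis gives the lower block, and Z(p) L
     g(p)^T = 0, where Z(p) starts with 1, gives the top entry. The rows lie in the hyperplane
     [lker psi], of dimension r. *)
  pose M : 'M[F]_(1 + n, r.+1) := col_mx (rsubmx (Z p) *m D) (- D).
  pose chi : 'Hom('rV[F]_r.+1, 'cV[F]_(1 + n)) := linfun (mulmx M \o trmx).
  have sub : (phi @: U <= chi @: lker psi)%VS.
    apply/subvP => _ /memv_imgP[L LU ->].
    have LR := relU L LU; have E := hD L LR.
    rewrite phiE; apply/memv_imgP; exists (Z p *m L).
      by rewrite memv_ker lfunE /= LR.
    have dE : dsubmx (L *m (g p)^T) = - (D *m (Z p *m L)^T).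
      by rewrite -mul_dsub_mx; apply/eqP; rewrite -addr_eq0; apply/eqP.
    rewrite lfunE /= -[L *m (g p)^T]vsubmxK dE mul_col_mx mulNmx; congr col_mx.
    have := LR p; rewrite -mulmxA -{1}[Z p]hsubmxK -[L *m (g p)^T]vsubmxK.
    rewrite mul_row_col Z1 mul1mx dE mulmxN => /eqP.
    by rewrite subr_eq0 mulmxA col_mxKu => /eqP.
  apply: leq_trans (dimvS sub) (leq_trans (dim_limg_le _ _) _).
  have := limg_ker_dim psi fullv; rewrite capfv dimvf dim_mx mul1n.
  suff : (0 < \dim (limg psi))%N by move: (\dim _) (\dim _) => a b; lia.
  rewrite lt0n dimv_eq0; apply: contra gp0 => /eqP I0.
  apply/eqP/matrixP => a j; rewrite (ord1 a) mxE.
  have : psi (delta_mx 0 j) \in limg psi by exact: memv_img (memvf _).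
  rewrite I0 memv0 lfunE /= -rowE => /eqP /matrixP /(_ 0 0).
  by rewrite !mxE.
have rk : \rank (kermx (g p)^T) = r.
  rewrite mxrank_ker mxrank_tr.
  have : \rank (g p) = 1%N.
    by apply/eqP; rewrite eqn_leq rank_leq_row lt0n mxrank_eq0.
  by move=> ->; rewrite subn1.
(* The rows of [N] form a basis of the rows orthogonal to g(p). A relation with L g(p)^T = 0 factors
   as [theta L *m N], and [theta L] is a relation between the [r] functions [g q *m N^T]. *)
have [N Nfree NE] := row_basis rk.
have Ngp : N *m (g p)^T = 0.
  by apply/sub_kermxP; rewrite NE.
pose theta : 'Hom('M[F]_(1 + n, r.+1), 'M[F]_(1 + n, r)) := linfun (mulmxr (pinvmx N)).
have thetaK L : L \in (U :&: lker phi)%VS -> theta L *m N = L.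
  rewrite memv_cap memv_ker phiE => /andP[_ /eqP L0].
  by rewrite lfunE /= mulmxKpV// NE; apply/sub_kermxP.
have -> : \dim (U :&: lker phi) = \dim (theta @: (U :&: lker phi)).
  apply/esym/limg_dim_eq/eqP; rewrite -subv0; apply/subvP => L.
  rewrite memv_cap => /andP[LU]; rewrite memv_ker => /eqP t0.
  by rewrite -(thetaK L LU) t0 mul0mx mem0v.
apply: (IH (fun q => g q *m N^T)).
- move=> q; have [D' hD'] := jet q; exists (D' *m N^T) => L hL.
  have := hD' (L *m N); rewrite -mul_dsub_mx !trmx_mul trmxK !mulmxA; apply.
  by move=> q'; have := hL q'; rewrite trmx_mul trmxK !mulmxA.
- move=> c hc; have : N^T *m c = 0.
    by apply: free => q; rewrite mulmxA hc.
  move=> /(congr1 trmx); rewrite trmx_mul trmxK trmx0 => /eqP.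
  rewrite mulmx_free_eq0// => /eqP /(congr1 trmx).
  by rewrite trmxK trmx0.
- move=> _ /memv_imgP[L LU ->] q; have LK := thetaK L LU.
  rewrite trmx_mul trmxK -!mulmxA [theta L *m _]mulmxA LK mulmxA.
  by apply: relU; move: LU; rewrite memv_cap => /andP[].
Qed.

(** Evaluation at finitely many points replaces a family of functions by a matrix of the same rank,
    so that kernels become Gram matrices. *)
Lemma maximal_free_family (T : Type) N (phi : T -> 'rV[F]_N) :
  exists e (y : 'I_e -> T), row_free (\matrix_i phi (y i)) /\
    forall z, (phi z <= \matrix_i phi (y i))%MS.
Proof.
pose P e := `[< exists y : 'I_e -> T, row_free (\matrix_i phi (y i)) >].
have P0 : exists e, P e.
  (* The empty family is given without a point of [T], which may be empty. *)
  exists 0%N; apply/asboolP; exists (fun i : 'I_0 => False_rect _ (not_false_is_true (ltn_ord i))).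
  by rewrite -row_leq_rank leq0n.
have Pb e : P e -> (e <= N)%N.
  by move=> /asboolP[y]; rewrite -row_leq_rank => /leq_trans; apply; exact: rank_leq_col.
case: (ex_maxnP P0 Pb) => e /asboolP[y fy] maxe.
exists e, y; split=> // z; apply: contrapT => /negP nz.
have : P (1 + e)%N.
  apply/asboolP; exists (fun i => match split i with inl _ => z | inr j => y j end).
  set Y := \matrix_i phi (y i).
  have -> : \matrix_i phi (match split i with inl _ => z | inr j => y j end) =
      col_mx (phi z) Y.
    by apply/row_matrixP => i; rewrite rowK -{2}(splitK i); case: (split i) => j /=;
      [rewrite rowKu (ord1 j) row_id | rewrite rowKd rowK].
  have rY : \rank Y = e by apply/eqP.
  have : (\rank Y < \rank (col_mx (phi z) Y))%N.
    apply: rank_ltmx; rewrite ltmxE -addsmxE addsmxSr /=.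
    by apply: contra nz; rewrite col_mx_sub => /andP[].
  by rewrite rY -row_leq_rank.
by move=> /maxe; rewrite add1n ltnn.
Qed.

Lemma rank_diag_scale s (a b : 'I_s -> F) (M : 'M[F]_s) :
  (forall i, a i != 0) -> (forall i, b i != 0) ->
  \rank (\matrix_(i, j) (a i * M i j * b j)) = \rank M.
Proof.
move=> a0 b0; pose Da := diag_mx (\row_i a i); pose Db := diag_mx (\row_i b i).
have -> : \matrix_(i, j) (a i * M i j * b j) = Da *m M *m Db.
  by apply/matrixP => i j; rewrite mul_mx_diag mul_diag_mx !mxE.
have uD (c : 'I_s -> F) : (forall i, c i != 0) -> diag_mx (\row_i c i) \in unitmx.
  by move=> c0; rewrite unitmxE det_diag unitfE; apply/prodf_neq0 => i _; rewrite mxE.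
rewrite mxrankMfree ?row_free_unit ?uD// -mxrank_tr trmx_mul mxrankMfree ?mxrank_tr//.
by rewrite row_free_unit unitmx_tr uD.
Qed.

End Relations.

Section Gram.
Variable R : rcfType.
Local Notation C := (R[i]%C).
Local Notation conj := (@conjc R).

Lemma row_free_gram s N (A : 'M[C]_(s, N)) : row_free A ->
  row_free (A *m (map_mx conj A)^T).
Proof.
move=> fA; apply: inj_row_free => v v0.
have vA0 : v *m A = 0.
  have : ((v *m A) *m (map_mx conj (v *m A))^T) 0 0 = 0.
    by rewrite map_mxM trmx_mul !mulmxA -(mulmxA v) v0 mul0mx mxE.
  rewrite mxE => /eqP.
  rewrite (eq_bigr (fun j => `|(v *m A) 0 j| ^+ 2)) => [|j _]; last by rewrite !mxE sqr_normc.
  rewrite psumr_eq0 => [|j _]; last exact: exprn_ge0.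
  move=> /allP h; apply/matrixP => a j; rewrite (ord1 a) [RHS]mxE.
  by have := h j (mem_index_enum j); rewrite expf_eq0 normr_eq0 => /eqP.
by move: vA0 => /eqP; rewrite mulmx_free_eq0// => /eqP.
Qed.

End Gram.

(** * Rank bounds from the factored kernel *)

Section Ranks.
Variable R : realType.
Local Notation C := (R[i]%C).
Local Notation nc := (@Normc.normc R).
Local Notation conj := (@conjc R).
Variables (n m d : nat) (Omega : set 'rV[C]_n).
Variables (h : 'rV[C]_n -> 'rV[C]_m) (f : 'rV[C]_n -> 'rV[C]_d).
Hypotheses (oO : open Omega) (cO : connected Omega).
Hypotheses (hh : holomorphic_on Omega h) (hf : holomorphic_on Omega f).
Hypothesis h_min : minimally_embedded Omega h.
Variables (p : 'rV[C]_n) (r : R).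
Hypotheses (Op : Omega p) (r_gt0 : 0 < r).
Hypothesis inO : forall z, polydisc p r z -> Omega z.
Hypothesis fac : forall z w, polydisc p r z -> polydisc p r w ->
    [/\ kratio h f z w != 0, kern id z w != 0, kern f z w != 0 &
        kratio h f z w * kratio h f p p = kratio h f z p * kratio h f p w].

Let T := {z | polydisc p r z}.

Definition segre (z : 'rV[C]_n) : 'rV[C]_((1 + n) * (1 + d)) :=
  mxvec ((hom id z)^T *m hom f z).

Let Hmx s (y : 'I_s -> T) := \matrix_i hom h (sval (y i)).
Let Smx s (y : 'I_s -> T) := \matrix_i segre (sval (y i)).

Let gram_row s N (phi : T -> 'rV[C]_N) (y : 'I_s -> T) i j :
  ((\matrix_i phi (y i)) *m (map_mx conj (\matrix_i phi (y i)))^T) i j =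
  \sum_k phi (y i) 0 k * conj (phi (y j) 0 k).
Proof. by rewrite mxE; apply: eq_bigr => k _; rewrite !mxE. Qed.

Lemma segre_gram z w :
  \sum_k segre z 0 k * conj (segre w 0 k) = kern id z w * kern f z w.
Proof.
transitivity ((segre z *m (map_mx conj (segre w))^T) 0 0).
  by rewrite mxE; apply: eq_bigr => k _; rewrite !mxE.
rewrite /segre map_mxvec mxvec_dotmul map_mxM /= mulmxA -mulmxA.
rewrite mxE big_ord1; congr (_ * _); rewrite /kern mxE; apply: eq_bigr => k _.
  by rewrite !mxE.
by rewrite !mxE mulrC.
Qed.

(** By the factorization, [kratio] at (z, w) is a function of z times a function of w, so it
    multiplies the Gram matrix of [segre] on both sides by invertible diagonal matrices. *)
Lemma gram_rank s (y : 'I_s -> T) :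
  \rank (Hmx y *m (map_mx conj (Hmx y))^T) = \rank (Smx y *m (map_mx conj (Smx y))^T).
Proof.
have pp : polydisc p r p := polydisc_center p r_gt0.
have k0 z w : polydisc p r z -> polydisc p r w -> kratio h f z w != 0.
  by move=> hz hw; have [] := fac hz hw.
rewrite -(@rank_diag_scale _ s (fun i => kratio h f (sval (y i)) p)
  (fun j => kratio h f p (sval (y j)) / kratio h f p p)
  (Smx y *m (map_mx conj (Smx y))^T)).
- congr mxrank; apply/matrixP => i j; rewrite [RHS]mxE; cbv beta.
  rewrite [LHS](gram_row (fun q => hom h (sval q)) y i j).
  rewrite [X in _ * X * _](gram_row (fun q => segre (sval q)) y i j) segre_gram.
  rewrite -/(kern h _ _); have [_ ki kf E] := fac (svalP (y i)) (svalP (y j)).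
  rewrite [kern h _ _](_ : _ = kratio h f (sval (y i)) (sval (y j)) *
    (kern id (sval (y i)) (sval (y j)) * kern f (sval (y i)) (sval (y j)))).
    move: E (k0 p p pp pp); move: (kratio h f (sval (y i)) (sval (y j)))
      (kratio h f p p) (kratio h f (sval (y i)) p) (kratio h f p (sval (y j)))
      (kern id _ _ * kern f _ _) => a b c e k E b0.
    by apply: (mulIf b0); rewrite mulrAC E; field.
  by rewrite /kratio divfK ?mulf_neq0.
- by move=> i; apply: k0 => //; exact: svalP.
- move=> i; rewrite mulf_neq0 ?invr_eq0 ?k0//; exact: svalP.
Qed.

Lemma segre_free_le s (y : 'I_s -> T) : row_free (Smx y) -> (s <= 1 + m)%N.
Proof.
move=> /row_free_gram /eqP; rewrite -gram_rank => <-.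
by apply: leq_trans (mxrankM_maxl _ _) (rank_leq_col _).
Qed.

(** A linear form that kills a maximal free family kills [hom h] on the polydisc, then on [Omega] by
    unique continuation, and minimality makes it zero; so the family has full rank. *)
Lemma hom_free_family : exists y : 'I_(1 + m) -> T, row_free (Hmx y).
Proof.
have [e [y [fy maxy]]] := maximal_free_family (fun q : T => hom h (sval q)).
suff full : row_full (\matrix_i hom h (sval (y i))).
  have e1 : e = (1 + m)%N := etrans (esym (eqP fy)) (eqP full).
  by subst e; exists y.
rewrite /row_full -mxrank_tr -/(row_free _); apply: inj_row_free => v v0.
have c0 z : Omega z -> hom h z *m v^T = 0.
  apply: (unique_continuation oO cO hh Op r_gt0) => {}z Oz hz.
  have [k ->] := submxP (maxy (exist _ z hz)).
  by rewrite -mulmxA -[X in _ *m X]trmxK trmx_mul trmxK v0 trmx0 mulmx0.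
pose W := lker (linfun (mulmxr v^T) : 'Hom('rV[C]_(1 + m), 'M[C]_1)).
have W1 : W = fullv.
  by apply: h_min => z /c0 hz; rewrite memv_ker lfunE /= hz.
apply: trmx_inj; rewrite trmx0; apply/matrixP => i j; rewrite (ord1 j) [RHS]mxE.
have : delta_mx 0 i \in W by rewrite W1 memvf.
by rewrite memv_ker lfunE /= -rowE => /eqP/matrixP/(_ 0 0); rewrite !mxE.
Qed.

(** Since [hom f] stays in the span of [e] rows, the vectors [segre] stay in the image of a space of
    dimension [(1 + n) * e], while 1 + m of them are independent. *)
Lemma rank_upper e (y : 'I_e -> T) :
  (forall q : T, (hom f (sval q) <= \matrix_i hom f (sval (y i)))%MS) ->
  (1 + m <= (1 + n) * e)%N.
Proof.
move=> fy; have [x /row_free_gram /eqP] := hom_free_family.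
rewrite gram_rank => <-; apply: leq_trans (mxrankM_maxl _ _) _.
set Y := \matrix_i hom f (sval (y i)) in fy.
have -> : Smx x = (\matrix_i mxvec ((hom id (sval (x i)))^T *m
    (hom f (sval (x i)) *m pinvmx Y))) *m lin_mx (mulmxr Y).
  apply/row_matrixP => i; rewrite row_mul !rowK mul_vec_lin /=.
  by rewrite -mulmxA mulmxKpV.
by apply: leq_trans (mxrankM_maxl _ _) (rank_leq_col _).
Qed.

(** Rank-nullity for the [(1 + n) * k] products z_a g_b of [k] independent combinations g_b of 1,
    f_1, ..., f_d: their rank is at most 1 + m, and [dim_relations] bounds their relations. *)
Lemma rank_lower k (y : 'I_k -> T) : row_free (\matrix_i hom f (sval (y i))) ->
  ((1 + n) * k <= 'C(k, 2) + (1 + m))%N.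
Proof.
set Y := \matrix_i hom f (sval (y i)) => fY.
(* [A] normalizes the combinations: [g] takes the unit vectors as values at the points [y i], whence
   its components are independent. *)
pose A := pinvmx Y; have YA : Y *m A = 1%:M by exact: mulmxVp.
pose g (q : T) := hom f (sval q) *m A.
pose tens (q : T) := mxvec ((hom id (sval q))^T *m g q).
have [s [x [fx maxx]]] := maximal_free_family tens.
have sm : (s <= 1 + m)%N.
  apply: (@segre_free_le s x).
  have E : \matrix_i tens (x i) = Smx x *m lin_mx (mulmxr A).
    by apply/row_matrixP => i; rewrite row_mul !rowK mul_vec_lin /= -mulmxA.
  rewrite -row_leq_rank; apply: leq_trans (mxrankM_maxl (Smx x) (lin_mx (mulmxr A))).
  by rewrite -E row_leq_rank.
pose X := \matrix_i tens (x i).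
pose ev : 'Hom('M[C]_(1 + n, k), 'cV[C]_s) := linfun (mulmx X \o trmx \o mxvec).
pose U := lker ev.
have dU : ((1 + n) * k <= \dim U + s)%N.
  have := limg_ker_dim ev fullv; rewrite capfv dimvf.
  have -> : dim 'M[C]_(1 + n, k) = ((1 + n) * k)%N := dim_matrix _ _ _.
  move=> <-; rewrite leq_add2l; apply: leq_trans (dimvS (subvf _)) _.
  rewrite dimvf; have -> : dim 'cV[C]_s = (s * 1)%N := dim_matrix _ _ _.
  by rewrite muln1.
suff : (\dim U <= 'C(k, 2))%N by move: (\dim U) dU sm => u; lia.
apply: (@dim_relations _ T n k (fun q => hom id (sval q)) g).
- by move=> q; rewrite row_mxKl.
(* [D] is the derivative of [g] at [q]; the product rule applied to the relation along the i-th
   coordinate direction is row i of the required identity. *)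
- move=> [q hq] /=; exists ((row_mx 0 ('J f q)) *m A) => L hL.
  apply/matrixP => i j; rewrite (ord1 j) {j} [RHS]mxE.
  have Oq := inO hq.
  pose pt t := q + t *: (delta_mx 0 i : 'rV[C]_n).
  have pt0 : pt 0 = q by rewrite /pt scale0r addr0.
  have df : differentiable f (pt 0) by rewrite pt0; exact: hf.
  pose z' := row_mx (0 : 'rV[C]_1) (delta_mx 0 i : 'rV[C]_n).
  pose f' := row_mx (0 : 'rV[C]_1) (delta_mx 0 i *m 'J f q).
  have Df b : cderiv (fun t => hom f (pt t) 0 b) 0 (f' 0 b).
    have := hom_line_cderiv (fun j => line_cderiv j df) b.
    by rewrite -/(pt 0) pt0.
  have Di a : cderiv (fun t => hom id (pt t) 0 a) 0 (z' 0 a).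
    apply: hom_line_cderiv => j.
    have D := cderivD (cderiv_cst (q 0 j) 0)
      (cderivM (cderiv_id 0) (cderiv_cst ((delta_mx 0 i : 'rV[C]_n) 0 j) 0)).
    by rewrite mul0r !add0r mulr1 in D; apply: eq_cderiv D => t; rewrite !mxE.
  pose M := L *m A^T.
  have S v w : (v *m L *m (w *m A)^T) 0 0 = \sum_a v 0 a * \sum_b M a b * w 0 b.
    rewrite trmx_mul !mulmxA -(mulmxA _ L) -/M -mulmxA mxE.
    apply: eq_bigr => a _; congr (_ * _).
    by rewrite mxE; apply: eq_bigr => b _; rewrite [w^T _ _]mxE.
  have DP : cderiv (fun t => \sum_a hom id (pt t) 0 a * \sum_b M a b * hom f (pt t) 0 b) 0
      (\sum_a (hom id (pt 0) 0 a * (\sum_b M a b * f' 0 b) +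
        (\sum_b M a b * hom f (pt 0) 0 b) * z' 0 a)).
    apply: cderiv_sum => a _; apply: (cderivM (Di a)).
    by apply: cderiv_sum => b _; exact: cderivZ.
  have dr : 0 < r - nc (q 0 i - p 0 i) by rewrite subr_gt0.
  have DP0 : \sum_a (hom id (pt 0) 0 a * (\sum_b M a b * f' 0 b) +
        (\sum_b M a b * hom f (pt 0) 0 b) * z' 0 a) = 0.
    apply: cderiv_unique DP (cderiv_near dr _ (cderiv_cst 0 0)) => t.
    rewrite subr0 => ht; have ptt : polydisc p r (pt t).
      move=> j; rewrite !mxE eqxx /=; have [->|ji] := eqVneq j i.
        by rewrite mulr1 addrAC; have := ler_ncD (q 0 i - p 0 i) t; lra.
      by rewrite mulr0 addr0; exact: hq.
    by rewrite -S (hL (exist _ (pt t) ptt)) mxE.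
  rewrite pt0 big_split /= in DP0.
  rewrite -[RHS]DP0 [LHS]mxE addrC; congr (_ + _).
    rewrite -S; transitivity ((row i (row_mx 0 ('J f q) *m A *m (hom id q *m L)^T)) 0 0).
      by rewrite [RHS]mxE.
    rewrite !row_mul row_row_mx row0 rowE -/f' -[f' *m A *m _]trmxK [LHS]mxE.
    by rewrite trmx_mul trmxK.
  transitivity ((z' *m L *m (hom f q *m A)^T) 0 0).
    rewrite -{2}[L]vsubmxK mul_row_col mul0mx add0r -rowE -row_mul.
    by rewrite [RHS]mxE.
  by rewrite S; apply: eq_bigr => a _; rewrite mulrC.
- move=> c hc; apply/row_matrixP => i.
  rewrite row0 -[c]mul1mx -YA -mulmxA row_mul rowK mulmxA.
  exact: hc (y i).
- move=> L LU q; rewrite -mxvec_dotmul -/(tens q).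
  have [c ->] := submxP (maxx q).
  move: LU; rewrite memv_ker lfunE /= => /eqP LU.
  by rewrite -mulmxA LU mulmx0.
Qed.

End Ranks.

Theorem corollary1p3 (R : realType) (n m : nat) (n_gt0 : (0 < n)%N)
  (m_gt0 : (0 < m)%N)
  (Omega : set 'rV[R[i]%C]_n) (Omega_neq0 : Omega !=set0)
  (Omega_open : open Omega) (Omega_connected : connected Omega)
  (h : 'rV[R[i]%C]_n -> 'rV[R[i]%C]_m)
  (h_holo : holomorphic_on Omega h)
  (h_min : minimally_embedded Omega h)
  (k : int)
  (lt_m : n%:Z * (k + 1) + k < m%:Z)
  (m_lt : m%:Z < n%:Z * (k + 2) - ((k * (k + 1)) %/ 2)%Z) :
  ~ exists (d : nat) (f : 'rV[R[i]%C]_n -> 'rV[R[i]%C]_d),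
      [/\ (0 < d)%N, holomorphic_on Omega f
        & forall z, Omega z -> pullback h (FS m) z = one_modification f z].
Proof.
move=> [d [f [_ f_holo eqn]]]; have [p Op] := Omega_neq0.
have [r r_gt0 [inO fac]] := local_factorization Omega_open h_holo f_holo eqn Op.
have [e [y [fy maxy]]] :=
  maximal_free_family (fun q : {z | polydisc p r z} => hom f (sval q)).
(* For k <= -2 the upper bound on [m] would be at most 0. *)
have k_gtN2 : -2 < k.
  rewrite ltNge; apply/negP => k_le.
  have kk : 0 <= k * (k + 1) by nia.
  have := divz_ge0 (k * (k + 1)) (isT : 0 < 2 :> int); rewrite kk => kk2.
  nia.
(* With j = k + 1 the bounds involve natural numbers only, and k (k + 1) / 2 is the binomial
   coefficient ['C(j, 2)], also for j = 0. *)
have [j kE] : exists j : nat, k = j%:Z - 1.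
  by exists (absz (k + 1)); lia.
have halfE : ((k * (k + 1)) %/ 2)%Z = 'C(j, 2)%:Z.
  have -> : k * (k + 1) = 'C(j, 2)%:Z * 2.
    rewrite kE; have := bin_ffact j 2; rewrite ffactnS ffactn1.
    have -> : 2`! = 2%N by [].
    by case: j {kE} => [|j] /=; nia.
  by rewrite mulzK.
rewrite halfE kE in m_lt; rewrite kE in lt_m.
have [e_le|e_gt] := leqP e j.
  have := rank_upper Omega_open Omega_connected h_holo h_min Op r_gt0 fac maxy.
  have : ((1 + n) * e <= (1 + n) * j)%N by rewrite leq_mul2l e_le orbT.
  nia.
(* The first j + 1 = k + 2 points of the family are enough: as 'C(j + 1, 2) = 'C(j, 2) + j,
   [rank_lower] reads m >= n (k + 2) - k (k + 1) / 2. *)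
pose y' (i : 'I_j.+1) := y (widen_ord e_gt i).
have fy' : row_free (\matrix_i hom f (sval (y' i))).
  apply: inj_row_free => v v0.
  pose P : 'M[R[i]%C]_(j.+1, e) := rowsub (widen_ord e_gt) 1%:M.
  have vP0 : v *m P = 0.
    apply/eqP; rewrite -(mulmx_free_eq0 _ fy) -mulmxA mul_rowsub_mx mul1mx -v0.
    by apply/eqP; congr (_ *m _); apply/matrixP => a b; rewrite !mxE.
  apply/matrixP => a b; rewrite (ord1 a) [RHS]mxE.
  have := congr1 (fun A : 'rV_e => A 0 (widen_ord e_gt b)) vP0.
  rewrite !mxE (bigD1 b)//= big1 => [|c cb]; last first.
    by rewrite !mxE -val_eqE /= val_eqE (negPf cb) mulr0.
  by rewrite !mxE eqxx mulr1 addr0.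
have := rank_lower f_holo r_gt0 inO fac fy'.
rewrite binS bin1; nia.
Qed.
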